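(* Assume that the equidistribution statement (E) formulated in the context holds. Then there exists $\kappa_0\ge2$ such that for any fixed Diophantine $\alpha$ of type $\kappa\le\kappa_0$, there exists $s=s(\kappa)>0$ such that for any bounded interval $A\subset\mathbb{R}$, $$R_{2,N}(A;\varphi_N)=|A|+O\left(N^{-s}\right)$$ as $N\to\infty$, where $\varphi_N(z)=\frac{(z-\alpha)^2}{2N}$.
   Context: An irrational $\alpha\in\mathbb{R}$ is Diophantine of type $\kappa>0$ if there exists $C>0$ such that $\left|\alpha-\frac{p}{q}\right|>\frac{C}{q^{\kappa}}$ for all $p\in\mathbb{Z}$, $q\in\mathbb{N}$ (necessarily $\kappa\ge2$). For a bounded interval $A\subset\mathbb{R}$ of length $|A|$, $$R_{2,N}(A;\varphi)=\frac{\#\{(i,j)\in\{1,\dots,N\}^2 : i\neq j,\ \varphi(i)-\varphi(j)\in N^{-1}A+\mathbb{Z}\}}{N}.$$ Let $\mathbb{H}(\mathbb{R})$ be the Heisenberg group of matrices $\begin{pmatrix}1&u&\xi_1\\0&1&\xi_2\\0&0&1\end{pmatrix}$ with $u,\xi_1,\xi_2\in\mathbb{R}$, written in coordinates as $(u,\xi_1,\xi_2)$, and $\mathbb{H}(\mathbb{Z})$ its subgroup of matrices with integer entries. Let $\mu_H$ be the Haar measure on $\mathbb{H}(\mathbb{R})$ normalized so that it induces a probability measure, also denoted $\mu_H$, on $\mathbb{H}(\mathbb{Z})\backslash\mathbb{H}(\mathbb{R})$. For $f\in C^k(\mathbb{H}(\mathbb{Z})\backslash\mathbb{H}(\mathbb{R}))$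 let $\|f\|_{C^k}=\sum_{\operatorname{ord}D\le k}\|Df\|_\infty$, the sum being over all monomials $D$ of degree $\le k$ in the standard basis elements of the Lie algebra of $\mathbb{H}(\mathbb{R})$ (regarded as left-invariant differential operators). For $\nu\in C^\infty(\mathbb{R})$ of compact support, $\|\nu\|_{C^l}=\sum_{0\le j\le l}\|\nu^{(j)}\|_\infty$ and $\hat\nu(\xi)=\int_{\mathbb{R}}\nu(x)e^{-2\pi i x\xi}\,dx$. $\phi$ is the Euler totient function. Statement (E) (a conjecture): There exist $k,l\in\mathbb{N}$ and $\kappa_0\ge2$ such that for any fixed Diophantine $\alpha$ of type $\kappa\le\kappa_0$ there exists $s=s(\kappa)>0$ such that for any $f\in C^k(\mathbb{H}(\mathbb{Z})\backslash\mathbb{H}(\mathbb{R}))$ and any $\nu\in C^\infty(\mathbb{R})$ supported on $[-L,L]$ ($L\ge1$), $$\frac{1}{\phi(c)}\sum_{\substack{d\in\mathbb{Z}\\(c,d)=1}}\nu\left(\frac dc\right)f\left(\frac ac,\,b\alpha+\frac a2,\,d\alpha+\frac c2\right)=\hat\nu(0)\int_{\mathbb{H}(\mathbb{Z})\backslash\mathbb{H}(\mathbb{R})}f\,d\mu_H+O\left(L\|\nu\|_{C^l}\|f\|_{C^k}c^{-s}\right)$$ as $c\to\infty$ through positive integers, where for each $d$, $(a,b)$ are any integers solving $ad-bc=1$, and the implied constant does not depend on $f,\nu,L,c$. *)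

(* Defs.v *)
From HB Require Import structures.
From mathcomp Require Import all_boot all_order all_algebra.
From mathcomp Require Import all_classical all_reals all_analysis.
From mathcomp Require Import ring lra.

Set Implicit Arguments.
Unset Strict Implicit.
Unset Printing Implicit Defensive.

Import Order.TTheory GRing.Theory Num.Theory.
Import numFieldNormedType.Exports.

Local Open Scope classical_set_scope.
Local Open Scope ring_scope.

(* kappa-Diophantine irrationals; the denominators q range over q >= 1 *)
Definition diophantine (R : realType) (kappa alpha : R) : Prop :=
  [/\ 0 < kappa, irrational alpha &
      exists2 C : R, 0 < C &
        forall (p : int) (q : nat), (0 < q)%N ->
          C / q%:R `^ kappa < `|alpha - p%:~R / q%:R| ].

(* (i, j) : 'I_N * 'I_N stands for the pair (i + 1, j + 1) in {1, ..., N}^2 *)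
Definition pair_correlation (R : realType) (N : nat) (A : set R)
    (phi : R -> R) : R :=
  #|[pred ij : 'I_N * 'I_N | (ij.1 != ij.2) &&
      `[< exists2 x : R, A x & exists m : int,
            phi ij.1.+1%:R - phi ij.2.+1%:R = x / N%:R + m%:~R >]]|%:R / N%:R.

Definition supnorm (R : realType) (T : Type) (f : T -> R) : R :=
  sup (range (fun x => `|f x|)).

Section heisenberg.
Context {R : realType}.
Local Notation mR := (measurableTypeR R).
Local Notation mu := (@lebesgue_measure R).

(* (u, xi1, xi2) *)
Definition heis : Type := (R * R * R)%type.

Definition hmul (x y : heis) : heis :=
  (x.1.1 + y.1.1, x.1.2 + y.1.2 + x.1.1 * y.2, x.2 + y.2).

Definition heis_mx (x : heis) : 'M[R]_3 :=
  \matrix_(i < 3, j < 3)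
    if i == j then 1
    else if (i == 0 :> nat) && (j == 1 :> nat) then x.1.1
    else if (i == 0 :> nat) && (j == 2 :> nat) then x.1.2
    else if (i == 1 :> nat) && (j == 2 :> nat) then x.2
    else 0.

Lemma heis_mxM (x y : heis) : heis_mx (hmul x y) = heis_mx x *m heis_mx y.
Proof.
apply/matrixP => i j; rewrite !mxE !big_ord_recl big_ord0 !mxE.
by case: i => [[|[|[|//]]] ?]; case: j => [[|[|[|//]]] ?];
  rewrite /hmul -!(inj_eq val_inj) /= ?bump0 /=; ring.
Qed.

Definition hint (m n1 n2 : int) : heis := (m%:~R, n1%:~R, n2%:~R).

(* functions on the quotient of H(R) by H(Z) acting on the left *)
Definition HZ_invariant (f : heis -> R) : Prop :=
  forall (m n1 n2 : int) (x : heis), f (hmul (hint m n1 n2) x) = f x.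

(* exp(t X) for X = E_12, E_13, E_23, the standard basis of the Lie algebra;
   X ^ 2 = 0, so exp(t X) = 1 + t X *)
Definition hexp (i : 'I_3) (t : R) : heis :=
  (t *+ (i == 0 :> nat), t *+ (i == 1 :> nat), t *+ (i == 2 :> nat)).

Definition lderiv (i : 'I_3) (f : heis -> R) : heis -> R :=
  fun x => derive1 (fun t : R => f (hmul x (hexp i t))) 0.

(* A C^k function is one all of whose iterated derivatives of order <= k along
   the left-invariant frame exist and are continuous *)
Fixpoint Ck (k : nat) (f : heis -> R) : Prop :=
  continuous f /\
  if k is k'.+1 then
    forall i : 'I_3,
      (forall x, derivable (fun t : R => f (hmul x (hexp i t))) 0 1) /\
      Ck k' (lderiv i f)
  else True.

(* the monomials of degree n are the words of length n in the basis elements *)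
Definition Ck_norm (k : nat) (f : heis -> R) : R :=
  \sum_(n < k.+1) \sum_(w : n.-tuple 'I_3) supnorm (foldr lderiv f w).

Definition lebesgue2 : set (mR * mR) -> \bar R :=
  (lebesgue_measure \x lebesgue_measure)%E.

HB.instance Definition _ := Measure.on lebesgue2.

(* the library's sigma-finite instance on products is shadowed by the one for
   subprobabilities *)
Let lebesgue2_sigma_finite : sigma_finite setT lebesgue2.
Proof.
have /sigma_finiteP[F [TF ndF Foo]] := sigma_finiteT (@lebesgue_measure R).
exists (fun n => F n `*` F n).
  rewrite -setXTT TF predeqE => -[x y]; split.
    move=> [/= [n _ Fnx] [k _ Fky]]; exists (maxn n k) => //; split.
    - by move: x Fnx; exact/subsetPset/ndF/leq_maxl.
    - by move: y Fky; exact/subsetPset/ndF/leq_maxr.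
  by move=> [n _ []/= ? ?]; split; exists n.
move=> k; have [? ?] := Foo k; split; first exact: measurableX.
by rewrite /lebesgue2 product_measure1E// lte_mul_pinfty// ge0_fin_numE.
Qed.

HB.instance Definition _ := Measure_isSigmaFinite.Build _ _ _ lebesgue2
  lebesgue2_sigma_finite.

(* Haar measure: Lebesgue measure in the coordinates (u, xi1, xi2), which
   is invariant under left translations (haar_left_invariant) and gives measure
   1 to the fundamental domain of H(Z) (haar_fund_dom, fund_domP) *)
Definition haar : set (mR * mR * mR) -> \bar R :=
  (lebesgue2 \x lebesgue_measure)%E.

HB.instance Definition _ := Measure.on haar.

Lemma measurable_addr (t : R) :
  measurable_fun setT ((fun x : R => x + t) : mR -> mR).
Proof.
by apply: (@measurable_realfun.measurable_funD);
  [exact: measurable_id|exact: measurable_cst].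
Qed.

Lemma lebesgue_measure_addr (t : R) (A : set mR) : measurable A ->
  pushforward mu ((fun x : R => x + t) : mR -> mR) A = mu A.
Proof.
move=> mA; apply/esym/lebesgue_measure_unique => //=.
  exact: measurable_addr.
move=> _ _ [[a b]] _ <-; rewrite /pushforward/=.
rewrite (_ : _ @^-1` _ = `](a - t), (b - t)]%classic); last first.
  by apply/seteqP; split=> x /=; rewrite !in_itv/= ltrBlDr lerBrDr.
rewrite !lebesgue_measure_itv/= !lte_fin ltrD2r -!EFinD.
by case: ifP => // _; congr (_%:E); ring.
Qed.

Lemma lebesgue2_addr (s t : R) (A : set (mR * mR)) : measurable A ->
  pushforward lebesgue2
    ((fun x => (x.1 + s, x.2 + t)) : mR * mR -> mR * mR) A = lebesgue2 A.
Proof.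
move=> mA; apply/esym/product_measure_unique => //=.
  apply: measurable_fun_pair.
    exact: (measurableT_comp (measurable_addr s)).
  exact: (measurableT_comp (measurable_addr t)).
move=> ms B C mB mC; rewrite /pushforward/=.
rewrite (_ : _ @^-1` _ = ((fun x : R => x + s) @^-1` B) `*`
  ((fun x : R => x + t) @^-1` C)) // /lebesgue2.
rewrite product_measure1E.
- by congr (_ * _)%E; exact: lebesgue_measure_addr.
- by rewrite -[X in measurable X]setTI; exact: measurable_addr.
- by rewrite -[X in measurable X]setTI; exact: measurable_addr.
Qed.

Lemma haarE (A : set (mR * mR * mR)) : measurable A ->
  haar A = (\int[mu]_z lebesgue2 (ysection A z))%E.
Proof.
move=> mA; rewrite /haar.
rewrite (@product_measure_unique _ _ _ _ _ _ _ (lebesgue2 \x^ mu)%E) //.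
by move=> B C mB mC; apply: product_measure2E.
Qed.

Lemma measurable_hmul (g : heis) :
  measurable_fun setT (hmul g : mR * mR * mR -> mR * mR * mR).
Proof.
have m1 : measurable_fun setT (fun x : mR * mR * mR => x.1.1 : mR).
  exact: (measurableT_comp (measurable_fst) measurable_fst).
have m2 : measurable_fun setT (fun x : mR * mR * mR => x.1.2 : mR).
  exact: (measurableT_comp (measurable_snd) measurable_fst).
have m3 : measurable_fun setT (fun x : mR * mR * mR => x.2 : mR).
  exact: measurable_snd.
apply: measurable_fun_pair; first apply: measurable_fun_pair.
- apply: (@measurable_realfun.measurable_funD) => //; exact: measurable_cst.
- apply: (@measurable_realfun.measurable_funD) => //.
    apply: (@measurable_realfun.measurable_funD) => //; exact: measurable_cst.
  apply: (@measurable_realfun.measurable_funM) => //; exact: measurable_cst.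
- apply: (@measurable_realfun.measurable_funD) => //; exact: measurable_cst.
Qed.

Lemma haar_left_invariant (g : heis) (A : set (mR * mR * mR)) :
  measurable A -> haar (hmul g @^-1` A) = haar A.
Proof.
move=> mA.
have mgA : measurable (hmul g @^-1` A : set (mR * mR * mR)).
  by rewrite -[X in measurable X]setTI; exact: measurable_hmul.
rewrite (haarE mgA) (haarE mA).
have mF := @measurable_fun_ysection _ _ _ _ _ lebesgue2 _ mA.
set F := (lebesgue2 \o ysection A) in mF.
transitivity (\int[mu]_z (F \o ((fun x : R => x + g.2)%R : mR -> mR)) z)%E.
  apply: eq_integral => z _; rewrite /F /=.
  have := @lebesgue2_addr g.1.1 (g.1.2 + g.1.1 * (z : R))
    (ysection A (z + g.2 : R)) (measurable_ysection _ mA).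
  move=> <-; rewrite /pushforward; congr (lebesgue2 _).
  apply/seteqP; split=> -[x y]; rewrite /ysection/= !inE/= /hmul/=;
    rewrite (addrC x) (addrC z) (addrC y) addrAC //.
have /= <- := @ge0_integral_pushforward _ _ _ _ _ _ (measurable_addr g.2) mu
  setT F measurableT mF (fun y _ => measure_ge0 _ _).
apply: eq_measure_integral => /= _ B mB.
  exact: measurable_addr.
by move=> _; exact: lebesgue_measure_addr.
Qed.

(* the fundamental domain [0, 1) ^ 3 of H(Z) *)
Definition fund_dom : set heis :=
  [set x | [/\ 0 <= x.1.1 < 1, 0 <= x.1.2 < 1 & 0 <= x.2 < 1]].

Lemma haar_fund_dom : haar fund_dom = 1%E.
Proof.
pose I : set mR := `[0, 1[%classic.
have mI : measurable I by exact: measurable_itv.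
have I1 : mu I = 1%E.
  by rewrite lebesgue_measure_itv/= lte_fin ltr01 oppr0 adde0.
have II1 : lebesgue2 (I `*` I) = 1%E.
  transitivity (mu I * mu I)%E; first exact: product_measure1E.
  by rewrite I1 mule1.
have -> : fund_dom = (I `*` I) `*` I.
  apply/seteqP; split=> -[[x y] z]; rewrite /fund_dom /I /= !in_itv/=;
    by [case|case; case].
transitivity (lebesgue2 (I `*` I) * mu I)%E.
  by apply: product_measure1E => //; exact: measurableX.
by rewrite II1 I1 mule1.
Qed.

Lemma fund_domP (x : heis) :
  exists! n : int * int * int, fund_dom (hmul (hint n.1.1 n.1.2 n.2) x).
Proof.
have fl (y : R) (n : int) : 0 <= n%:~R + y < 1 <-> n = - Num.floor y.
  split=> [/andP[h0 h1]|->].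
    apply/eqP; rewrite -eqr_oppLR eq_sym; apply/eqP/floor_def.
    by rewrite !intrD !intrN; apply/andP; split; lra.
  have := floor_itv y; rewrite intrD intrN.
  by move=> /andP[h0 h1]; apply/andP; split; lra.
pose m := - Num.floor x.1.1.
exists (m, - Num.floor (x.1.2 + m%:~R * x.2), - Num.floor x.2); split.
  by rewrite /fund_dom /hmul /=; split; rewrite -?addrA; apply/fl.
move=> [[n n1] n2] /=; rewrite /fund_dom /hmul /= -addrA => -[].
by move=> /fl -> /fl -> /fl ->.
Qed.

(* the integral of an H(Z)-invariant function over the quotient *)
Definition quotient_integral (f : heis -> R) : R :=
  (\int[haar]_(x in fund_dom) f x)%R.

Definition smooth (nu : R -> R) : Prop :=
  forall (j : nat) (x : R), derivable (derive1n j nu) x 1.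

Definition Cl_norm (l : nat) (nu : R -> R) : R :=
  \sum_(j < l.+1) supnorm (derive1n j nu).

End heisenberg.
Arguments heis R : clear implicits.

(* The exponent s depends on kappa only, and the implied constant K, as well as
   the threshold for c, on alpha only. The sum over d is finite because nu is
   supported in [-L, L], and the value of the Fourier transform of nu at 0
   is the integral of nu. *)
Definition equidistribution (R : realType) : Prop :=
  exists k l : nat, exists2 kappa0 : R, 2 <= kappa0 &
  forall kappa : R, kappa <= kappa0 -> exists2 s : R, 0 < s &
  forall alpha : R, diophantine kappa alpha -> exists K : R,
  \forall c \near \oo,
  forall (f : heis R -> R) (nu : R -> R) (L : R) (a b : int -> int),
    HZ_invariant f -> Ck k f ->
    smooth nu -> 1 <= L -> (forall x, L < `|x| -> nu x = 0) ->
    (forall d : int, coprimez c%:Z d -> a d * d - b d * c%:Z = 1) ->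
    `| (totient c)%:R^-1 *
         \sum_(d \in [set d : int | coprimez c%:Z d])
           nu (d%:~R / c%:R) *
           f ((a d)%:~R / c%:R,
              (b d)%:~R * alpha + (a d)%:~R / 2,
              d%:~R * alpha + c%:R / 2)
       - (\int[lebesgue_measure]_x nu x)%R * quotient_integral f |
    <= K * (L * Cl_norm l nu * Ck_norm k f * c%:R `^ (- s)).

(* Main.v *)
(* Writing g = gcd(i - j, N), N = g c, i - j = g d and k = i + j, the phase
   difference phi_N(i) - phi_N(j) is d (k - 2 alpha) / (2 c) with d prime to c,
   and (d, k) ranges over the lattice points of a diamond with k = g d mod 2.
   Inclusion-exclusion removes the parity condition, at the price of moduli c and
   2 c and of frequencies beta = alpha and 2 alpha.  For fixed g the pairs are
   counted by applying (E) at beta / 2 to the Poincare-type series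
   sum_{n, m} p(2 xi2 - n) q(2 xi1 - u (2 xi2 - n) + s - m), in which the factors
   2 turn the shifts a/2 and c/2 of (E) into integers: at the points of (E) it
   becomes a sum over k and m of cut-offs of d (beta - k) + c m and of k / c, while
   nu cuts off d / c.  Covering the diamond by boxes in (d / c, k / c) of width
   N^-eta, with smooth cut-offs at a smaller scale, gives the main term |A| phi(c)
   up to a power saving as long as g is below a small power of N.  For larger g
   the Diophantine condition makes the relevant d sparse, and the divisor bound
   controls the number of values of g.  Finally sum_{g c = N} phi(c) = N. *)

Require Import Defs.
From HB Require Import structures.
From mathcomp Require Import all_boot all_order all_algebra.
From mathcomp Require Import all_classical all_reals all_analysis.
From mathcomp Require Import measurable_realfun.
From mathcomp Require cyclic.
From mathcomp Require Import ring lra zify.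

Set Implicit Arguments.
Unset Strict Implicit.
Unset Printing Implicit Defensive.

Import Order.TTheory GRing.Theory Num.Theory.
Import numFieldNormedType.Exports.

Local Open Scope classical_set_scope.
Local Open Scope ring_scope.

(** * Smooth cut-offs *)

Section towers.
Context {R : realType}.
Implicit Types (f g : R -> R) (x y : R).

(** (E) tests d / c and the point of the quotient by separate factors, so only products of cut-offs,
    that is boxes in (d / c, k / c), are within reach, whereas the range of k allowed by 1 <= i, j
    <= N shrinks as |d| grows. This is why the diamond must be covered. The two ramps of a cut-off
    are congruent, so its integral is exactly a length: the main terms of (E) are exact volumes, and
    smoothing costs only what boxes gain or lose in size. Derivatives up to order r at scale e0 cost
    e0^-r in each of three cut-offs, a fixed power to be set against c^-s. With Q = floor(N^eta)
    cells on each side of d = 0, m = floor(kappa) and e0 = Q^-(m+3), every loss is a fixed power of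
    Q; for small eta, c^-s absorbs it when g <= Q^(m+1). Each divisor g of N then leaves an error
    O(N / Q), and the number of divisors takes back N^(eta/2), whence the final exponent eta / 2.
    The bound kappa0 is that of (E), because alpha / 2 has the same Diophantine type as alpha. *)

Lemma is_derive_mul f g x df dg :
  is_derive x 1 f df -> is_derive x 1 g dg ->
  is_derive x 1 (fun y => f y * g y) (df * g x + f x * dg).
Proof.
move=> hf hg; apply: (@is_derive_eq _ _ _ (f * g)).
by rewrite /GRing.scale /=; ring.
Qed.

Lemma is_derive_add f g x df dg :
  is_derive x 1 f df -> is_derive x 1 g dg ->
  is_derive x 1 (fun y => f y + g y) (df + dg).
Proof. by move=> hf hg; apply: (@is_deriveD _ _ _ f g). Qed.

Lemma is_derive_scale f x df a :
  is_derive x 1 f df -> is_derive x 1 (fun y => a * f y) (a * df).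
Proof. by move=> hf; apply: (@is_deriveZ _ _ _ f a). Qed.

Lemma is_derive_affine f x df a b :
  is_derive (a * x + b) 1 f df -> is_derive x 1 (fun y => f (a * y + b)) (df * a).
Proof.
move=> hf.
have hg : is_derive x 1 (fun y : R => a * y + b) a.
  have h1 : is_derive x 1 (fun y : R => a * y) (a * 1) by exact: is_derive_scale.
  have h2 : is_derive x 1 (fun _ : R => b) 0 by exact: is_derive_cst.
  by apply: is_derive_eq (is_derive_add h1 h2) _; rewrite mulr1 addr0.
by have := @is_derive1_comp _ f (fun y : R => a * y + b) x df a hf hg; rewrite mulrC.
Qed.

Lemma is_derive_seq (I : Type) (r : seq I) (F : I -> R -> R) x (dF : I -> R) :
  (forall i, is_derive x 1 (F i) (dF i)) ->
  is_derive x 1 (fun y => \sum_(i <- r) F i y) (\sum_(i <- r) dF i).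
Proof.
move=> h; elim: r => [|i r IH].
  rewrite big_nil (_ : (fun _ => _) = cst 0); first exact: is_derive_cst.
  by apply/funext => y; rewrite big_nil.
rewrite big_cons (_ : (fun _ => _) = (fun y => F i y + \sum_(j <- r) F j y)).
  exact: is_derive_add.
by apply/funext => y; rewrite big_cons.
Qed.

(** The difference quotient at x is at most K |y - x|. This handles the points outside (0, 1), where
    the bump functions below vanish, without any formula for the derivative. *)
Lemma is_derive_quad f x K :
  (forall y, `|f y - f x| <= K * (y - x) ^+ 2) -> is_derive x 1 f 0.
Proof.
move=> h.
have hc : (fun t => t^-1 *: ((f \o shift x) (t *: 1) - f x)) @ 0^' --> (0 : R).
  apply/cvgrPdist_le => /= e e0.
  near=> t.
  have t0 : t != 0 by near: t; exact: nbhs_dnbhs_neq.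
  rewrite sub0r normrN normrM normfV.
  have := h (t *: 1 + x); rewrite addrK /GRing.scale /= mulr1 => ht.
  rewrite mulrC ler_pdivrMr ?normr_gt0// (le_trans ht)//.
  rewrite -real_normK ?num_real// expr2 mulrA ler_wpM2r//.
  have K0 : `|K| * `|t| <= e.
    have hd : `|t| <= e / (`|K| + 1).
      near: t; apply: dnbhs0_le; rewrite divr_gt0// ltr_wpDl//.
    rewrite (le_trans (ler_wpM2l _ hd))//.
    by rewrite mulrCA ler_piMr ?(ltW e0)// ler_pdivrMr ?ltr_wpDl// mul1r lerDl.
  by rewrite (le_trans _ K0)// ler_wpM2r// ler_norm.
split; first by apply/cvg_ex; exists 0.
exact/cvg_lim.
Unshelve. all: by end_near. Qed.

(** A function packed with all its derivatives: supports and bounds can then be stated for each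
    order, and [derive1n] never has to be computed. *)
Definition tower (p : nat -> R -> R) : Prop :=
  forall j x, is_derive x 1 (p j) (p j.+1 x).

Lemma tower_derive1n p j : tower p -> derive1n j (p 0%N) = p j.
Proof.
move=> hp; elim: j => // j IH; rewrite derive1nS IH; apply/funext => x.
by rewrite derive1E; have [_ ->] := hp j x.
Qed.

Lemma tower_smooth p : tower p -> smooth (p 0%N).
Proof. by move=> hp j x; rewrite (tower_derive1n _ hp); have [] := hp j x. Qed.

Lemma is_derive_continuous f x df : is_derive x 1 f df -> {for x, continuous f}.
Proof. by move=> [h _]; apply/differentiable_continuous/derivable1_diffP. Qed.

Lemma tower_continuous p j : tower p -> continuous (p j).
Proof. by move=> hp x; exact: is_derive_continuous (hp j x). Qed.

End towers.

Section bumpf.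
Context {R : realType}.
Implicit Types (P : {poly R}) (n : nat) (x y : R).

(** With t = x (1 - x), the functions P t^-n exp(-1/t) on (0, 1) form a class stable under
    differentiation, so all derivatives of a bump are available in closed form. *)
Definition bumpf P n x : R :=
  if 0 < x < 1 then
    P.[x] * (x * (1 - x))^-1 ^+ n * expR (- (x * (1 - x))^-1)
  else 0.

(** The derivative of P t^-n exp(-1/t) over the common denominator t^(n+2); here [s] is the
    derivative of [t]. *)
Definition bump_step (Pn : {poly R} * nat) : {poly R} * nat :=
  let t : {poly R} := 'X * (1 - 'X) in
  let s : {poly R} := 1 - 2%:P * 'X in
  (Pn.1^`() * (t * t) - Pn.2%:R%:P * (Pn.1 * s * t) + Pn.1 * s, Pn.2.+2).

Lemma horner_bounded P : exists2 K : R, 0 <= K & forall x, 0 < x < 1 -> `|P.[x]| <= K.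
Proof.
exists (\sum_(i < size P) `|P`_i|); first exact: sumr_ge0.
move=> x /andP[x0 x1]; rewrite horner_coef (le_trans (ler_norm_sum _ _ _))//.
apply: ler_sum => i _; rewrite normrM ler_piMr// normrX exprn_ile1//.
by rewrite gtr0_norm// ltW.
Qed.

(** The exponential series gives exp(1/t) >= t^-(n+2) / (n+2)!, which beats t^-n and leaves t^2. The
    exponent 2 is the one required by [is_derive_quad]. *)
Lemma bump_small P n : exists2 K : R, 0 <= K &
  forall x, 0 < x < 1 -> `|bumpf P n x| <= K * (x * (1 - x)) ^+ 2.
Proof.
have [K K0 hK] := horner_bounded P.
exists (K * (n.+2)`!%:R); first by rewrite mulr_ge0.
move=> x hx; rewrite /bumpf hx; move: (hx) => /andP[x0 x1].
set t := x * (1 - x).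
have t0 : 0 < t by rewrite mulr_gt0 ?subr_gt0.
rewrite -mulrA normrM -mulrA ler_pM//; first exact: hK.
rewrite ger0_norm; last by rewrite mulr_ge0 ?expR_ge0// exprn_ge0// invr_ge0 ltW.
rewrite expRN ler_pdivrMr ?expR_gt0//.
have h : 1 + t^-1 ^+ n.+2 / n.+2`!%:R <= expR t^-1.
  by apply: expR_ge1Dxn; rewrite invr_ge0 ltW.
have f0 : 0 < (n.+2`!%:R : R) by rewrite ltr0n fact_gt0.
have {}h : t^-1 ^+ n.+2 <= n.+2`!%:R * expR t^-1.
  rewrite -ler_pdivrMl// mulrC (le_trans _ h)//; lra.
rewrite -mulrA mulrCA (_ : t^-1 ^+ n = t ^+ 2 * t^-1 ^+ n.+2).
  by rewrite ler_wpM2l// exprn_ge0// ltW.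
by rewrite -(addn2 n) exprD mulrCA -exprMn mulfV ?gt_eqF// expr1n mulr1.

Qed.

Lemma bump0 P n x : (x <= 0) || (1 <= x) -> bumpf P n x = 0.
Proof. by rewrite /bumpf => /orP[] h; case: ifP => // /andP[]; lra. Qed.

Lemma bump_bounded P n : exists2 K : R, 0 <= K & forall x, `|bumpf P n x| <= K.
Proof.
have [K K0 hK] := bump_small P n; exists K => // x.
have [hx|hx] := boolP (0 < x < 1); last by rewrite /bumpf (negbTE hx) normr0.
rewrite (le_trans (hK _ hx))// ler_piMr// exprn_ile1//; move/andP: hx => [x0 x1].
- by rewrite mulr_ge0; lra.
- by rewrite mulr_ile1; lra.
Qed.

Lemma bump_derive_identity (p' p s t e : R) n : t != 0 ->
  (p' * t^-1 ^+ n + p * (n%:R * t^-1 ^+ n.-1 * (- t ^- 2 * s))) * e +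
    p * t^-1 ^+ n * (e * (- 1 * (- t ^- 2 * s))) =
  (p' * t ^+ 2 - n%:R * (p * s * t) + p * s) * t^-1 ^+ n.+2 * e.
Proof.
move=> t0; case: n => [|n]; first by rewrite expr0; field.
by rewrite /= !(exprS t^-1); move: (t^-1 ^+ n) => w; field.
Qed.

Lemma bump_derive P n x :
  is_derive x 1 (bumpf P n) (let Qm := bump_step (P, n) in bumpf Qm.1 Qm.2 x).
Proof.
have [hx|hx] := boolP (0 < x < 1); last first.
  have z Q m : bumpf Q m x = 0 by rewrite /bumpf (negbTE hx).
  rewrite /= z.
  have [K K0 hK] := bump_small P n.
  apply: (@is_derive_quad _ _ _ K) => y.
  rewrite z subr0; have [hy|hy] := boolP (0 < y < 1); last first.
    by rewrite /bumpf (negbTE hy) normr0 mulr_ge0// sqr_ge0.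
  rewrite (le_trans (hK _ hy))// ler_wpM2l//.
  (* A point x outside (0, 1) is at distance at least y or at least 1 - y from y, and both exceed y
     (1 - y). *)
  move: hy => /andP[y0 y1]; rewrite -[leRHS]real_normK ?num_real// lerXn2r ?nnegrE//.
    by rewrite mulr_ge0; lra.
  move: hx; rewrite negb_and -!leNgt => /orP[] hx.
  - by rewrite ger0_norm ?subr_ge0; nra.
  - by rewrite ler0_norm ?subr_le0; nra.
pose g y := P.[y] * (y * (1 - y))^-1 ^+ n * expR (- (y * (1 - y))^-1).
apply: (@near_eq_is_derive _ _ _ g).
  have : \forall y \near x, y \in `]0, 1[ by apply: near_in_itvoo; rewrite in_itv.
  apply: filterS => y; rewrite in_itv/= => hy; rewrite /bumpf hy; by [].
have t0 : x * (1 - x) != 0 by move: hx => /andP[? ?]; rewrite mulf_neq0//; lra.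
have dt : is_derive x 1 (fun y : R => y * (1 - y)) (1 - 2 * x).
  have -> : 1 - 2 * x = 1 * (1 - x) + x * (0 + -1) by ring.
  apply: (@is_derive_mul _ id); apply: (@is_derive_add _ (cst 1)).
have dq : is_derive x 1 (fun y : R => (y * (1 - y))^-1)
    (- (x * (1 - x)) ^- 2 * (1 - 2 * x)).
  exact: (@is_deriveV _ (fun y : R => y * (1 - y))).
have dqn : is_derive x 1 (fun y : R => (y * (1 - y))^-1 ^+ n)
   (n%:R * (x * (1 - x))^-1 ^+ n.-1 * (- (x * (1 - x)) ^- 2 * (1 - 2 * x))).
  have -> : (fun y : R => (y * (1 - y))^-1 ^+ n) = (fun y : R => (y * (1 - y))^-1) ^+ n.
    by apply/funext => y; rewrite exprfctE.
  exact: (@is_deriveX _ _ (fun y : R => (y * (1 - y))^-1)).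
have de : is_derive x 1 (fun y : R => expR (- (y * (1 - y))^-1))
   (expR (- (x * (1 - x))^-1) * (- 1 * (- (x * (1 - x)) ^- 2 * (1 - 2 * x)))).
  have h : is_derive x 1 (fun y : R => - (y * (1 - y))^-1)
    (- 1 * (- (x * (1 - x)) ^- 2 * (1 - 2 * x))).
    have -> : (fun y : R => - (y * (1 - y))^-1) = (fun y : R => -1 * (y * (1 - y))^-1).
      by apply/funext => y; rewrite mulN1r.
    exact: is_derive_scale.
  have := @is_derive1_comp _ expR (fun y : R => - (y * (1 - y))^-1) x _ _ _ h.
  by rewrite mulrC; apply.
have := is_derive_mul (is_derive_mul (is_derive_poly P x) dqn) de.
rewrite /g => H; apply: (is_derive_eq H).
rewrite /= {H} /bumpf hx /bump_step /=.
rewrite !(hornerD, hornerN, hornerM, hornerC, hornerX).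
rewrite -expr2; exact: bump_derive_identity.
Qed.

Definition bump_tower (c : R) (P : {poly R}) (j : nat) (x : R) : R :=
  let Qm := iter j bump_step (P, 0%N) in c * bumpf Qm.1 Qm.2 x.

Lemma bump_towerP c P : tower (bump_tower c P).
Proof.
move=> j x; rewrite /bump_tower; apply: is_derive_scale.
rewrite iterS; case: (iter j _ _) => Q m; exact: bump_derive.
Qed.

End bumpf.

(** * The smooth step, its primitive, and plateau cut-offs *)

Section smooth_step.
Context {R : realType}.
Notation mu := (@lebesgue_measure R).
Implicit Types (f F : R -> R) (x y : R).

Lemma is_derive_MVT f (df : R -> R) x y : x <= y -> (forall z : R, is_derive z 1 f (df z)) ->
  exists2 c, x <= c <= y & f y - f x = df c * (y - x).
Proof.
move=> xy h; have [|c + hc] := @MVT_segment _ f df x y xy (fun z _ => h z).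
  by apply: continuous_subspaceT => z; exact: is_derive_continuous (h z).
by rewrite in_itv => hcc; exists c.
Qed.

Definition prim f x : R := (\int[mu]_(t in `]-oo, x]) f t)%R.

Lemma prim_derive f x : continuous f -> (forall y, (y <= 0) || (1 <= y) -> f y = 0) ->
  is_derive x 1 (prim f) (f x).
Proof.
move=> cf f0.
have fT : mu.-integrable setT (EFin \o f).
  have : mu.-integrable `[0, 1] (EFin \o f).
    apply: continuous_compact_integrable; first exact: segment_compact.
    exact: continuous_subspaceT.
  rewrite integrable_mkcond//; apply: eq_integrable => // y _.
  rewrite patchE; case: ifPn => //; rewrite notin_setE /= in_itv/= => /negP h.
  by rewrite f0//; move: h; rewrite negb_and -!ltNge => /orP[] /ltW ->; rewrite ?orbT.
have xx : x < x + 1 by rewrite ltrDl.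
have fi : mu.-integrable [set` `]-oo, (x + 1)]] (EFin \o f) by exact: integrableS fT.
have [h1 h2] := continuous_FTC1 xx fi (ltNyr x) (cf x).
by split; [exact: h1|rewrite -derive1E; exact: h2].
Qed.

Lemma prim_left f x : (forall y, (y <= 0) || (1 <= y) -> f y = 0) -> x <= 0 ->
  prim f x = 0.
Proof.
move=> f0 x0; rewrite /prim.
transitivity (\int[mu]_(t in `]-oo, x]) (cst 0 t : R))%R.
  apply: eq_Rintegral => t; rewrite inE /= in_itv/= => tx.
  by rewrite f0 // (le_trans tx x0).
by rewrite /Rintegral integral0.
Qed.

Lemma prim_right f x : continuous f -> (forall y, (y <= 0) || (1 <= y) -> f y = 0) ->
  1 <= x -> prim f x = prim f 1.
Proof.
move=> cf f0 x1.
have [c /andP[c1 _]] := is_derive_MVT x1 (fun z => prim_derive z cf f0).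
by rewrite f0 ?c1 ?orbT// mul0r => /eqP; rewrite subr_eq0 => /eqP.
Qed.

Let rho : R -> R := bumpf 1 0.

Let rhoC : continuous rho.
Proof. by move=> x; exact: is_derive_continuous (bump_derive 1 0 x). Qed.

Let rho0 y : (y <= 0) || (1 <= y) -> rho y = 0. Proof. exact: bump0. Qed.

Let rho_ge0 y : 0 <= rho y.
Proof.
by rewrite /rho /bumpf; case: ifP => // _; rewrite hornerC expr0 !mul1r expR_ge0.
Qed.

Definition step_mass : R := prim rho 1.

(** The mean value theorem is applied on three consecutive pieces of [0, 1]: on the middle one the
    intermediate point is interior, where the density is positive; nonnegativity is enough on the
    outer ones. *)
Lemma step_mass_gt0 : 0 < step_mass.
Proof.
have D z := prim_derive z rhoC rho0.
have m01 : (0 : R) <= 1/4 by lra.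
have m12 : (1/4 : R) <= 3/4 by lra.
have m23 : (3/4 : R) <= 1 by lra.
have [c0 _ h0] := is_derive_MVT m01 D.
have [c1 /andP[hc1 hc2] h1] := is_derive_MVT m12 D.
have [c2 _ h2] := is_derive_MVT m23 D.
have g0 : 0 <= rho c0 * (1/4 - 0) by rewrite mulr_ge0//; lra.
have g2 : 0 <= rho c2 * (1 - 3/4) by rewrite mulr_ge0//; lra.
have g1 : 0 < rho c1 * (3/4 - 1/4).
  rewrite mulr_gt0//; last lra.
  have h : 0 < c1 < 1 by apply/andP; split; lra.
  by rewrite /rho /bumpf h hornerC expr0 !mul1r expR_gt0.
have z0 : prim rho 0 = 0 by exact: prim_left.
rewrite /step_mass; lra.
Qed.

(* th 0 is a smooth step from 0 to 1 on [0, 1]; th j is its j-th derivative *)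
Definition th (j : nat) (x : R) : R :=
  if j is j'.+1 then bump_tower step_mass^-1 1 j' x else step_mass^-1 * prim rho x.

Lemma th_tower : tower th.
Proof.
move=> [|j] x; last exact: bump_towerP.
by apply: is_derive_scale; exact: prim_derive.
Qed.

Lemma th_left j x : x <= 0 -> th j x = 0.
Proof.
move=> x0; case: j => [|j] /=; first by rewrite prim_left ?mulr0.
by rewrite /bump_tower bump0 ?x0// mulr0.
Qed.

Lemma th_right x : 1 <= x -> th 0 x = 1.
Proof.
by move=> x1; rewrite /= prim_right// mulVf// gt_eqF// step_mass_gt0.
Qed.

Lemma thS_right j x : 1 <= x -> th j.+1 x = 0.
Proof. by move=> x1; rewrite /= /bump_tower bump0 ?x1 ?orbT// mulr0. Qed.

Lemma th_homo x y : x <= y -> th 0 x <= th 0 y.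
Proof.
move=> xy; have [c _ h] := is_derive_MVT xy (th_tower 0).
rewrite -subr_ge0 h mulr_ge0 ?subr_ge0//= mulr_ge0//.
  by rewrite invr_ge0 ltW// step_mass_gt0.
Qed.

Lemma th_ge0 x : 0 <= th 0 x.
Proof.
by have [/(th_left 0) ->//|/ltW x0] := leP x 0; rewrite -(th_left 0 (lexx 0)) th_homo.
Qed.

Lemma th_le1 x : th 0 x <= 1.
Proof.
by have [/th_right ->//|/ltW x0] := leP 1 x; rewrite -(th_right (lexx 1)) th_homo.
Qed.

Lemma th_bounded j : exists2 K : R, 0 <= K & forall x, `|th j x| <= K.
Proof.
case: j => [|j].
  by exists 1 => // x; rewrite ger0_norm ?th_ge0// th_le1.
pose Qm := iter j (@bump_step R) (1, 0%N).
have [K K0 hK] := bump_bounded Qm.1 Qm.2.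
exists (`|step_mass^-1| * K); first by rewrite mulr_ge0.
by move=> x; rewrite /= /bump_tower normrM ler_wpM2l.
Qed.

(** A primitive of [th 0] obtained by parts. Since [th 0] equals 1 on the right, [prim_derive] does
    not apply to it; it does apply to t times the density, which is the bump with polynomial 'X. *)
Definition thI (x : R) : R := x * th 0 x - step_mass^-1 * prim (bumpf 'X 0) x.

Lemma thI_derive x : is_derive x 1 thI (th 0 x).
Proof.
have cX : continuous (bumpf 'X 0 : R -> R).
  by move=> y; exact: is_derive_continuous (bump_derive 'X 0 y).
have h1 := is_derive_mul (is_derive_id x 1) (th_tower 0 x).
have h2 := is_derive_scale (- step_mass^-1) (prim_derive x cX (fun y => @bump0 _ 'X 0%N y)).
have -> : thI = (fun y => y * th 0 y + - step_mass^-1 * prim (bumpf 'X 0) y).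
  by apply/funext => y; rewrite /thI mulNr.
apply: is_derive_eq (is_derive_add h1 h2) _.
rewrite /= /bump_tower /=.
have -> : bumpf 'X 0 x = x * bumpf 1 0 x :> R.
  by rewrite /bumpf; case: ifP => _; rewrite ?mulr0// hornerX hornerC mul1r mulrA.
ring.
Qed.

Lemma thI_left x : x <= 0 -> thI x = 0.
Proof.
move=> x0; rewrite /thI th_left// prim_left//; first by rewrite !mulr0 subr0.
by move=> y; exact: bump0.
Qed.

Lemma thI_right x y : 1 <= x -> 1 <= y -> thI x - thI y = x - y.
Proof.
move=> x1 y1; rewrite /thI !th_right// [prim _ x]prim_right// ?[prim _ y]prim_right//.
- by ring.
- by move=> z; exact: is_derive_continuous (bump_derive 'X 0 z).
- by move=> z; exact: bump0.
- by move=> z; exact: is_derive_continuous (bump_derive 'X 0 z).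
- by move=> z; exact: bump0.
Qed.

Lemma is_derive_rescale f df x p d : is_derive ((x - p) / d) 1 f df ->
  is_derive x 1 (fun y => f ((y - p) / d)) (df / d).
Proof.
have e y : (y - p) / d = d^-1 * y + - (p / d) by ring.
rewrite e => h; rewrite (_ : (fun _ => _) = (fun y => f (d^-1 * y + - (p / d)))).
  exact: is_derive_affine.
by apply/funext => y; rewrite e.
Qed.

Lemma rescale_le0 x p d : 0 < d -> x <= p -> (x - p) / d <= 0.
Proof. by move=> d0 xp; rewrite ler_pdivrMr// mul0r subr_le0. Qed.

Lemma rescale_ge1 x p d : 0 < d -> p + d <= x -> 1 <= (x - p) / d.
Proof. by move=> d0 xp; rewrite ler_pdivlMr// mul1r lerBrDl. Qed.

(* smooth approximation of the indicator of [p, q] at scale d *)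
Definition plateau (p q d : R) (j : nat) (x : R) : R :=
  d^-1 ^+ j * (th j ((x - p) / d) + (-1) * th j ((x - q) / d)).

Lemma plateau_tower p q d : tower (plateau p q d).
Proof.
move=> j x; rewrite /plateau exprSr -mulrA; apply: is_derive_scale.
rewrite (_ : d^-1 * _ = th j.+1 ((x - p) / d) / d + (-1) * (th j.+1 ((x - q) / d) / d)).
  by apply: is_derive_add; [|apply: is_derive_scale]; apply: is_derive_rescale;
     exact: th_tower.
by ring.
Qed.

Lemma plateau_bounded r : exists2 T : R, 0 <= T & forall p q d j x,
  0 < d -> d <= 1 -> (j <= r)%N -> `|plateau p q d j x| <= T * d^-1 ^+ r.
Proof.
have /choice[K hK] : forall j, exists K : R, 0 <= K /\ forall x, `|th j x| <= K.
  by move=> j; have [K ? ?] := th_bounded j; exists K.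
exists (2 * \sum_(j < r.+1) K j).
  by rewrite mulr_ge0// sumr_ge0// => j _; have [] := hK j.
move=> p q d j x d0 d1 jr.
have i0 : 1 <= d^-1 by rewrite invf_ge1.
rewrite /plateau normrM mulrC ler_pM//; last first.
  by rewrite ger0_norm ?exprn_ge0 ?invr_ge0 ?(ltW d0)// ler_weXn2l.
have [K0 hKj] := hK j.
have hs : K j <= \sum_(j < r.+1) K j.
  rewrite (bigD1 (Ordinal (jr : (j < r.+1)%N)))//= lerDl sumr_ge0// => i _.
  by have [] := hK i.
rewrite (le_trans (ler_normD _ _))// normrM normrN1 mul1r.
have := hKj ((x - p) / d); have := hKj ((x - q) / d); lra.
Qed.

Section plateau_facts.
Variables (p q d : R).
Hypotheses (pq : p <= q) (d0 : 0 < d).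

Lemma plateau_left j x : x <= p -> plateau p q d j x = 0.
Proof.
move=> xp.
have h1 : (x - p) / d <= 0 by apply: rescale_le0 => //; move: (pq) (d0); lra.
have h2 : (x - q) / d <= 0 by apply: rescale_le0 => //; apply: le_trans pq.
by rewrite /plateau !th_left// mulr0 addr0 mulr0.
Qed.

Lemma plateau_right j x : q + d <= x -> plateau p q d j x = 0.
Proof.
move=> xq.
have h1 : 1 <= (x - q) / d by apply: rescale_ge1 => //; move: (pq) (d0); lra.
have h2 : 1 <= (x - p) / d by apply: rescale_ge1 => //; move: (pq) (d0) => {h1}; lra.
case: j => [|j]; rewrite /plateau.
  by rewrite !th_right// mulr1 subrr mulr0.
by rewrite !thS_right// mulr0 addr0 mulr0.
Qed.

Lemma plateau_in x : p + d <= x -> x <= q -> plateau p q d 0 x = 1.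
Proof.
move=> px xq.
have h1 : 1 <= (x - p) / d by apply: rescale_ge1 => //; move: (pq) (d0); lra.
have h2 : (x - q) / d <= 0 by apply: rescale_le0 => //; apply: le_trans pq.
by rewrite /plateau expr0 mul1r th_right// th_left// mulr0 addr0.
Qed.

Lemma plateau_ge0 x : 0 <= plateau p q d 0 x.
Proof.
rewrite /plateau expr0 mul1r mulN1r subr_ge0 th_homo// ler_pM2r ?invr_gt0//; move: (pq) (d0); lra.
Qed.

Lemma plateau_le1 x : plateau p q d 0 x <= 1.
Proof.
rewrite /plateau expr0 mul1r mulN1r.
by have := th_ge0 ((x - q) / d); have := th_le1 ((x - p) / d); lra.
Qed.

Definition plateauI (x : R) : R := d * (thI ((x - p) / d) + (-1) * thI ((x - q) / d)).

Lemma plateauI_derive x : is_derive x 1 plateauI (plateau p q d 0 x).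
Proof.
have h z := is_derive_rescale (thI_derive ((x - z) / d)).
apply: is_derive_eq (is_derive_scale d (is_derive_add (h p) (is_derive_scale (-1) (h q)))) _.
by rewrite /plateau expr0; field; rewrite gt_eqF.
Qed.

Lemma plateauI_left x : x <= p -> plateauI x = 0.
Proof.
move=> xp.
have h1 : (x - p) / d <= 0 by apply: rescale_le0 => //; move: (pq) (d0); lra.
have h2 : (x - q) / d <= 0 by apply: rescale_le0 => //; apply: le_trans pq.
by rewrite /plateauI !thI_left// mulr0 addr0 mulr0.
Qed.

(** The rising and falling ramps have the same shape, so the mass is the length q - p exactly, for
    every smoothing scale d. No smoothing error enters the main terms of (E) for this reason. *)
Lemma plateauI_right x : q + d <= x -> plateauI x = q - p.
Proof.
move=> xq; rewrite /plateauI mulN1r thI_right.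
- by field; rewrite gt_eqF.
- by apply: rescale_ge1 => //; move: (pq) (d0); lra.
- by apply: rescale_ge1 => //; move: (pq) (d0); lra.
Qed.

End plateau_facts.
End smooth_step.

(** * Poincare-type series *)

Section integer_sums.
Context {R : realType}.
Implicit Types (F : int -> R) (G : int -> int -> R) (K : nat).

Definition zw K : seq int := [seq i%:Z - K%:Z | i <- iota 0 K.*2.+1].
#[global] Arguments zw : simpl never.

Lemma zw_uniq K : uniq (zw K).
Proof.
rewrite map_inj_in_uniq ?iota_uniq// => i j _ _ h; lia.
Qed.

Lemma mem_zw K (n : int) : (n \in zw K) = (`|n| <= K)%N.
Proof.
apply/mapP/idP => [[i]|h]; first by rewrite mem_iota => h ->; lia.
by exists (absz (n + K%:Z)); [rewrite mem_iota; lia|lia].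
Qed.

Definition zsum F : R := \sum_(n \in [set: int]) F n.

Definition zsum2 G : R := \sum_(p \in [set: int * int]) G p.1 p.2.

Lemma zsumE K F : (forall n, (K < `|n|)%N -> F n = 0) ->
  zsum F = \sum_(n <- zw K) F n.
Proof.
move=> h; rewrite /zsum (fsbigE (zw K)) ?zw_uniq//.
  by apply: eq_bigl => n; apply/mem_set.
by move=> n _; rewrite mem_zw -ltnNge; exact: h.
Qed.

Lemma zsum2E K L G : (forall n m, G n m != 0 -> (`|n| <= K)%N /\ (`|m| <= L)%N) ->
  zsum2 G = \sum_(n <- zw K) \sum_(m <- zw L) G n m.
Proof.
move=> h; rewrite /zsum2 (fsbigE [seq (n, m) | n <- zw K, m <- zw L]).
- under eq_bigl do rewrite mem_set//.
  by rewrite big_allpairs_dep.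
- by rewrite allpairs_uniq ?zw_uniq// => -[? ?] [? ?] _ _ [-> ->].
- by [].
- move=> p _; apply: contraNeq => /h[hn hm].
  by apply/allpairsPdep; exists p.1, p.2; rewrite !mem_zw -surjective_pairing.
Qed.

Lemma zsum2_reindex (h : int * int -> int * int) G : bijective h ->
  zsum2 G = zsum2 (fun n m => G (h (n, m)).1 (h (n, m)).2).
Proof.
move=> hb; rewrite /zsum2 (reindex_fsbigT h)//.
by apply: eq_fsbigr => -[n m] _.
Qed.

Lemma eq_zsum2 G G' : (forall n m, G n m = G' n m) -> zsum2 G = zsum2 G'.
Proof. by move=> h; apply: eq_fsbigr => -[n m] _; exact: h. Qed.

Lemma count_zw K (a b : R) : a <= b + 1 ->
  \sum_(n <- zw K) ((a <= n%:~R <= b)%R)%:R <= b - a + 1 :> R.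
Proof.
move=> ab; rewrite -natr_sum.
rewrite (_ : (\sum_(n <- zw K) _)%N = size [seq n <- zw K | a <= n%:~R <= b]); last first.
  rewrite size_filter -sum1_count [RHS]big_mkcond.
  by apply: eq_bigr => n _; case: (_ <= _ <= _).
have [->|sn0] := eqVneq [seq n <- zw K | a <= n%:~R <= b] [::].
  by rewrite /=; lra.
have b0 : 0 <= b - a.
  move: sn0; case e: [seq _ <- _ | _] => [//|n s] _.
  have : n \in [seq n <- zw K | a <= n%:~R <= b] by rewrite e mem_head.
  by rewrite mem_filter => /andP[/andP[h1 h2] _]; lra.
pose c := Num.ceil a.
have hs : (size [seq n <- zw K | (a <= n%:~R <= b)%R] <= (Num.truncn (b - a)).+1)%N.
  rewrite -(size_iota 0 (Num.truncn (b - a)).+1) -(size_map (fun n => absz (n - c))).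
  have hc n : a <= n%:~R -> c <= n by move=> h; rewrite ceil_le_int.
  apply: uniq_leq_size => [|y /mapP[n]].
    rewrite map_inj_in_uniq ?filter_uniq ?zw_uniq// => n m.
    rewrite !mem_filter => /andP[/andP[h1 h2] _] /andP[/andP[h3 h4] _].
    by have := hc _ h1; have := hc _ h3; lia.
  rewrite mem_filter => /andP[/andP[h1 h2] _] ->.
  rewrite mem_iota add0n /= ltnS truncn_ge_nat//.
  rewrite natr_absz ger0_norm ?subr_ge0 ?hc// rmorphB /=.
  by have := ceil_ge a; rewrite -/c; lra.
have : (Num.truncn (b - a)).+1%:R <= b - a + 1 :> R.
  by rewrite -natr1 lerD2r truncn_le.
by apply: le_trans; rewrite ler_nat.
Qed.

Lemma count_zw_sub K (x a b : R) : a <= b + 1 ->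
  \sum_(n <- zw K) ((a <= x - n%:~R <= b)%R)%:R <= b - a + 1 :> R.
Proof.
move=> ab; have h : x - b <= x - a + 1 by lra.
have := count_zw K h; rewrite (_ : x - a - (x - b) = b - a); last by ring.
by under eq_bigr do rewrite lerBrDr -lerBrDl lerBlDr -lerBlDl andbC.
Qed.

End integer_sums.

Section poincare_series.
Context {R : realType}.
Implicit Types (p q : R -> R) (x : heis R) (s : R).

Definition supported (a b : R) p := forall y, ~~ (a <= y <= b) -> p y = 0.

(* p and q are cut off at the values 2 xi2 - n and 2 xi1 - u (2 xi2 - n) so
   that translation by H(Z) only permutes the terms *)
Definition poincare p q s x : R :=
  zsum2 (fun n m => p (2 * x.2 - n%:~R) *
    q (2 * x.1.2 - x.1.1 * (2 * x.2 - n%:~R) + s - m%:~R)).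

(** Translation by (m, n1, n2) changes 2 xi1 by 2 n1 + 2 m xi2 and, with w = 2 xi2 - n kept fixed by
    shifting n, changes u w by m w = 2 m xi2 - m n. The non-integral parts 2 m xi2 cancel, leaving
    the integer shift 2 n1 + m n of the second index. *)
Lemma poincare_invariant p q s : HZ_invariant (poincare p q s).
Proof.
move=> m n1 n2 x; rewrite /poincare.
pose h (z : int * int) : int * int := (z.1 + 2 * n2, z.2 + 2 * n1 + m * z.1).
rewrite (@zsum2_reindex _ h).
  apply: eq_zsum2 => n k; rewrite /hmul /hint /h /=.
  congr (p _ * q _); rewrite !(intrD, intrM); ring.
exists (fun z => (z.1 - 2 * n2, z.2 - 2 * n1 - m * (z.1 - 2 * n2))).
  by move=> [a b]; rewrite /h /=; congr (_, _); ring.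
by move=> [a b]; rewrite /h /=; congr (_, _); ring.
Qed.

Lemma supported_norm a b p y : supported a b p -> p y != 0 -> `|y| <= `|a| + `|b|.
Proof.
move=> h; apply: contraNle => hy; rewrite h//; apply/negP => /andP[h1 h2].
move: hy; rewrite ltNge => /negP; apply; rewrite ler_norml.
have := ler_norm b; have := ler_norm (- a); rewrite normrN.
have := normr_ge0 a; have := normr_ge0 b => *; apply/andP; split; lra.
Qed.

Lemma absz_le_truncn (n : int) (B : R) : `|n%:~R| <= B -> (`|n| <= Num.truncn B)%N.
Proof.
move=> h; rewrite truncn_ge_nat ?(le_trans _ h)//.
by rewrite natr_absz intr_norm.
Qed.

(** On a bounded part of the group the support of p bounds n, and then that of q bounds m. The
    window depends on the supports and on B only, so the same one serves a series and its
    derivatives. *)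
Lemma poincare_window a b c d s (B : R) : exists K0 : nat, forall K p q x,
  (K0 <= K)%N -> supported a b p -> supported c d q ->
  `|x.1.1| <= B -> `|x.1.2| <= B -> `|x.2| <= B ->
  poincare p q s x = \sum_(n <- zw K) \sum_(m <- zw K)
    p (2 * x.2 - n%:~R) * q (2 * x.1.2 - x.1.1 * (2 * x.2 - n%:~R) + s - m%:~R).
Proof.
pose W := `|a| + `|b|; pose V := `|c| + `|d|.
exists (Num.truncn (2 * B + W + (2 * B + B * W + `|s| + V))) => K p q x hK hp hq h1 h2 h3.
have W0 : 0 <= W by rewrite addr_ge0.
have V0 : 0 <= V by rewrite addr_ge0.
have B0 : 0 <= B by rewrite (le_trans _ h1).
have BW : 0 <= B * W by rewrite mulr_ge0.
apply: zsum2E => n m; rewrite mulf_eq0 negb_or => /andP[hpn hqm].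
have n1 := supported_norm hp hpn; have m1 := supported_norm hq hqm.
rewrite -/W in n1; rewrite -/V in m1.
set w := 2 * x.2 - n%:~R in n1 m1.
have uw : `|x.1.1 * w| <= B * W by rewrite normrM ler_pM.
have s0 := ler_norm s; have s1 := ler_norm (- s); rewrite normrN in s1.
move: h1 h2 h3 n1 m1 uw; rewrite !ler_norml => /andP[? ?] /andP[? ?] /andP[? ?].
move=> /andP[? ?] /andP[? ?] /andP[? ?].
have e : w = 2 * x.2 - n%:~R by [].
have s2 := normr_ge0 s.
by split; apply: leq_trans hK; apply: absz_le_truncn; rewrite ler_norml; apply/andP; split; lra.
Qed.

(** The indices of the nonzero terms move with x, but their number does not grow: at most b - a + 1
    values of n, and d - c + 1 values of m for each of them. Hence a bound on the whole noncompact
    group. *)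
Lemma poincare_bounded a b c d s p q (D E : R) x : a <= b -> c <= d ->
  supported a b p -> supported c d q ->
  (forall y, `|p y| <= D) -> (forall y, `|q y| <= E) ->
  `|poincare p q s x| <= (b - a + 1) * (d - c + 1) * (D * E).
Proof.
move=> ab cd hp hq hD hE.
have [K hK] := poincare_window a b c d s (`|x.1.1| + `|x.1.2| + `|x.2|).
have D0 : 0 <= D by rewrite (le_trans _ (hD 0)).
have E0 : 0 <= E by rewrite (le_trans _ (hE 0)).
have n1 := normr_ge0 x.1.1; have n2 := normr_ge0 x.1.2; have n3 := normr_ge0 x.2.
rewrite (hK K)//; [|lra|lra|lra].
have hi (r : R -> R) (e f g y : R) : supported e f r -> (forall y, `|r y| <= g) ->
    `|r y| <= (e <= y <= f)%R%:R * g.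
  by move=> hr hg; have [h|/hr ->] := boolP (_ <= _ <= _);
     rewrite ?mul1r// normr0 mul0r.
have := @count_zw_sub R K (2 * x.2) a b; set S := \sum_(_ <- _) _ => hS.
apply: (@le_trans _ _ (S * ((d - c + 1) * (D * E)))); last first.
  rewrite -mulrA ler_wpM2r ?hS ?mulr_ge0//; lra.
rewrite /S mulr_suml (le_trans (ler_norm_sum _ _ _))//; apply: ler_sum => n _.
set v := 2 * x.1.2 - _ + s.
rewrite -mulr_sumr normrM.
apply: (@le_trans _ _ ((a <= 2 * x.2 - n%:~R <= b)%R%:R * D * ((d - c + 1) * E))).
  rewrite ler_pM//; first exact: hi.
  rewrite (le_trans (ler_norm_sum _ _ _))//.
  apply: (@le_trans _ _ (\sum_(m <- zw K) (c <= v - m%:~R <= d)%R%:R * E)).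
    by apply: ler_sum => m _; exact: hi.
  by rewrite -mulr_suml ler_wpM2r// count_zw_sub//; lra.
by rewrite le_eqVlt; apply/orP; left; apply/eqP; ring.
Qed.

Lemma continuous_seq_sum (T : topologicalType) (I : Type) (r : seq I)
    (F : I -> T -> R) (x : T) :
  (forall i, {for x, continuous (F i)}) ->
  {for x, continuous (fun y => \sum_(i <- r) F i y)}.
Proof.
move=> h; elim: r => [|i r IH].
  rewrite (_ : (fun _ => _) = cst 0); first exact: cst_continuous.
  by apply/funext => y; rewrite big_nil.
rewrite (_ : (fun _ => _) = (fun y => F i y + \sum_(j <- r) F j y)).
  exact: (continuousD (h i) IH).
by apply/funext => y; rewrite big_cons.
Qed.

Lemma near_norm_le (T : topologicalType) (f : T -> R) (x : T) (B : R) :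
  {for x, continuous f} -> `|f x| < B -> \forall y \near x, `|f y| <= B.
Proof.
move=> cf hB; have e0 : 0 < B - `|f x| by rewrite subr_gt0.
have : \forall y \near x, `|f x - f y| < B - `|f x|.
  by move/cvgrPdist_lt : cf; exact.
apply: filterS => y hy.
have -> : f y = f x - (f x - f y) by ring.
by rewrite (le_trans (ler_normB _ _))//; lra.
Qed.

Lemma continuous_x1 x : {for x, continuous (fun y : heis R => y.1.1)}.
Proof. by apply: continuous_comp; [exact: cvg_fst|exact: cvg_fst]. Qed.

Lemma continuous_x2 x : {for x, continuous (fun y : heis R => y.1.2)}.
Proof. by apply: continuous_comp; [exact: cvg_fst|exact: cvg_snd]. Qed.

Lemma continuous_x3 x : {for x, continuous (fun y : heis R => y.2)}.
Proof. exact: cvg_snd. Qed.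

Lemma poincare_continuous a b c d s p q :
  supported a b p -> supported c d q -> continuous p -> continuous q ->
  continuous (poincare p q s).
Proof.
move=> hp hq cp cq x.
pose B := `|x.1.1| + `|x.1.2| + `|x.2| + 1.
have [K hK] := poincare_window a b c d s B.
have n1 := normr_ge0 x.1.1; have n2 := normr_ge0 x.1.2; have n3 := normr_ge0 x.2.
pose g (y : heis R) := \sum_(n <- zw K) \sum_(m <- zw K)
    p (2 * y.2 - n%:~R) * q (2 * y.1.2 - y.1.1 * (2 * y.2 - n%:~R) + s - m%:~R).
have hg : \forall y \near x, g y = poincare p q s y.
  have B1 : `|x.1.1| < B by rewrite /B; lra.
  have B2 : `|x.1.2| < B by rewrite /B; lra.
  have B3 : `|x.2| < B by rewrite /B; lra.
  near=> y; rewrite (hK K)//.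
  - by near: y; exact: near_norm_le (@continuous_x1 x) B1.
  - by near: y; exact: near_norm_le (@continuous_x2 x) B2.
  - by near: y; exact: near_norm_le (@continuous_x3 x) B3.
have gx : g x = poincare p q s x by exact: nbhs_singleton hg.
rewrite /continuous_at -gx.
apply: cvg_trans (_ : g y @[y --> x] --> g x); first exact: near_eq_cvg hg.
apply: continuous_seq_sum => n; apply: continuous_seq_sum => m.
have ck (r : R) : {for x, continuous (fun _ : heis R => r)} by exact: cst_continuous.
have cM (f h : heis R -> R) : {for x, continuous f} -> {for x, continuous h} ->
    {for x, continuous (fun y => f y * h y)} by exact: continuousM.
have cB (f h : heis R -> R) : {for x, continuous f} -> {for x, continuous h} ->
    {for x, continuous (fun y => f y - h y)} by exact: continuousB.
have cD (f h : heis R -> R) : {for x, continuous f} -> {for x, continuous h} ->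
    {for x, continuous (fun y => f y + h y)} by exact: continuousD.
have c2 : {for x, continuous (fun y : heis R => 2 * y.2 - n%:~R)}.
  by apply: (cB _ _ (cM _ _ (ck 2) (@continuous_x3 x)) (ck _)).
have c4 : {for x, continuous (fun y : heis R =>
    2 * y.1.2 - y.1.1 * (2 * y.2 - n%:~R) + s - m%:~R)}.
  exact: (cB _ _ (cD _ _ (cB _ _ (cM _ _ (ck 2) (@continuous_x2 x))
    (cM _ _ (@continuous_x1 x) c2)) (ck s)) (ck _)).
apply: (cM (fun y : heis R => p (2 * y.2 - n%:~R))
  (fun y : heis R => q (2 * y.1.2 - y.1.1 * (2 * y.2 - n%:~R) + s - m%:~R))).
  exact: (@continuous_comp _ _ _ (fun y : heis R => 2 * y.2 - n%:~R) p _ c2 (cp _)).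
exact: (@continuous_comp _ _ _ (fun y : heis R =>
  2 * y.1.2 - y.1.1 * (2 * y.2 - n%:~R) + s - m%:~R) q _ c4 (cq _)).
Unshelve. all: by end_near. Qed.

End poincare_series.

(** * Left-invariant derivatives and C^k norms of the series *)

Section poincare_derivatives.
Context {R : realType}.
Implicit Types (P Q : nat -> R -> R) (p q : R -> R) (x : heis R) (s : R).

(* the derivative of a Poincare series along the i-th basis element is again a
   Poincare series; topP i and topQ i are the towers of its two factors *)
Definition topP (i : 'I_3) P (j : nat) (w : R) : R :=
  match nat_of_ord i with
  | 0%N => - (w * P j w + j%:R * P j.-1 w)
  | 1%N => 2 * P j w
  | _ => 2 * P j.+1 w
  end.

Definition topQ (i : 'I_3) Q (j : nat) : R -> R :=
  if (i == 2 :> nat) then Q j else Q j.+1.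

(** For i = 0 this is Leibniz' rule for -w P(w): the second argument has derivative -w along E_12,
    and this factor is absorbed into the first cut-off. *)
Lemma topP_tower i P : tower P -> tower (topP i P).
Proof.
move=> hP j x; rewrite /topP; case: i => [[|[|i]] _] /=; last first.
- exact: is_derive_scale.
- exact: is_derive_scale.
rewrite (_ : (fun _ => _) = (fun w => -1 * (w * P j w + j%:R * P j.-1 w))); last first.
  by apply/funext => w; rewrite mulN1r.
case: j => [|j] /=.
  have := is_derive_scale (-1) (is_derive_add (is_derive_mul (is_derive_id x 1) (hP 0%N x))
    (is_derive_scale 0%:R (hP 0%N x))).
  by move=> H; apply: is_derive_eq H _; ring.
have := is_derive_scale (-1) (is_derive_add (is_derive_mul (is_derive_id x 1) (hP j.+1 x))
    (is_derive_scale j.+1%:R (hP j x))).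
by move=> H; apply: is_derive_eq H _; rewrite -[in RHS]natr1; ring.
Qed.

Lemma topQ_tower i Q : tower Q -> tower (topQ i Q).
Proof. by move=> hQ j x; rewrite /topQ; case: ifP => _. Qed.

Lemma topP_supported i P a b : (forall j, supported a b (P j)) ->
  forall j, supported a b (topP i P j).
Proof.
move=> h j y hy; rewrite /topP !(h _ y hy).
by case: i => [[|[|i]] _] /=; rewrite !mulr0 ?addr0 ?oppr0.
Qed.

Lemma topQ_supported i Q a b : (forall j, supported a b (Q j)) ->
  forall j, supported a b (topQ i Q j).
Proof. by move=> h j y hy; rewrite /topQ; case: ifP => _; apply: h. Qed.

Definition bounded_upto (r : nat) (D : R) P : Prop :=
  forall j y, (j <= r)%N -> `|P j y| <= D.

(** The factor w is harmless because it is bounded on the support of P. This is the only place where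
    the position of a support, and not just its length, affects a bound. *)
Lemma topP_bounded i P a b r D : (forall j, supported a b (P j)) ->
  bounded_upto r.+1 D P ->
  bounded_upto r ((`|a| + `|b| + r%:R + 2) * D) (topP i P).
Proof.
move=> sP hP j y jr.
have D0 : 0 <= D by rewrite (le_trans _ (hP 0%N 0 isT)).
have n1 := normr_ge0 a; have n2 := normr_ge0 b.
have r0 : (0 : R) <= r%:R by [].
have h2 k : (k <= r.+1)%N -> `|2 * P k y| <= (`|a| + `|b| + r%:R + 2) * D.
  move=> kr; rewrite normrM ger0_norm// ler_pM//; first by lra.
  exact: hP.
rewrite /topP; case: i => [[|[|i]] _] /=; last first.
- by apply: h2; rewrite ltnS.
- by apply: h2; rewrite (leq_trans jr).
rewrite normrN (le_trans (ler_normD _ _))// !normrM normr_nat.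
have h3 : `|y| * `|P j y| <= (`|a| + `|b|) * D.
  have [->|/(supported_norm (sP j)) hy] := eqVneq (P j y) 0.
    by rewrite normr0 mulr0 mulr_ge0// addr_ge0.
  by rewrite ler_pM// hP// (leq_trans jr).
have h4 : j%:R * `|P j.-1 y| <= r%:R * D.
  rewrite ler_pM ?ler_nat// hP//; lia.
by rewrite (le_trans (lerD h3 h4))// -mulrDl ler_wpM2r//; lra.
Qed.

Lemma topQ_bounded i Q r D : bounded_upto r.+1 D Q -> bounded_upto r D (topQ i Q).
Proof.
by move=> h j y jr; rewrite /topQ; case: ifP => _; apply: h; lia.
Qed.

(** Along E_12 and E_13 only the second argument moves, at rates -w and 2. Along E_23 the first
    moves at rate 2, while the changes 2 u t of 2 xi1 and of u (2 xi2 - n) cancel, so the second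
    stays put. Near t = 0 one window serves all t, and the finite sum is differentiated term by
    term. *)
Lemma poincare_is_derive i P Q a b c d s x : tower P -> tower Q ->
  (forall j, supported a b (P j)) -> (forall j, supported c d (Q j)) ->
  is_derive (0 : R) 1 (fun t => poincare (P 0%N) (Q 0%N) s (hmul x (hexp i t)))
    (poincare (topP i P 0%N) (topQ i Q 0%N) s x).
Proof.
move=> tP tQ sP sQ.
pose B := 2 * `|x.1.1| + `|x.1.2| + `|x.2| + 2.
have [K hK] := poincare_window a b c d s B.
have n1 := normr_ge0 x.1.1; have n2 := normr_ge0 x.1.2; have n3 := normr_ge0 x.2.
pose w n : R := 2 * x.2 - n%:~R.
pose v n m : R := 2 * x.1.2 - x.1.1 * w n + s - m%:~R.
pose A : R := 2 *+ (i == 2 :> nat).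
pose C n : R := if (i == 0 :> nat) then - w n else 2 *+ (i == 1 :> nat).
pose g (t : R) := \sum_(n <- zw K) \sum_(m <- zw K)
    P 0%N (A * t + w n) * Q 0%N (C n * t + v n m).
apply: (@near_eq_is_derive _ _ _ g).
  have : \forall t \near (0 : R), `|t| <= 1.
    apply: (@near_norm_le _ _ id); first exact: cvg_id.
    by rewrite normr0.
  apply: filterS => t t1.
  rewrite (hK K (P 0%N) (Q 0%N) _ (leqnn K) (sP 0%N) (sQ 0%N)).
  - apply: eq_bigr => n _; apply: eq_bigr => m _.
    rewrite /A /C /v /w /hmul /hexp /=.
    by case: i {A C g} => [[|[|[|//]]] _] /=; rewrite ?mulr0n ?mulr1n;
      congr (P _ _ * Q _ _); ring.
  - rewrite /hmul /hexp /= (le_trans (ler_normD _ _))//.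
    have : `|t *+ (i == 0 :> nat)| <= 1 by case: (_ == _); rewrite ?mulr0n ?normr0.
    by rewrite /B; lra.
  - rewrite /hmul /hexp /= (le_trans (ler_normD _ _))//.
    have := ler_normD x.1.2 (t *+ (i == 1 :> nat)).
    have : `|t *+ (i == 1 :> nat)| <= 1 by case: (_ == _); rewrite ?mulr0n ?normr0.
    have : `|x.1.1 * t *+ (i == 2 :> nat)| <= `|x.1.1|.
      case: (_ == _); rewrite ?mulr0n ?normr0//.
      by rewrite mulr1n normrM ler_piMr.
    by rewrite /B -mulrnAr; lra.
  - rewrite /hmul /hexp /= (le_trans (ler_normD _ _))//.
    have : `|t *+ (i == 2 :> nat)| <= 1 by case: (_ == _); rewrite ?mulr0n ?normr0.
    by rewrite /B; lra.
have sP' : supported a b (topP i P 0%N) by exact: topP_supported.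
have sQ' : supported c d (topQ i Q 0%N) by exact: topQ_supported.
rewrite (hK K _ _ _ (leqnn K) sP' sQ').
- apply: is_derive_seq => n; apply: is_derive_seq => m.
  have h1 : is_derive (0 : R) 1 (fun t => P 0%N (A * t + w n)) (P 1%N (w n) * A).
    by apply: is_derive_affine; rewrite mulr0 add0r.
  have h2 : is_derive (0 : R) 1 (fun t => Q 0%N (C n * t + v n m)) (Q 1%N (v n m) * C n).
    by apply: is_derive_affine; rewrite mulr0 add0r.
  apply: is_derive_eq (is_derive_mul h1 h2) _.
  rewrite !mulr0 !add0r -/(w n) -/(v n m) /A /C /topP /topQ.
  by case: i {A C g h1 h2 sP' sQ'} => [[|[|[|//]]] _] /=; rewrite ?mulr0n ?mulr1n; ring.
- by rewrite /B; lra.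
- by rewrite /B; lra.
- by rewrite /B; lra.
Qed.

Lemma lderiv_poincare i P Q a b c d s : tower P -> tower Q ->
  (forall j, supported a b (P j)) -> (forall j, supported c d (Q j)) ->
  lderiv i (poincare (P 0%N) (Q 0%N) s) = poincare (topP i P 0%N) (topQ i Q 0%N) s.
Proof.
move=> tP tQ sP sQ; apply/funext => x; rewrite /lderiv derive1E.
by have [_ ->] := poincare_is_derive i s x tP tQ sP sQ.
Qed.

Lemma poincare_Ck k P Q a b c d s : tower P -> tower Q ->
  (forall j, supported a b (P j)) -> (forall j, supported c d (Q j)) ->
  Ck k (poincare (P 0%N) (Q 0%N) s).
Proof.
elim: k P Q => [|k IH] P Q tP tQ sP sQ.
  by split => //; apply: poincare_continuous (sP 0%N) (sQ 0%N) _ _;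
    exact: tower_continuous.
split.
  by apply: poincare_continuous (sP 0%N) (sQ 0%N) _ _; exact: tower_continuous.
move=> i; split.
  by move=> x; have [] := poincare_is_derive i s x tP tQ sP sQ.
rewrite (lderiv_poincare i s tP tQ sP sQ); apply: IH.
- exact: topP_tower.
- exact: topQ_tower.
- exact: topP_supported.
- exact: topQ_supported.
Qed.

Lemma supnorm_le (f : heis R -> R) (M : R) :
  (forall x, `|f x| <= M) -> supnorm f <= M.
Proof.
move=> h; apply: ge_sup; first by exists `|f (0, 0, 0)|; exists (0, 0, 0).
by move=> _ [x _ <-].
Qed.

(** [r] counts the orders of differentiation still controlled after the word [w]; each letter uses
    up one, so [r] has to vary in the induction. *)
Lemma foldr_lderiv_bounded (w : seq 'I_3) P Q a b c d s (r : nat) (D E : R) :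
  a <= b -> c <= d -> tower P -> tower Q ->
  (forall j, supported a b (P j)) -> (forall j, supported c d (Q j)) ->
  bounded_upto (size w + r) D P -> bounded_upto (size w + r) E Q ->
  exists P' Q', [/\ foldr lderiv (poincare (P 0%N) (Q 0%N) s) w =
      poincare (P' 0%N) (Q' 0%N) s,
    tower P' /\ tower Q',
    (forall j, supported a b (P' j)) /\ (forall j, supported c d (Q' j)) &
    bounded_upto r ((`|a| + `|b| + (size w + r)%:R + 2) ^+ size w * D) P' /\
    bounded_upto r E Q'].
Proof.
move=> ab cd tP tQ sP sQ; elim: w r => [|i w IH] r bP bQ.
  by exists P, Q; rewrite /= expr0 mul1r.
have [||P' [Q' [e [tP' tQ'] [sP' sQ'] [bP' bQ']]]] := IH r.+1.
- by move: bP; rewrite /= addSnnS.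
- by move: bQ; rewrite /= addSnnS.
exists (topP i P'), (topQ i Q'); split => /=.
- by rewrite e (lderiv_poincare i s tP' tQ' sP' sQ').
- by split; [exact: topP_tower|exact: topQ_tower].
- by split; [exact: topP_supported|exact: topQ_supported].
split; last exact: topQ_bounded.
move=> j y jr; apply: le_trans (topP_bounded i sP' bP' y jr) _.
have D0 : 0 <= D by rewrite (le_trans _ (bP 0%N 0 isT)).
rewrite exprS -mulrA -addSnnS ler_wpM2r//.
  by rewrite mulr_ge0// exprn_ge0.
by rewrite lerD2r lerD2l ler_nat /=; lia.
Qed.

Lemma Ck_norm_poincare k P Q a b c d s (D E : R) :
  a <= b -> c <= d -> tower P -> tower Q ->
  (forall j, supported a b (P j)) -> (forall j, supported c d (Q j)) ->
  bounded_upto k D P -> bounded_upto k E Q ->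
  Ck_norm k (poincare (P 0%N) (Q 0%N) s) <=
    \sum_(n < k.+1) \sum_(w : n.-tuple 'I_3)
      (`|a| + `|b| + k%:R + 2) ^+ k * (b - a + 1) * ((d - c + 1) * (D * E)).
Proof.
move=> ab cd tP tQ sP sQ bP bQ.
apply: ler_sum => n _; apply: ler_sum => w _; apply: supnorm_le => x.
have nk : (n <= k)%N by rewrite -ltnS.
have ek : (size w + (k - n) = k)%N by rewrite size_tuple subnKC.
have [||P' [Q' [e _ [sP' sQ'] [bP' bQ']]]] :=
  @foldr_lderiv_bounded w P Q a b c d s (k - n)%N D E ab cd tP tQ sP sQ.
- by rewrite ek.
- by rewrite ek.
rewrite e; apply: le_trans (poincare_bounded _ _ ab cd (sP' 0%N) (sQ' 0%N)
  (fun y => bP' 0%N y isT) (fun y => bQ' 0%N y isT)) _.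
rewrite ek size_tuple.
have D0 : 0 <= D by rewrite (le_trans _ (bP 0%N 0 isT)).
have E0 : 0 <= E by rewrite (le_trans _ (bQ 0%N 0 isT)).
set L := `|a| + `|b| + k%:R + 2.
have L1 : 1 <= L.
  by rewrite /L; have := normr_ge0 a; have := normr_ge0 b; have : (0 : R) <= k%:R by []; lra.
have -> : (b - a + 1) * (d - c + 1) * (L ^+ n * D * E) =
  L ^+ n * ((b - a + 1) * ((d - c + 1) * (D * E))) by ring.
rewrite -[leRHS]mulrA ler_wpM2r//; last exact: ler_weXn2l.
by rewrite !mulr_ge0//; lra.
Qed.

End poincare_derivatives.

(** * Integral of the series over the quotient *)

Section plateau_integrals.
Context {R : realType}.
Notation mu := (@lebesgue_measure R).
Local Notation mR := (measurableTypeR R).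

Lemma integral_primitive (f F : R -> R) (a b : R) : a < b -> continuous f ->
  (forall x : R, is_derive x 1 F (f x)) ->
  (\int[mu]_(x in `[a, b]) (f x)%:E = (F b - F a)%:E)%E.
Proof.
move=> ab cf dF; have cF x := is_derive_continuous (dF x).
rewrite (@continuous_FTC2 _ f F)//.
- exact: continuous_subspaceT.
- split; first by move=> x _; have [] := dF x.
  + by apply: cvg_at_right_filter; exact: cF.
  + by apply: cvg_at_left_filter; exact: cF.
- by move=> x _; rewrite derive1E; have [_ ->] := dF x.
Qed.

Lemma plateau_integral (p q d a b : R) : p <= q -> 0 < d -> a < p -> q + d < b ->
  (\int[mu]_(x in `[a, b]) (plateau p q d 0 x)%:E = (q - p)%:E)%E.
Proof.
move=> pq d0 ap qb.
have ab : a < b by rewrite (lt_trans ap)// (le_lt_trans pq)// (le_lt_trans _ qb)// lerDl ltW.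
rewrite (integral_primitive ab (tower_continuous (j := 0%N) (plateau_tower p q d))
  (plateauI_derive p q d0)).
by rewrite plateauI_right// ?(ltW qb)// plateauI_left ?subr0// ltW.
Qed.

Lemma plateau_Rintegral (p q d : R) : p <= q -> 0 < d ->
  (\int[mu]_x plateau p q d 0 x)%R = q - p.
Proof.
move=> pq d0; rewrite /Rintegral.
suff -> : (\int[mu]_x (plateau p q d 0 x)%:E = (q - p)%:E)%E by [].
rewrite -(@plateau_integral p q d (p - 1) (q + d + 1))//; [|lra|lra].
rewrite [RHS]integral_mkcond; apply: eq_integral => x _.
rewrite patchE; case: ifPn => //; rewrite notin_setE /= in_itv /= => /negP.
rewrite negb_and -!ltNge => /orP[] h.
  by rewrite plateau_left//; lra.
by rewrite plateau_right//; lra.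
Qed.

Lemma big_zw (K : nat) (F : int -> R) :
  \sum_(m <- zw K) F m = \sum_(0 <= i < K.*2.+1) F (i%:Z - K%:Z).
Proof. by rewrite /zw big_map /index_iota subn0. Qed.

(** Writing u_i for the primitive at r + K + 2 - i, each term is u_i - u_(i+2), the difference of
    the consecutive values u_i + u_(i+1) and u_(i+1) + u_(i+2). Two terms survive on the right of
    the support, each equal to q - p, and the two on the left vanish. *)
Lemma plateauI_telescope (p q d r : R) K : p <= q -> 0 < d ->
  q + d - 1 <= r + K%:R -> r - K%:R <= p - 1 ->
  \sum_(m <- zw K) (plateauI p q d (2 + r - m%:~R) - plateauI p q d (r - m%:~R)) =
  2 * (q - p).
Proof.
move=> pq d0 h1 h2; rewrite big_zw.
pose u (i : nat) := plateauI p q d (r + K%:R + 2 - i%:R).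
rewrite (eq_bigr (fun i => - (u i.+1 + u i.+2) - - (u i + u i.+1))); last first.
  move=> i _; rewrite /u rmorphB /= -!pmulrn -![in i.+2%:R]natr1 -![in i.+1%:R]natr1.
  rewrite opprD opprK addrACA [X in _ = X](_ : _ = plateauI p q d (r + K%:R + 2 - i%:R)
    - plateauI p q d (r + K%:R + 2 - (i%:R + 1 + 1))); last by ring.
  by congr (plateauI _ _ _ _ - plateauI _ _ _ _); ring.
rewrite (telescope_sumr (fun i => - (u i + u i.+1)))// /u.
rewrite ![plateauI _ _ _ (_ - K.*2.+1%:R)]plateauI_left ?[plateauI _ _ _ (_ - K.*2.+2%:R)]plateauI_left//.
- rewrite !plateauI_right//; first by ring.
  + by rewrite mulr1n; lra.
  + by rewrite mulr0n; lra.
- by rewrite -addnn -!natr1 natrD; lra.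
- by rewrite -addnn -!natr1 natrD; lra.
Qed.

(** As y runs over [0, 1], 2 y covers two periods of the sum over m, and the Jacobian 1/2
    compensates: each i contributes c_i (q - p) whatever its shift. The window condition is
    restricted to c_i != 0, since the shifts are controlled only there. *)
Lemma periodized_integral (p q d : R) (I : Type) (l : seq I) (c r : I -> R) (K : nat) :
  p <= q -> 0 < d ->
  (forall i, c i != 0 -> `|r i| + `|p| + `|q| + d + 1 <= K%:R) ->
  (\int[mu]_(y in `[0%R, 1%R[)
    (\sum_(i <- l) c i * \sum_(m <- zw K) plateau p q d 0 (2 * y + (r i - m%:~R)))%:E =
   ((\sum_(i <- l) c i) * (q - p))%:E)%E.
Proof.
move=> pq d0 hK.
pose F (y : R) := \sum_(i <- l) c i * \sum_(m <- zw K)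
  (2^-1 * plateauI p q d (2 * y + (r i - m%:~R))).
pose f (y : R) := \sum_(i <- l) c i * \sum_(m <- zw K)
  plateau p q d 0 (2 * y + (r i - m%:~R)).
have cf : continuous f.
  move=> x; apply: continuous_seq_sum => i.
  apply: (@continuousM _ _ (cst (c i))); first exact: cst_continuous.
  apply: continuous_seq_sum => m.
  exact: is_derive_continuous (is_derive_affine (plateau_tower p q d 0%N _)).
have dF (x : R) : is_derive x 1 F (f x).
  apply: is_derive_seq => i; apply: is_derive_scale; apply: is_derive_seq => m.
  apply: is_derive_eq (is_derive_scale 2^-1
    (is_derive_affine (plateauI_derive p q d0 _))) _.
  by field.
rewrite integral_itv_bndo_bndc; last first.
  apply/measurable_EFinP; apply: (@measurable_funS _ _ _ _ setT) => //.
  exact: continuous_measurable_fun.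
rewrite (integral_primitive ltr01 cf dF) /F; congr (_%:E).
rewrite -sumrB mulr_suml; apply: eq_bigr => i _.
rewrite -mulrBr; have [->|ci] := eqVneq (c i) 0; first by rewrite !mul0r.
congr (_ * _); have := hK i ci.
have := ler_norm (r i); have := ler_norm (- r i); rewrite normrN.
have := ler_norm (p); have := ler_norm (- p); rewrite normrN.
have := ler_norm (q); have := ler_norm (- q); rewrite normrN => *.
rewrite -sumrB (eq_bigr (fun m : int => 2^-1 *
  (plateauI p q d (2 + r i - m%:~R) - plateauI p q d (r i - m%:~R)))).
  rewrite -mulr_sumr plateauI_telescope//; [by field|lra|lra].
by move=> m _; rewrite -mulrBr mulr1 mulr0 add0r addrA.
Qed.

End plateau_integrals.

Section poincare_integral.
Context {R : realType}.
Notation mu := (@lebesgue_measure R).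
Local Notation mR := (measurableTypeR R).

Lemma plateau_supported (p q d : R) j : p <= q -> 0 < d ->
  supported p (q + d) (plateau p q d j).
Proof.
move=> pq d0 y; rewrite negb_and -!ltNge => /orP[] /ltW h.
  exact: plateau_left.
exact: plateau_right.
Qed.

Lemma measurable_plateau (p q d : R) : measurable_fun setT (plateau p q d 0 : mR -> mR).
Proof.
by apply: continuous_measurable_fun; exact: tower_continuous (plateau_tower p q d).
Qed.

(** The integral over xi1 comes before the others: for fixed u and xi2 it turns the second factor
    into d - c, which removes the dependence on u along with the shift s. The integral over xi2 then
    turns the sum over n into b - a. *)
Lemma quotient_integral_poincare (a b c d e s : R) : a <= b -> c <= d -> 0 < e ->
  quotient_integral (poincare (plateau a b e 0) (plateau c d e 0) s) =
  (b - a) * (d - c).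
Proof.
move=> ab cd e0.
have sp := plateau_supported 0 ab e0; have sq := plateau_supported 0 cd e0.
have [K0 hK0] := poincare_window a (b + e) c (d + e) s 1.
pose W := `|a| + `|b + e|.
(* One window large enough both to represent the series on the fundamental domain and to make the
   two telescoping sums complete. *)
pose K := maxn K0 (Num.truncn (W + `|s| + `|a| + `|b| + `|c| + `|d| + e + 2)).+1.
have KW : W + `|s| + `|a| + `|b| + `|c| + `|d| + e + 2 <= K%:R.
  by apply: le_trans (ltW (truncnS_gt _)) _; rewrite ler_nat leq_maxr.
pose g (x : heis R) : R := \sum_(n <- zw K)
  plateau a b e 0 (2 * x.2 - n%:~R) * \sum_(m <- zw K)
  plateau c d e 0 (2 * x.1.2 + (- x.1.1 * (2 * x.2 - n%:~R) + s - m%:~R)).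
have gE x : fund_dom x -> poincare (plateau a b e 0) (plateau c d e 0) s x = g x.
  case=> /andP[x1 x1'] /andP[x2 x2'] /andP[x3 x3'].
  rewrite (hK0 K)// ?leq_maxl// ?ger0_norm// ?ltW//.
  apply: eq_bigr => n _; rewrite mulr_sumr; apply: eq_bigr => m _.
  by congr (_ * plateau _ _ _ _ _); ring.
have g0 x : 0 <= g x.
  apply: sumr_ge0 => n _; rewrite mulr_ge0 ?plateau_ge0//.
  by apply: sumr_ge0 => m _; rewrite plateau_ge0.
have mg : measurable_fun setT (g : mR * mR * mR -> mR).
  have m1 : measurable_fun setT (fun x : mR * mR * mR => x.1.1 : mR).
    exact: (measurableT_comp (measurable_fst) measurable_fst).
  have m2 : measurable_fun setT (fun x : mR * mR * mR => x.1.2 : mR).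
    exact: (measurableT_comp (measurable_snd) measurable_fst).
  have m3 : measurable_fun setT (fun x : mR * mR * mR => x.2 : mR).
    exact: measurable_snd.
  have mc (r : R) : measurable_fun setT (fun _ : mR * mR * mR => r : mR).
    exact: measurable_cst.
  have mw n : measurable_fun setT (fun x : mR * mR * mR => (2 * x.2 - n%:~R : R) : mR).
    by apply: measurable_funB => //; exact: measurable_funM.
  apply: measurable_sum => n; apply: measurable_funM.
    exact: (measurableT_comp (measurable_plateau a b e)).
  apply: measurable_sum => m.
  apply: (measurableT_comp (measurable_plateau c d e)).
  apply: measurable_funD; first exact: measurable_funM.
  apply: measurable_funB => //; apply: measurable_funD => //.
  apply: measurable_funM; [exact: measurable_funN|exact: mw].
pose I : set mR := `[0, 1[%classic.
have mI : measurable I by exact: measurable_itv.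
have I1 : mu I = 1%E by rewrite lebesgue_measure_itv/= lte_fin ltr01 oppr0 adde0.
have fundE : fund_dom = (I `*` I) `*` I :> set (mR * mR * mR).
  apply/seteqP; split=> -[[x y] z]; rewrite /fund_dom /I /= !in_itv/=;
    by [case|case; case].
have mF : measurable (fund_dom : set (mR * mR * mR)).
  rewrite fundE; apply: measurableX => //; exact: measurableX.
pose h : mR * mR * mR -> \bar R := (EFin \o g) \_ fund_dom.
have mh : measurable_fun setT h.
  apply/(measurable_restrictT _ mF).
  apply/measurable_EFinP; by apply: (@measurable_funS _ _ _ _ setT).
have h0 x : (0 <= h x)%E by rewrite /h patchE; case: ifP => // _; rewrite lee_fin.
pose G (z : R) : R := (\sum_(n <- zw K) plateau a b e 0 (2 * z - n%:~R)) * (d - c).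
have hE x y z : h ((x, y), z) =
    if (z \in I) && (x \in I) then ((fun y => (g ((x, y), z))%:E) \_ I) y else 0%E.
  rewrite /h patchE fundE !in_setX /= patchE.
  by case: (x \in I); case: (y \in I); case: (z \in I).
have step1 x z : (\int[mu]_y h ((x, y), z) =
    if (z \in I) && (x \in I) then (G z)%:E else 0)%E.
  under eq_integral do rewrite hE.
  case: ifPn => [/andP[zI xI]|_]; last by rewrite integral0.
  rewrite -integral_mkcond /g /=.
  apply: (@periodized_integral R c d e int (zw K)
    (fun n : int => plateau a b e 0 (2 * z - n%:~R))
    (fun n : int => - x * (2 * z - n%:~R) + s) K cd e0) => n hn.
  have := supported_norm sp hn; rewrite -/W => hw.
  rewrite (le_trans _ KW)//.
  have hx : `|- x * (2 * z - n%:~R)| <= W.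
    rewrite normrM normrN (le_trans _ hw)// ler_piMl//.
    by move: xI; rewrite inE /I /= in_itv /= => /andP[h1 h2]; rewrite ger0_norm// ltW.
  have := ler_normD (- x * (2 * z - n%:~R)) s.
  have := normr_ge0 a; have := normr_ge0 b; lra.
have step2 z : (\int[lebesgue2]_w h (w, z) = if z \in I then (G z)%:E else 0)%E.
  have mhz : measurable_fun setT (fun w : mR * mR => h (w, z)).
    by apply: (measurableT_comp mh); exact: measurable_pair2.
  have -> : (\int[lebesgue2]_w h (w, z) = \int[mu]_x \int[mu]_y h ((x, y), z))%E.
    rewrite -(@fubini_tonelli1 _ _ _ _ _ mu mu _ mhz (fun w => h0 (w, z))).
    exact: eq_measure_integral.
  under eq_integral do rewrite step1.
  case: (z \in I) => /=; last by rewrite integral0.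
  transitivity (\int[mu]_(x in I) (G z)%:E)%E.
    by rewrite [RHS]integral_mkcond; apply: eq_integral => x _; rewrite patchE.
  by rewrite integral_cst// -[X in (_ * X)%E]/(mu I) I1 mule1.
rewrite /quotient_integral /Rintegral.
suff -> : (\int[haar]_(x in fund_dom)
    (poincare (plateau a b e 0) (plateau c d e 0) s x)%:E = ((b - a) * (d - c))%:E)%E by [].
transitivity (\int[haar]_x h x)%E.
  rewrite integral_mkcond; apply: eq_integral => x _; rewrite /h !patchE.
  by case: ifPn => //; rewrite inE => /gE /= ->.
transitivity (\int[mu]_z \int[lebesgue2]_w h (w, z))%E.
  rewrite -(@fubini_tonelli2 _ _ _ _ _ lebesgue2 mu _ mh h0).
  exact: eq_measure_integral.
under eq_integral do rewrite step2.
transitivity (\int[mu]_(z in I) (G z)%:E)%E.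
  by rewrite [RHS]integral_mkcond; apply: eq_integral => z _; rewrite patchE.
have hK' : forall i : unit, d - c != 0 -> `|(0:R)| + `|a| + `|b| + e + 1 <= K%:R.
  move=> _ _; rewrite normr0 add0r (le_trans _ KW)//.
  have : 0 <= W by rewrite addr_ge0.
  have := normr_ge0 s; have := normr_ge0 c; have := normr_ge0 d; lra.
have := @periodized_integral R a b e unit [:: tt] (fun _ => d - c) (fun _ => 0) K ab e0 hK'.
rewrite big_seq1 mulrC => <-; apply: eq_integral => z _.
rewrite /G big_seq1 mulrC; congr ((_ * _)%:E).
by apply: eq_bigr => m _; rewrite sub0r.
Qed.

End poincare_integral.

(** * Counting in boxes *)

Section smooth_box.
Context {R : realType}.

Lemma coprimez_bezout (c : nat) : exists a b : int -> int,
  forall d : int, coprimez c%:Z d -> a d * d - b d * c%:Z = 1.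
Proof.
have /choice[f hf] : forall d : int, exists ab : int * int,
    coprimez c%:Z d -> ab.1 * d - ab.2 * c%:Z = 1.
  move=> d; have [u [v uv]] := Bezoutz c%:Z d.
  exists (v, - u) => /eqP <-; rewrite -uv /=; ring.
by exists (fun d => (f d).1), (fun d => (f d).2).
Qed.

(* the unimodular change of variables k = a n - c m, m' = b n - d m + 1 turns
   the cut-offs of the series into d beta - d k + c m' and k / c *)
Lemma poincare_point (p q : R -> R) (al : R) (c : nat) (a b d : int) :
  (0 < c)%N -> a * d - b * c%:Z = 1 ->
  poincare p q (2 * al / c%:R)
    (a%:~R / c%:R, b%:~R * al + a%:~R / 2, d%:~R * al + c%:R / 2) =
  zsum2 (fun k m => p (d%:~R * (2 * al) - (d * k - c%:Z * m)%:~R) *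
                    q (k%:~R / c%:R)).
Proof.
move=> c0 hab; rewrite /poincare.
pose h (z : int * int) : int * int :=
  (d * z.1 - c%:Z * (z.2 - 1), b * z.1 - a * (z.2 - 1)).
have hb : bijective h.
  exists (fun z => (a * z.1 - c%:Z * z.2, b * z.1 - d * z.2 + 1)).
    move=> [x y]; rewrite /h /=; congr (_, _).
      rewrite (_ : _ - _ = (a * d - b * c%:Z) * x); first by rewrite hab mul1r.
      by ring.
    rewrite (_ : _ + 1 = (a * d - b * c%:Z) * (y - 1) + 1); last by ring.
    by rewrite hab; ring.
  move=> [x y]; rewrite /h /=; congr (_, _).
    rewrite (_ : _ - _ = (a * d - b * c%:Z) * x); first by rewrite hab mul1r.
    by ring.
  rewrite (_ : _ - _ = (a * d - b * c%:Z) * y); first by rewrite hab mul1r.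
  by ring.
rewrite (@zsum2_reindex _ h)//; apply: eq_zsum2 => k m; rewrite /h /=.
have cR : c%:R != 0 :> R by rewrite pnatr_eq0 -lt0n.
have e1 : (a%:~R * d%:~R - b%:~R * c%:R = 1 :> R).
  by have := congr1 (fun z : int => z%:~R : R) hab; rewrite intrB !intrM -pmulrn.
have e2 : b%:~R = (a%:~R * d%:~R - 1) / c%:R :> R.
  by apply: (mulIf cR); rewrite mulfVK//; move: e1; lra.
congr (p _ * q _); rewrite !(intrD, intrN, intrM) -!pmulrn ?e2.
  by field.
by field.
Qed.

Lemma fsbig_coprime_window (F : int -> R) (c K : nat) :
  (forall d, (K < `|d|)%N -> F d = 0) ->
  \sum_(d \in [set d : int | coprimez c%:Z d]) F d =
  \sum_(d <- zw K | coprimez c%:Z d) F d.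
Proof.
move=> h; rewrite (fsbigE [seq d <- zw K | coprimez c%:Z d]).
- rewrite -[RHS]big_filter [RHS]big_seq [LHS]big_seq_cond.
  apply: eq_bigl => d; rewrite mem_filter; case hd: (coprimez _ _) => //=.
  have -> : d \in [set d : int | coprimez c%:Z d] by exact: mem_set.
  by rewrite andbT.
- by rewrite filter_uniq// zw_uniq.
- move=> d hd; suff : coprimez c%:Z d && (d \in zw K) by move=> /andP[].
  by rewrite -mem_filter.
- move=> d hd; rewrite mem_filter negb_and => /orP[/negP//|].
  rewrite mem_zw -ltnNge; exact: h.
Qed.

(** The first cut-off is confined to [-W, W] because derivatives along E_12 bring out its argument.
    The second may sit anywhere: only its length matters, through the number of terms, and enters
    linearly as H. The exponent 3 r collects e0^-r from nu and from each of the two factors of the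
    series. The shift 2 al / c in the series cancels the part of the second argument that depends on
    al. *)
Lemma smooth_box : equidistribution R ->
  exists e : nat, exists2 kappa0 : R, 2 <= kappa0 &
  forall kappa : R, kappa <= kappa0 -> exists2 s : R, 0 < s &
  forall al : R, diophantine kappa al -> forall W : R, 1 <= W ->
  exists K : R, exists C0 : nat, 0 <= K /\
  forall (c : nat) (i0 i1 b0 b1 j0 j1 H e0 : R), (C0 <= c)%N -> (0 < c)%N ->
    0 < e0 -> e0 <= 1 -> -2 <= i0 -> i0 <= i1 -> i1 <= 1 ->
    - W <= b0 -> b0 <= b1 -> b1 <= W -> j0 <= j1 -> j1 <= j0 + H -> 1 <= H ->
    `| \sum_(d <- zw c.*2 | coprimez c%:Z d) plateau i0 i1 e0 0 (d%:~R / c%:R) *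
         zsum2 (fun k m =>
           plateau b0 b1 e0 0 (d%:~R * (2 * al) - (d * k - c%:Z * m)%:~R) *
           plateau j0 j1 e0 0 (k%:~R / c%:R))
       - (totient c)%:R * ((i1 - i0) * (b1 - b0) * (j1 - j0)) |
    <= K * ((totient c)%:R * H * e0^-1 ^+ e * c%:R `^ (- s)).
Proof.
move=> [k [l [kappa0 k02 hE]]]; pose r := maxn k l.
exists (3 * r)%N, kappa0 => // kappa kk; have [s s0 {}hE] := hE _ kk.
exists s => // al hal W W1; have [KE [C0 _ {}hE]] := hE _ hal.
have [T T0 hT] := @plateau_bounded R r.
pose N : R := \sum_(n < k.+1) \sum_(w : n.-tuple 'I_3)
  (2 * W + k%:R + 3) ^+ k * (2 * W + 2) * (3 * (T * T)).
exists (`|KE| * (2 * (l.+1%:R * T) * N)), C0; split.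
  rewrite !mulr_ge0//; apply: sumr_ge0 => n _; apply: sumr_ge0 => w _.
  have k0 : (0 : R) <= k%:R by [].
  by rewrite !mulr_ge0 ?exprn_ge0//; lra.
move=> c i0 i1 b0 b1 j0 j1 H e0 cC c0 e00 e01 hi0 hi hi1 hb0 hb hb1 hj hjH H1.
have [a [b hab]] := coprimez_bezout c.
pose nu : R -> R := plateau i0 i1 e0 0.
pose f : heis R -> R := poincare (plateau b0 b1 e0 0) (plateau j0 j1 e0 0) (2 * al / c%:R).
have cR : 0 < c%:R :> R by rewrite ltr0n.
have phi0 : 0 < (totient c)%:R :> R by rewrite ltr0n totient_gt0.
have sP := fun j => plateau_supported j hb e00.
have sQ := fun j => plateau_supported j hj e00.
have tP := plateau_tower b0 b1 e0; have tQ := plateau_tower j0 j1 e0.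
have tN := plateau_tower i0 i1 e0.
(* The support [i0, i1 + e0] lies in [-2, 2], which gives L = 2 in (E). *)
have nuE x : 2 < `|x| -> nu x = 0.
  rewrite ltr_normr => /orP[] h; first by apply: plateau_right => //; lra.
  by apply: plateau_left => //; lra.
have := hE c cC f nu 2 a b (poincare_invariant _ _ _)
  (poincare_Ck _ _ tP tQ sP sQ) (tower_smooth tN) _ nuE hab.
have -> : (1 <= 2 :> R) by clear; lra.
move=> /(_ isT).
rewrite /quotient_integral -/(quotient_integral f) quotient_integral_poincare//.
rewrite plateau_Rintegral//.
rewrite (@fsbig_coprime_window _ _ c.*2); last first.
  move=> d hd; rewrite nuE ?mul0r// normrM normfV normr_nat ltr_pdivlMr//.
  by rewrite -intr_norm -natr_absz -natrM ltr_nat mul2n.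
set S := \sum_(d <- _ | _) _; set S' := \sum_(d <- _ | _) _.
have -> : S = S'.
  apply: eq_bigr => d hd; rewrite /nu /f poincare_point//; exact: hab.
move=> h.
have {h} h2 : `|S' - (totient c)%:R * ((i1 - i0) * (b1 - b0) * (j1 - j0))| <=
    (totient c)%:R * (KE * (2 * Cl_norm l nu * Ck_norm k f * c%:R `^ (- s))).
  rewrite (_ : S' - _ = (totient c)%:R *
    ((totient c)%:R^-1 * S' - (i1 - i0) * ((b1 - b0) * (j1 - j0)))).
    by rewrite normrM ger0_norm ?ler_pM2l// ltW.
  by field; rewrite gt_eqF.
apply: le_trans h2 _.
have ie : 1 <= e0^-1 by rewrite invf_ge1.
have ie0 : 0 <= e0^-1 by rewrite (le_trans _ ie).
have hCl : Cl_norm l nu <= l.+1%:R * T * e0^-1 ^+ r.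
  rewrite /Cl_norm -mulrA mulr_natl -[X in _ *+ X]card_ord -sumr_const.
  apply: ler_sum => j _; apply: ge_sup; first by exists `|derive1n j nu 0|; exists 0.
  move=> _ [x _ <-]; rewrite (tower_derive1n _ tN) hT//.
  by rewrite (leq_trans _ (leq_maxr _ _))// -ltnS.
have hCl0 : 0 <= Cl_norm l nu.
  rewrite /Cl_norm; apply: sumr_ge0 => j _.
  apply: (@le_trans _ _ `|derive1n j nu 0|) => //.
  apply: ub_le_sup; last by exists 0.
  exists (T * e0^-1 ^+ r) => _ [x _ <-]; rewrite (tower_derive1n _ tN) hT//.
  by rewrite (leq_trans _ (leq_maxr _ _))// -ltnS.
have bP : bounded_upto k (T * e0^-1 ^+ r) (plateau b0 b1 e0).
  by move=> j y jk; apply: hT => //; rewrite (leq_trans jk)// leq_maxl.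
have bQ : bounded_upto k (T * e0^-1 ^+ r) (plateau j0 j1 e0).
  by move=> j y jk; apply: hT => //; rewrite (leq_trans jk)// leq_maxl.
have hCk : Ck_norm k f <= N * (H * (e0^-1 ^+ r * e0^-1 ^+ r)).
  have b1' : b0 <= b1 + e0 by move: hb e00; clear; lra.
  have j1' : j0 <= j1 + e0 by move: hj e00; clear; lra.
  apply: le_trans (Ck_norm_poincare _ b1' j1' tP tQ sP sQ bP bQ) _.
  rewrite /N mulr_suml; apply: ler_sum => n _; rewrite mulr_suml; apply: ler_sum => w _.
  have k0 : (0 : R) <= k%:R by [].
  have nb0 : `|b0| <= W.
    by rewrite ler_norml; move: hb0 hb hb1; clear => *; apply/andP; split; lra.
  have nb1 : `|b1 + e0| <= W + 1.
    by rewrite ler_norml; move: hb0 hb hb1 e00 e01; clear => *; apply/andP; split; lra.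
  have q0 := normr_ge0 b0; have q1 := normr_ge0 (b1 + e0).
  set E := e0^-1 ^+ r; have E0 : 0 <= E by rewrite exprn_ge0.
  have TE : 0 <= T * E * (T * E) by rewrite !mulr_ge0.
  have -> : (2 * W + k%:R + 3) ^+ k * (2 * W + 2) * (3 * (T * T)) * (H * (E * E)) =
    (2 * W + k%:R + 3) ^+ k * (2 * W + 2) * (3 * H * (T * E * (T * E))) by ring.
  apply: ler_pM.
  - by rewrite mulr_ge0 ?exprn_ge0//; move: k0 q0 q1 b1'; clear; lra.
  - by rewrite mulr_ge0//; move: j1'; clear; lra.
  - apply: ler_pM; [rewrite exprn_ge0//| |rewrite lerXn2r ?nnegrE//|];
      by move: k0 q0 q1 b1' nb0 nb1 hb0 hb1 e01 W1; clear; lra.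
  - by rewrite ler_wpM2r//; move: hjH e01 H1; clear; lra.
have hCk0 : 0 <= Ck_norm k f.
  apply: sumr_ge0 => n _; apply: sumr_ge0 => w _.
  apply: (@le_trans _ _ `|foldr lderiv f w (0, 0, 0)|) => //.
  apply: ub_le_sup; last by exists (0, 0, 0).
  have nk : (n <= k)%N by rewrite -ltnS.
  have ek : (size w + (k - n) = k)%N by rewrite size_tuple subnKC.
  have b1' : b0 <= b1 + e0 by move: hb e00; clear; lra.
  have j1' : j0 <= j1 + e0 by move: hj e00; clear; lra.
  rewrite -ek in bP bQ.
  have [P' [Q' [-> _ [sP' sQ'] [bP' bQ']]]] :=
    foldr_lderiv_bounded (2 * al / c%:R) b1' j1' tP tQ sP sQ bP bQ.
  eexists => _ [x _ <-]; exact: (poincare_bounded _ _ b1' j1' (sP' 0%N) (sQ' 0%N)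
    (fun y => bP' 0%N y isT) (fun y => bQ' 0%N y isT)).
have ps : 0 <= c%:R `^ (- s) by exact: powR_ge0.
set E := e0^-1 ^+ r.
have E0 : 0 <= E by rewrite exprn_ge0.
have -> : e0^-1 ^+ (3 * r) = E * (E * E).
  by rewrite /E mulnC exprM !exprS expr0 mulr1.
have -> : `|KE| * (2 * (l.+1%:R * T) * N) *
   ((totient c)%:R * H * (E * (E * E)) * c%:R `^ (- s)) =
   (totient c)%:R * (`|KE| * (2 * (l.+1%:R * T * E) * (N * (H * (E * E))) * c%:R `^ (- s))).
  by ring.
rewrite ler_pM2l//; apply: le_trans (_ : `|KE| * (2 * Cl_norm l nu * Ck_norm k f * c%:R `^ (- s)) <= _).
  by rewrite ler_wpM2r ?ler_norm// !mulr_ge0.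
rewrite ler_wpM2l// ler_wpM2r// ler_pM ?mulr_ge0// ler_pM2l//.
Qed.

End smooth_box.

(** * Comparison of smooth boxes with counts of k *)

Section boxes.
Context {R : realType}.

Definition box_term (be : R) (c : nat) (d : int) (b0 b1 j0 j1 e : R) (k m : int) : R :=
  plateau b0 b1 e 0 (d%:~R * be - (d * k - c%:Z * m)%:~R) *
  plateau j0 j1 e 0 (k%:~R / c%:R).

Lemma box_term_ge0 be c d b0 b1 j0 j1 e k m : b0 <= b1 -> j0 <= j1 -> 0 < e ->
  0 <= box_term be c d b0 b1 j0 j1 e k m.
Proof. by move=> *; rewrite mulr_ge0// plateau_ge0. Qed.

Lemma plateau_neq0 (p q e y : R) : p <= q -> 0 < e -> plateau p q e 0 y != 0 ->
  p < y < q + e.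
Proof.
move=> pq e0 h; rewrite !ltNge -negb_or; apply: contraNN h => /orP[] h.
  by rewrite plateau_left.
by rewrite plateau_right.
Qed.

Lemma box_finite be (c : nat) d b0 b1 j0 j1 e : (0 < c)%N ->
  b0 <= b1 -> j0 <= j1 -> 0 < e ->
  exists L0 : nat, forall k m, box_term be c d b0 b1 j0 j1 e k m != 0 ->
    (`|k| <= L0)%N /\ (`|m| <= L0)%N.
Proof.
move=> c0 hb hj e0.
have c1 : 1 <= c%:R :> R by rewrite ler1n.
pose B1 := `|j0| + `|j1 + e|.
pose B2 := `|d%:~R * be| + `|b0| + `|b1 + e| + `|d%:~R| * (B1 * c%:R).
exists (Num.truncn (B1 * c%:R + B2)) => k m.
rewrite mulf_eq0 negb_or => /andP[h1 h2].
have {}h1 := supported_norm (plateau_supported 0 hb e0) h1.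
have {}h2 := supported_norm (plateau_supported 0 hj e0) h2.
have cp : 0 < c%:R :> R by lra.
have hk : `|k%:~R| <= B1 * c%:R :> R.
  by move: h2; rewrite normrM normfV normr_nat ler_pdivrMr.
have B10 : 0 <= B1 * c%:R by rewrite mulr_ge0 ?addr_ge0.
have B20 : 0 <= B2 by rewrite !addr_ge0// mulr_ge0.
have hm : `|m%:~R| <= B2 :> R.
  apply: (@le_trans _ _ `|c%:R * m%:~R|).
    by rewrite normrM ger0_norm// ler_peMl.
  have -> : c%:R * m%:~R = (d%:~R * be - (d * k - c%:Z * m)%:~R)
      - d%:~R * be + d%:~R * k%:~R :> R.
    by rewrite intrB !intrM -!pmulrn; ring.
  rewrite (le_trans (ler_normD _ _))//.
  have t1 := ler_normB (d%:~R * be - (d * k - c%:Z * m)%:~R) (d%:~R * be).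
  have t2 : `|d%:~R * k%:~R| <= `|d%:~R| * (B1 * c%:R) :> R.
    by rewrite normrM ler_wpM2l.
  rewrite /B2; lra.
by split; apply: absz_le_truncn; [apply: le_trans hk _|apply: le_trans hm _];
  rewrite ?lerDl ?lerDr.
Qed.

Lemma ler_sum_subwindow (F G : int -> R) (L L' : nat) : (L <= L')%N ->
  (forall k, 0 <= G k) -> (forall k, F k <= G k) ->
  \sum_(k <- zw L) F k <= \sum_(k <- zw L') G k.
Proof.
move=> LL G0 FG; apply: le_trans (ler_sum _ (fun k _ => FG k)) _.
rewrite [X in _ <= X](bigID (fun k : int => (`|k| <= L)%N)) /=.
rewrite -[X in X <= _]addr0; apply: lerD; last exact: sumr_ge0.
rewrite -[X in _ <= X]big_filter le_eqVlt; apply/orP; left; apply/eqP.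
apply: perm_big; apply: uniq_perm; rewrite ?filter_uniq ?zw_uniq//.
by move=> k; rewrite mem_filter !mem_zw; lia.
Qed.

Lemma sum_unique (I : eqType) (r : seq I) (F : I -> R) (S : R) : uniq r -> 0 <= S ->
  (forall i, F i <= S) ->
  (forall i j, F i != 0 -> F j != 0 -> i = j) ->
  \sum_(i <- r) F i <= S.
Proof.
move=> ur S0 FS hu.
have [/hasP[i ir Fi]|/hasPn h] := boolP (has (fun i => F i != 0) r).
  rewrite (bigD1_seq i)//= big1 ?addr0// => j ji.
  by apply/eqP; apply: contraNT ji => Fj; rewrite (hu j i).
rewrite big_seq big1// => i ir; apply/eqP; have := h i ir.
by rewrite negbK.
Qed.

(** Each counted k has a companion m whose term equals 1, and all other terms are nonnegative. *)
Lemma box_upper be (c : nat) d b0 b1 j0 j1 e L (P : int -> bool) : (0 < c)%N ->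
  b0 <= b1 -> j0 <= j1 -> 0 < e ->
  (forall k, P k -> plateau j0 j1 e 0 (k%:~R / c%:R) = 1 /\
    exists m : int, plateau b0 b1 e 0 (d%:~R * be - (d * k - c%:Z * m)%:~R) = 1) ->
  \sum_(k <- zw L) (P k)%:R <= zsum2 (box_term be c d b0 b1 j0 j1 e).
Proof.
move=> c0 hb hj e0 hP.
have [L0 hL0] := box_finite be d c0 hb hj e0.
have g0 k m := box_term_ge0 be c d k m hb hj e0.
rewrite (@zsum2E _ (maxn L0 L) L0); last first.
  by move=> k m /hL0[h1 h2]; split => //; rewrite (leq_trans h1)// leq_maxl.
apply: ler_sum_subwindow; first exact: leq_maxr.
  by move=> k; apply: sumr_ge0.
move=> k; case hk: (P k); last by apply: sumr_ge0.
have [h1 [m h2]] := hP k hk.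
have hm : box_term be c d b0 b1 j0 j1 e k m = 1 by rewrite /box_term h1 h2 mulr1.
have [_ mL] : (`|k| <= L0)%N /\ (`|m| <= L0)%N by apply: hL0; rewrite hm oner_neq0.
by rewrite (bigD1_seq m) ?zw_uniq ?mem_zw//= hm lerDl sumr_ge0.
Qed.

(** For fixed k the arguments of the first cut-off are spaced by c and its support is no longer than
    c, so at most one m contributes, and it contributes at most 1. *)
Lemma box_lower be (c : nat) d b0 b1 j0 j1 e L (P : int -> bool) : (0 < c)%N ->
  b0 <= b1 -> j0 <= j1 -> 0 < e -> b1 + e - b0 <= c%:R ->
  (forall k m, plateau j0 j1 e 0 (k%:~R / c%:R) != 0 ->
     plateau b0 b1 e 0 (d%:~R * be - (d * k - c%:Z * m)%:~R) != 0 ->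
     P k /\ (`|k| <= L)%N) ->
  zsum2 (box_term be c d b0 b1 j0 j1 e) <= \sum_(k <- zw L) (P k)%:R.
Proof.
move=> c0 hb hj e0 hc hP.
have cp : 0 < c%:R :> R by rewrite ltr0n.
have [L0 hL0] := box_finite be d c0 hb hj e0.
have hN k m : box_term be c d b0 b1 j0 j1 e k m != 0 -> P k /\ (`|k| <= L)%N.
  by rewrite mulf_eq0 negb_or => /andP[h1 h2]; apply: hP h2 h1.
rewrite (@zsum2E _ L L0); last first.
  by move=> k m h; split; [have [] := hN _ _ h|have [] := hL0 _ _ h].
apply: ler_sum => k _; apply: sum_unique; rewrite ?zw_uniq//.
  move=> m; have [h|h] := eqVneq (box_term be c d b0 b1 j0 j1 e k m) 0.
    by rewrite h.
  have [-> _] := hN _ _ h.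
  by rewrite /box_term mulr_ile1 ?plateau_ge0 ?plateau_le1.
have hw i : box_term be c d b0 b1 j0 j1 e k i != 0 ->
    b0 < d%:~R * be - (d * k - c%:Z * i)%:~R < b1 + e.
  by rewrite mulf_eq0 negb_or => /andP[h _]; exact: plateau_neq0 h.
move=> m m' /hw h1 /hw h2.
move: h1 h2; rewrite !intrB !intrM -!pmulrn => /andP[h1 h2] /andP[h3 h4].
have h5 : (m - m')%:~R < (1 : int)%:~R :> R.
  by rewrite mulr1z -(ltr_pM2l cp) mulr1 intrB mulrBr; lra.
have h6 : (m' - m)%:~R < (1 : int)%:~R :> R.
  by rewrite mulr1z -(ltr_pM2l cp) mulr1 intrB mulrBr; lra.
by move: h5 h6; rewrite !ltr_int; clear; lia.
Qed.

End boxes.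

(** * Counting in diamonds *)

Section diamonds.
Context {R : realType}.

(** The condition that d (k - be) lies in lam A + c Z. Scale and frequency are free because it is
    used with (1/g, al) modulo c and 2 c, and with (2/g, 2 al) modulo 2 c. *)
Definition hit (A : set R) (lam be : R) (c : nat) (d k : int) : bool :=
  `[< exists2 x, A x & exists m : int,
      (d * k)%:~R - d%:~R * be = lam * x + c%:R * m%:~R >].

Definition in_diamond (c : nat) (om rho k0 : R) (d k : int) : bool :=
  `|k%:~R / c%:R - k0| + om * `|d%:~R / c%:R| <= rho.

Definition diamond_count (A : set R) (lam be : R) (c : nat) (om rho k0 : R)
    (L : nat) : R :=
  \sum_(d <- zw c.*2 | coprimez c%:Z d) \sum_(k <- zw L)
    (in_diamond c om rho k0 d k && hit A lam be c d k)%:R.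

Lemma sum_ord_nat n : \sum_(r < n) r%:R = n%:R * (n%:R - 1) / 2 :> R.
Proof.
elim: n => [|n IH]; first by rewrite big_ord0 !mul0r.
by rewrite big_ord_recr /= IH -natr1; field.
Qed.

Lemma sum_ord_bool n (F : nat -> R) :
  \sum_(i : 'I_n * bool) F i.1 = 2 * \sum_(r < n) F r.
Proof.
rewrite -(pair_bigA _ (fun (r : 'I_n) (_ : bool) => F r)) /= mulr_sumr.
by apply: eq_bigr => r _; rewrite big_bool /=; ring.
Qed.

Lemma cell_cover (X x : R) (Q : nat) : (0 < Q)%N -> 0 < X -> 0 <= x -> x <= X ->
  exists r : 'I_Q, X * (r%:R / Q%:R) <= x <= X * (r%:R / Q%:R) + X / Q%:R.
Proof.
move=> Q0 X0 x0 xX; have QR : 0 < Q%:R :> R by rewrite ltr0n.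
pose y := x * Q%:R / X.
have y0 : 0 <= y by rewrite divr_ge0 ?mulr_ge0// ltW.
have yQ : y <= Q%:R by rewrite ler_pdivrMr// mulrC ler_pM2l.
have xy : x = y * (X / Q%:R).
  by rewrite /y; field; rewrite !gt_eqF.
(* At x = X the truncation is Q; the minimum puts this endpoint into the last cell. *)
have hr : (minn (Num.truncn y) Q.-1 < Q)%N by rewrite gtn_min; apply/orP; right; lia.
exists (Ordinal hr) => /=.
set r := minn _ _.
have r1 : r%:R <= y by rewrite (le_trans _ (_ : (Num.truncn y)%:R <= y)) ?truncn_le// ler_nat geq_minl.
have r2 : y <= r%:R + 1.
  rewrite natr1 /r /minn; case: ifP => h; first by rewrite ltW// truncnS_gt.
  by rewrite prednK.
have XQ : 0 < X / Q%:R by rewrite divr_gt0.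
rewrite mulrCA xy ler_pM2r// r1 /= -[X in _ <= _ + X]mul1r -mulrDl ler_pM2r//.
Qed.

(** The coefficient of e is at most (1 + L) (1 + Y) (1 + Z), and the three factors are bounded by 2,
    1 + M1 and M2. *)
Lemma box_volume_upper (L Y Z e M1 M2 : R) : 0 <= L -> L <= 1 -> 0 <= Y -> Y <= M1 ->
  0 <= Z -> 1 + Z <= M2 -> 0 < e -> e <= 1 ->
  (L + e) * (Y + e) * (Z + e) <= L * Y * Z + e * (2 * (1 + M1) * M2).
Proof.
move=> L0 L1 Y0 YM Z0 ZM e0 e1.
have -> : (L + e) * (Y + e) * (Z + e) =
  L * Y * Z + e * (Y * Z + L * Z + L * Y + e * (L + Y + Z + e)) by ring.
rewrite lerD2l ler_pM2l//.
apply: (@le_trans _ _ ((1 + L) * (1 + Y) * (1 + Z))).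
  have : e * (L + Y + Z + e) <= 1 * (L + Y + Z + 1).
    by rewrite ler_pM//; lra.
  by have := mulr_ge0 (mulr_ge0 L0 Y0) Z0; lra.
rewrite ler_pM//; [|lra|]; first by rewrite mulr_ge0//; lra.
by rewrite ler_pM//; lra.
Qed.

Lemma box_volume_lower (L Y Z e M1 M2 : R) : 0 <= L -> L <= 1 -> 0 <= Y -> Y <= M1 ->
  0 <= Z -> 1 + Z <= M2 -> 0 < e -> e <= 1 ->
  L * Y * Z - e * (2 * (1 + M1) * M2) <= (L - e) * (Y - e) * (Z - e).
Proof.
move=> L0 L1 Y0 YM Z0 ZM e0 e1.
have -> : (L - e) * (Y - e) * (Z - e) =
  L * Y * Z - e * (Y * Z + L * Z + L * Y - e * (L + Y + Z - e)) by ring.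
rewrite lerD2l lerN2 ler_pM2l//.
apply: (@le_trans _ _ ((1 + L) * (1 + Y) * (1 + Z))).
  have : 0 <= e * (L + Y + Z) by rewrite mulr_ge0//; lra.
  have : e * e <= 1 * 1 by rewrite ler_pM//; lra.
  by have := mulr_ge0 (mulr_ge0 L0 Y0) Z0; lra.
rewrite ler_pM//; [|lra|]; first by rewrite mulr_ge0//; lra.
by rewrite ler_pM//; lra.
Qed.

(** The left end of a cell. The boolean is a sign: the two cells of index r make up the shell X r /
    Q <= |x| <= X (r+1) / Q, over which the width of the diamond varies little. *)
Definition cell_lo (X : R) (Q : nat) (i : 'I_Q * bool) : R :=
  if i.2 then X * (i.1%:R / Q%:R) else - (X * (i.1%:R / Q%:R) + X / Q%:R).

Lemma cell_bounds (X : R) (Q : nat) (i : 'I_Q * bool) : (0 < Q)%N -> 0 < X -> X <= 1 ->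
  -1 <= cell_lo X i /\ cell_lo X i + X / Q%:R <= 1.
Proof.
move=> Q0 X0 X1; have QR : 0 < Q%:R :> R by rewrite ltr0n.
have XQ : 0 < X / Q%:R by rewrite divr_gt0.
have h : X * (i.1%:R / Q%:R) + X / Q%:R <= 1.
  rewrite mulrCA -[X in _ + X]mul1r -mulrDl natr1 mulrA ler_pdivrMr// mul1r mulrC.
  by rewrite (le_trans (_ : _ <= X * Q%:R)) ?ler_pM2l ?ler_nat// ler_piMl// ltW.
have h0 : 0 <= X * (i.1%:R / Q%:R) by rewrite mulr_ge0 ?divr_ge0// ltW.
by rewrite /cell_lo; case: i.2; split; lra.
Qed.

Lemma cell_disjoint (X x : R) (Q : nat) (i j : 'I_Q * bool) : (0 < Q)%N -> 0 < X ->
  cell_lo X i < x < cell_lo X i + X / Q%:R ->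
  cell_lo X j < x < cell_lo X j + X / Q%:R -> i = j.
Proof.
move=> Q0 X0; have QR : 0 < Q%:R :> R by rewrite ltr0n.
pose w := X / Q%:R; have w0 : 0 < w by rewrite divr_gt0.
pose n (i : 'I_Q * bool) : int := if i.2 then i.1%:Z else - (i.1%:Z + 1).
have lo i' : cell_lo X i' = (n i')%:~R * w.
  rewrite /cell_lo /n; case: i'.2; first by rewrite mulrCA -pmulrn.
  by rewrite intrN intrD -pmulrn mulrCA /w; ring.
rewrite !lo -/w => /andP[h1 h2] /andP[h3 h4].
have nij : n i = n j.
  have g1 : (n i)%:~R < (n j + 1)%:~R :> R.
    by rewrite -(ltr_pM2r w0) intrD mulrDl mul1r; lra.
  have g2 : (n j)%:~R < (n i + 1)%:~R :> R.
    by rewrite -(ltr_pM2r w0) intrD mulrDl mul1r; lra.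
  by move: g1 g2; rewrite !ltr_int; lia.
case: i j nij {h1 h2 h3 h4} => [i si] [j sj]; rewrite /n /=.
by case: si; case: sj => h; [congr (_, _); apply/val_inj|exfalso|exfalso|
  congr (_, _); apply/val_inj]; rewrite /=; lia.
Qed.

Lemma cell_norm (X x : R) (Q : nat) (i : 'I_Q * bool) : (0 < Q)%N -> 0 < X ->
  cell_lo X i <= x <= cell_lo X i + X / Q%:R ->
  X * (i.1%:R / Q%:R) <= `|x| <= X * (i.1%:R / Q%:R) + X / Q%:R.
Proof.
move=> Q0 X0; have QR : 0 < Q%:R :> R by rewrite ltr0n.
have h0 : 0 <= X * (i.1%:R / Q%:R) by rewrite mulr_ge0 ?divr_ge0// ltW.
rewrite /cell_lo; case: i.2 => /andP[h1 h2].
  by rewrite ger0_norm; [apply/andP; split|]; lra.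
by rewrite ler0_norm; [apply/andP; split|]; lra.
Qed.

Lemma cell_cover_signed (X x : R) (Q : nat) : (0 < Q)%N -> 0 < X -> `|x| <= X ->
  exists i : 'I_Q * bool, cell_lo X i <= x <= cell_lo X i + X / Q%:R.
Proof.
move=> Q0 X0 hx; have [x0|x0] := leP 0 x.
  rewrite ger0_norm// in hx.
  by have [r hr] := cell_cover Q0 X0 x0 hx; exists (r, true).
rewrite ltr0_norm// in hx.
have [|r /andP[h1 h2]] := cell_cover Q0 X0 _ hx; first by lra.
by exists (r, false); rewrite /cell_lo /=; apply/andP; split; lra.
Qed.

End diamonds.

(** * Outer and inner coverings of the diamond by boxes *)

Section diamond_estimates.
Context {R : realType}.

Definition box_sum (be : R) (c : nat) (e i0 i1 b0 b1 j0 j1 : R) : R :=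
  \sum_(d <- zw c.*2 | coprimez c%:Z d) plateau i0 i1 e 0 (d%:~R / c%:R) *
    zsum2 (box_term be c d b0 b1 j0 j1 e).

(** The only form in which (E) enters the counting: smoothing scale, window and error are
    parameters, so the geometry below involves no Heisenberg group. *)
Definition box_estimate (be : R) (c : nat) (e W H Err : R) : Prop :=
  forall i0 i1 b0 b1 j0 j1 : R, -2 <= i0 -> i0 <= i1 -> i1 <= 1 ->
  - W <= b0 -> b0 <= b1 -> b1 <= W -> j0 <= j1 -> j1 <= j0 + H ->
  `| box_sum be c e i0 i1 b0 b1 j0 j1 -
     (totient c)%:R * ((i1 - i0) * (b1 - b0) * (j1 - j0)) | <= Err.

(** The half-width in k / c of the diamond above |d / c| = (rho / om) r / Q. *)
Definition cell_radius (rho : R) (Q r : nat) : R := rho * (1 - r%:R / Q%:R).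

(** Over a shell the diamond is at most as wide as at the inner end r. A plateau reaches 1 only at
    distance e from its left end, hence the left ends lowered by e. The first cut-off sees -lam x
    for x in A, so the endpoints a and b come reversed. *)
Lemma diamond_le_boxes (A : set R) (a b lam be : R) (c Q L : nat) (om rho k0 e : R) :
  (0 < c)%N -> (0 < Q)%N -> (forall x, A x -> a <= x <= b) -> a <= b ->
  0 < lam -> 0 < om -> 0 < rho -> 0 < e ->
  diamond_count A lam be c om rho k0 L <=
  \sum_(i : 'I_Q * bool)
    box_sum be c e (cell_lo (rho / om) i - e) (cell_lo (rho / om) i + rho / om / Q%:R)
      (- (lam * b) - e) (- (lam * a))
      (k0 - cell_radius rho Q i.1 - e) (k0 + cell_radius rho Q i.1).
Proof.
move=> c0 Q0 hA ab lam0 om0 rho0 e0.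
set X := rho / om; have X0 : 0 < X by rewrite divr_gt0.
have QR : 0 < Q%:R :> R by rewrite ltr0n.
have XQ : 0 < X / Q%:R by rewrite divr_gt0.
have rad0 (i : 'I_Q * bool) : 0 <= cell_radius rho Q i.1.
  rewrite mulr_ge0 ?(ltW rho0)// subr_ge0 ler_pdivrMr// mul1r ler_nat.
  by case: i => i _ /=; rewrite ltnW.
have lab : lam * a <= lam * b by rewrite ler_pM2l.
rewrite /box_sum exchange_big; apply: ler_sum => d hd.
have nn (i : 'I_Q * bool) : 0 <=
    plateau (cell_lo X i - e) (cell_lo X i + X / Q%:R) e 0 (d%:~R / c%:R) *
    zsum2 (box_term be c d (- (lam * b) - e) (- (lam * a))
      (k0 - cell_radius rho Q i.1 - e) (k0 + cell_radius rho Q i.1) e).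
  rewrite mulr_ge0 ?plateau_ge0//; first by lra.
  have r0 := rad0 i.
  apply: fsumr_ge0 => -[k m] _; apply: box_term_ge0 => //; lra.
have [hx|hx] := leP `|d%:~R / c%:R| X; last first.
  rewrite big1 ?sumr_ge0// => k _; rewrite /in_diamond leNgt.
  suff -> : rho < `|k%:~R / c%:R - k0| + om * `|d%:~R / c%:R| by [].
  have : rho < om * `|d%:~R / c%:R| by rewrite -ltr_pdivrMl// mulrC.
  have := normr_ge0 (k%:~R / c%:R - k0); lra.
have [i hi] := cell_cover_signed Q0 X0 hx.
have /andP[ni _] := cell_norm Q0 X0 hi.
have r0 := rad0 i.
apply: le_trans (_ : zsum2 (box_term be c d (- (lam * b) - e) (- (lam * a))
      (k0 - cell_radius rho Q i.1 - e) (k0 + cell_radius rho Q i.1) e) <= _).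
  apply: (@box_upper _ be c d _ _ _ _ e L
    (fun k => in_diamond c om rho k0 d k && hit A lam be c d k)) => //.
  - lra.
  - lra.
  move=> k /andP[hdm /asboolP[x /hA /andP[xa xb] [m hm]]]; split.
    have : om * (X * (i.1%:R / Q%:R)) <= om * `|d%:~R / c%:R| by rewrite ler_pM2l.
    rewrite mulrA (_ : om * X = rho); last by rewrite /X; field; rewrite gt_eqF.
    move: hdm; rewrite /in_diamond => hdm hr.
    have : `|k%:~R / c%:R - k0| <= cell_radius rho Q i.1 by rewrite /cell_radius mulrBr mulr1; lra.
    rewrite ler_norml => /andP[g1 g2].
    by apply: plateau_in; move: r0 e0 g1 g2; clear; lra.
  exists m; have la : lam * a <= lam * x by rewrite ler_pM2l.
  have lb : lam * x <= lam * b by rewrite ler_pM2l.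
  have -> : d%:~R * be - (d * k - c%:Z * m)%:~R = - (lam * x).
    by move: hm; rewrite intrB intrM [in (_ * m)%:~R]intrM -pmulrn; lra.
  by apply: plateau_in; move: lab la lb xa xb e0; clear; lra.
by rewrite (bigD1 i)//= plateau_in ?mul1r ?lerDl ?sumr_ge0//; move/andP: hi => [];
  move: XQ e0; clear; lra.
Qed.

(** Now the width is taken at the outer end r + 1, and the right ends are lowered by e because a
    plateau extends by e beyond them. The cells are disjoint, so each d is seen by at most one box.
    The outermost shell has radius 0 and is left out. *)
Lemma boxes_le_diamond (A : set R) (a b lam be : R) (c Q L : nat) (om rho k0 e : R) :
  (0 < c)%N -> (0 < Q)%N -> (forall x, a < x < b -> A x) ->
  0 < lam -> 0 < om -> 0 < rho -> 0 < e ->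
  e <= rho / om / Q%:R -> e <= 2 * rho / Q%:R -> e <= lam * (b - a) ->
  lam * (b - a) <= c%:R -> (`|k0| + rho) * c%:R <= L%:R ->
  \sum_(i : 'I_Q * bool | (i.1.+1 < Q)%N)
    box_sum be c e (cell_lo (rho / om) i) (cell_lo (rho / om) i + rho / om / Q%:R - e)
      (- (lam * b)) (- (lam * a) - e)
      (k0 - cell_radius rho Q i.1.+1) (k0 + cell_radius rho Q i.1.+1 - e) <=
  diamond_count A lam be c om rho k0 L.
Proof.
move=> c0 Q0 hA lam0 om0 rho0 e0 eX eR eA hc hL.
set X := rho / om in eX *; have X0 : 0 < X by rewrite divr_gt0.
have QR : 0 < Q%:R :> R by rewrite ltr0n.
have cR : 0 < c%:R :> R by rewrite ltr0n.
have XQ : 0 < X / Q%:R by rewrite divr_gt0.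
(* Apart from the outermost shell the radius is at least rho / Q, which leaves room for an inner
   box. *)
have rad0 (i : 'I_Q * bool) : (i.1.+1 < Q)%N -> e <= 2 * cell_radius rho Q i.1.+1.
  move=> iQ; have h : Q%:R^-1 <= 1 - i.1.+1%:R / Q%:R :> R.
    rewrite -(ler_pM2r QR) mulVf ?gt_eqF// mulrBl mul1r divfK ?gt_eqF//.
    by rewrite lerBrDr addrC natr1 ler_nat.
  by have := ler_wpM2l (ltW rho0) h; rewrite -/(cell_radius rho Q i.1.+1); lra.
rewrite /box_sum exchange_big; apply: ler_sum => d hd.
have cellneq (i : 'I_Q * bool) :
    plateau (cell_lo X i) (cell_lo X i + X / Q%:R - e) e 0 (d%:~R / c%:R) != 0 ->
    cell_lo X i < d%:~R / c%:R < cell_lo X i + X / Q%:R.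
  by move=> /plateau_neq0; rewrite subrK; apply => //; lra.
rewrite big_mkcond; apply: sum_unique.
- exact: index_enum_uniq.
- by apply: sumr_ge0 => k _.
- move=> i; case: ifP => iQ; last by apply: sumr_ge0 => k _.
  have [->|pn] := eqVneq (plateau (cell_lo X i) (cell_lo X i + X / Q%:R - e) e 0
    (d%:~R / c%:R)) 0; first by rewrite mul0r sumr_ge0.
  have r0 := rad0 i iQ.
  have z0 : 0 <= zsum2 (box_term be c d (- (lam * b)) (- (lam * a) - e)
      (k0 - cell_radius rho Q i.1.+1) (k0 + cell_radius rho Q i.1.+1 - e) e).
    apply: fsumr_ge0 => -[k m] _; apply: box_term_ge0 => //.
    - by move: eA; clear; lra.
    - by move: r0; clear; lra.
  apply: le_trans (ler_wpM2r z0 (plateau_le1 _ _ _ _)) _.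
  rewrite mul1r; apply: box_lower => //.
  - by move: eA; clear; lra.
  - by move: r0; clear; lra.
  - by move: hc; clear; lra.
  move=> k m /plateau_neq0 hk /plateau_neq0 hm.
  have {}hk : k0 - cell_radius rho Q i.1.+1 < k%:~R / c%:R < k0 + cell_radius rho Q i.1.+1 - e + e.
    by apply: hk => //; lra.
  have {}hm : - (lam * b) < d%:~R * be - (d * k - c%:Z * m)%:~R < - (lam * a) - e + e.
    by apply: hm => //; lra.
  have hk' : `|k%:~R / c%:R - k0| <= cell_radius rho Q i.1.+1.
    by rewrite ler_norml; move/andP: hk; clear => -[? ?]; apply/andP; split; lra.
  have /andP[h1 h2] := cellneq i pn.
  have hcell : cell_lo X i <= d%:~R / c%:R <= cell_lo X i + X / Q%:R.
    by rewrite (ltW h1) (ltW h2).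
  have /andP[_ n2] := cell_norm Q0 X0 hcell.
  have i0 : cell_radius rho Q i.1.+1 <= rho.
    by rewrite /cell_radius ler_piMr ?(ltW rho0)// gerBl divr_ge0.
  split.
    apply/andP; split.
      rewrite /in_diamond.
      have hom : om * `|d%:~R / c%:R| <= rho * (i.1.+1%:R / Q%:R).
        rewrite (_ : rho = om * X); last by rewrite /X; field; rewrite gt_eqF.
        rewrite -mulrA ler_pM2l// (le_trans n2)// -natr1 mulrDl mulrDr.
        by rewrite mul1r.
      by move: hk' hom; rewrite /cell_radius mulrBr mulr1; clear; lra.
    apply/asboolP.
    exists (lam^-1 * ((d * k - c%:Z * m)%:~R - d%:~R * be)).
      apply: hA; apply/andP; split; [rewrite ltr_pdivlMl//|rewrite ltr_pdivrMl//];
        by move/andP: hm; clear => -[? ?]; lra.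
    exists m; rewrite mulrA mulfV ?gt_eqF// mul1r intrB [in (_ * m)%:~R]intrM -pmulrn.
    by ring.
  have : `|k%:~R| <= (`|k0| + rho) * c%:R :> R.
    rewrite -ler_pdivrMr// -[c%:R]ger0_norm ?(ltW cR)// -normfV -normrM.
    have -> : k%:~R / c%:R = k0 + (k%:~R / c%:R - k0) :> R by ring.
    by rewrite (le_trans (ler_normD _ _))// lerD2l (le_trans hk').
  by move=> /le_trans /(_ hL); rewrite -intr_norm -natr_absz ler_nat.
- move=> i j; case: ifP => iQ; last by rewrite eqxx.
  case: ifP => jQ; last by rewrite eqxx.
  rewrite mulf_eq0 negb_or => /andP[/cellneq h1 _].
  rewrite mulf_eq0 negb_or => /andP[/cellneq h2 _].
  exact: cell_disjoint h1 h2.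
Qed.

End diamond_estimates.

Section diamond_asymptotics.
Context {R : realType}.

Lemma radius_ge0 (rho : R) (Q r : nat) : (0 < Q)%N -> 0 <= rho -> (r <= Q)%N ->
  0 <= cell_radius rho Q r.
Proof.
move=> Q0 rho0 rQ; rewrite mulr_ge0// subr_ge0 ler_pdivrMr ?ltr0n//.
by rewrite mul1r ler_nat.
Qed.

Lemma radius_le (rho : R) (Q r : nat) : 0 <= rho -> cell_radius rho Q r <= rho.
Proof. by move=> r0; rewrite /cell_radius ler_piMr// gerBl divr_ge0. Qed.

(** The outer Riemann sum for the half-width of the diamond. With [sum_radiusS] it brackets the
    exact value rho Q / 2, each being off by rho / 2: this is the relative error 1 / Q of the
    covering. *)
Lemma sum_radius (rho : R) (Q : nat) : (0 < Q)%N ->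
  \sum_(r < Q) cell_radius rho Q r = rho * (Q%:R + 1) / 2.
Proof.
move=> Q0; have QR : Q%:R != 0 :> R by rewrite pnatr_eq0 -lt0n.
rewrite /cell_radius -mulr_sumr sumrB -mulr_suml sum_ord_nat sumr_const card_ord.
by field.
Qed.

Lemma sum_radiusS (rho : R) (Q : nat) : (0 < Q)%N ->
  \sum_(r < Q) cell_radius rho Q r.+1 = rho * (Q%:R - 1) / 2.
Proof.
move=> Q0; have QR : Q%:R != 0 :> R by rewrite pnatr_eq0 -lt0n.
rewrite (eq_bigr (fun r : 'I_Q => cell_radius rho Q r - rho / Q%:R)); last first.
  by move=> r _; rewrite /cell_radius -natr1; ring.
by rewrite sumrB sum_radius// sumr_const card_ord -mulr_natr; field.
Qed.

Lemma sum_ord_const n (x : R) : \sum_(r < n) x = n%:R * x.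
Proof. by rewrite sumr_const card_ord mulr_natl. Qed.

Lemma box_sum_upper (be : R) c (e W H Err i0 w b0 Y j0 z M1 M2 : R) :
  box_estimate be c e W H Err -> 0 < e -> e <= 1 -> -1 <= i0 -> 0 <= w -> w <= 1 ->
  i0 + w <= 1 -> - W <= b0 - e -> b0 + Y <= W -> 0 <= Y -> Y <= M1 ->
  0 <= z -> 2 * z + 1 <= H -> 2 * z + 1 <= M2 ->
  box_sum be c e (i0 - e) (i0 + w) (b0 - e) (b0 + Y) (j0 - z - e) (j0 + z) <=
  (totient c)%:R * (w * Y * (2 * z) + e * (2 * (1 + M1) * M2)) + Err.
Proof.
move=> hbox e0 e1 hi w0 w1 hiw hb hbY Y0 YM z0 zH zM.
have hv : (w + e) * (Y + e) * (2 * z + e) <=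
    w * Y * (2 * z) + e * (2 * (1 + M1) * M2).
  by apply: box_volume_upper => //; lra.
have {}hv := ler_wpM2l (ler0n R (totient c)) hv.
apply: le_trans (_ : _ <= _ + Err) (lerD hv (lexx Err)).
have := hbox (i0 - e) (i0 + w) (b0 - e) (b0 + Y) (j0 - z - e) (j0 + z).
move=> /(_ ltac:(move: e1 hi; clear; lra) ltac:(move: e0 w0; clear; lra) hiw hb
  ltac:(move: e0 Y0; clear; lra) hbY ltac:(move: e0 z0; clear; lra)
  ltac:(move: zH e1; clear; lra)).
have -> : i0 + w - (i0 - e) = w + e by ring.
have -> : b0 + Y - (b0 - e) = Y + e by ring.
have -> : j0 + z - (j0 - z - e) = 2 * z + e by ring.
rewrite ler_norml => /andP[_] h; rewrite -lerBlDl; exact: h.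
Qed.

Lemma box_sum_lower (be : R) c (e W H Err i0 w b0 Y j0 z M1 M2 : R) :
  box_estimate be c e W H Err -> 0 < e -> e <= 1 -> -1 <= i0 -> e <= w -> w <= 1 ->
  i0 + w <= 1 -> - W <= b0 -> b0 + Y <= W -> e <= Y -> Y <= M1 ->
  e <= 2 * z -> 2 * z + 1 <= H -> 2 * z + 1 <= M2 ->
  (totient c)%:R * (w * Y * (2 * z) - e * (2 * (1 + M1) * M2)) - Err <=
  box_sum be c e i0 (i0 + w - e) b0 (b0 + Y - e) (j0 - z) (j0 + z - e).
Proof.
move=> hbox e0 e1 hi w0 w1 hiw hb hbY Y0 YM z0 zH zM.
have hv : w * Y * (2 * z) - e * (2 * (1 + M1) * M2) <=
    (w - e) * (Y - e) * (2 * z - e).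
  by apply: box_volume_lower => //; lra.
have {}hv := ler_wpM2l (ler0n R (totient c)) hv.
apply: le_trans (lerD hv (lexx (- Err))) _.
have := hbox i0 (i0 + w - e) b0 (b0 + Y - e) (j0 - z) (j0 + z - e).
move=> /(_ ltac:(move: hi; clear; lra) ltac:(move: w0; clear; lra)
  ltac:(move: e0 hiw; clear; lra) hb ltac:(move: Y0; clear; lra)
  ltac:(move: e0 hbY; clear; lra) ltac:(move: z0; clear; lra)
  ltac:(move: zH e0; clear; lra)).
have -> : i0 + w - e - i0 = w - e by ring.
have -> : b0 + Y - e - b0 = Y - e by ring.
have -> : j0 + z - e - (j0 - z) = 2 * z - e by ring.
rewrite ler_norml => /andP[h _]; rewrite -lerBrDl; move: h; clear; lra.
Qed.

(** 2 rho (rho / om) is the area of the diamond in (d / c, k / c). The three errors come from the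
    Riemann sums of the radii, from changing the sides of 2 Q boxes by e, and from one use of (E)
    per box. The conditions on lam, g, rho and om keep the volume below 4 (b - a), uniformly in
    g. *)
Lemma diamond_estimate (A : set R) (a b lam be : R) (c Q L : nat)
    (om rho k0 e W g Err : R) :
  (0 < c)%N -> (0 < Q)%N -> (forall x, A x -> a <= x <= b) ->
  (forall x, a < x < b -> A x) -> a <= b ->
  0 < lam -> 1 <= g -> lam * g <= 2 -> 0 < om -> 0 < rho -> rho <= g ->
  rho / om <= 1 -> 0 < e -> e <= 1 -> e <= rho / om / Q%:R ->
  e <= 2 * rho / Q%:R -> lam * (b - a) <= c%:R ->
  (`|k0| + rho) * c%:R <= L%:R -> 2 * (`|a| + `|b|) + 1 <= W -> 0 <= Err ->
  box_estimate be c e W (3 * g) Err ->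
  `| diamond_count A lam be c om rho k0 L -
     (totient c)%:R * (lam * (b - a) * (2 * rho * (rho / om))) | <=
  (totient c)%:R * (4 * (b - a) / Q%:R + Q%:R * e * g * (12 * (1 + 2 * (b - a))))
    + 2 * Q%:R * Err.
Proof.
move=> c0 Q0 hA hA' ab lam0 g1 lamg om0 rho0 rhog X1 e0 e1 eX eR hc hL hW Err0 hbox.
set X := rho / om in X1 eX *; have X0 : 0 < X by rewrite divr_gt0.
have QR : 0 < Q%:R :> R by rewrite ltr0n.
have Q1 : 1 <= Q%:R :> R by rewrite ler1n.
have XQ : 0 < X / Q%:R by rewrite divr_gt0.
have XQ1 : X / Q%:R <= 1 by rewrite ler_pdivrMr// mul1r; lra.
have phi0 : 0 < (totient c)%:R :> R by rewrite ltr0n totient_gt0.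
set phi := (totient c)%:R in phi0 *.
pose Y := lam * (b - a).
have lam2 : lam <= 2 by rewrite (le_trans _ lamg)// ler_peMr// ltW.
have Y0 : 0 <= Y by rewrite mulr_ge0 ?subr_ge0// ltW.
have YM : Y <= 2 * (b - a) by rewrite ler_wpM2r ?subr_ge0.
have lb : `|lam * b| <= 2 * `|b| by rewrite normrM ler_wpM2r// ger0_norm// ltW.
have la : `|lam * a| <= 2 * `|a| by rewrite normrM ler_wpM2r// ger0_norm// ltW.
have lab : lam * a <= lam * b by rewrite ler_pM2l.
have a0 := normr_ge0 a; have b0 := normr_ge0 b.
have [lb1 lb2] : - (2 * `|b|) <= lam * b /\ lam * b <= 2 * `|b|.
  by move: lb; rewrite ler_norml => /andP[].
have [la1 la2] : - (2 * `|a|) <= lam * a /\ lam * a <= 2 * `|a|.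
  by move: la; rewrite ler_norml => /andP[].
have YrX : Y * rho * X <= 2 * (b - a).
  have h : Y * rho <= 2 * (b - a).
    have lr : lam * rho <= 2 by apply: le_trans lamg; rewrite ler_pM2l.
    by rewrite /Y mulrAC ler_wpM2r ?subr_ge0.
  by apply: le_trans h; rewrite ler_piMr// mulr_ge0// ltW.
(* The smoothing loss of one box: its side in the first cut-off is at most 2 (b - a), and 2 z + 1 <=
   3 g for a radius z <= g, as g >= 1. *)
pose D := e * (2 * (1 + 2 * (b - a)) * (3 * g)).
have D0 : 0 <= D by rewrite /D !mulr_ge0 ?(ltW e0)//; move: ab g1; clear; lra.
have rad0 (i : 'I_Q * bool) : 0 <= cell_radius rho Q i.1.
  by apply: radius_ge0 => //; [exact: ltW|exact/ltnW/ltn_ord].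
have rad1 (i : 'I_Q * bool) : 0 <= cell_radius rho Q i.1.+1.
  by apply: radius_ge0 => //; exact: ltW.
have radl r : cell_radius rho Q r <= g by rewrite (le_trans (radius_le _ _ (ltW rho0))).
rewrite ler_norml; apply/andP; split; last first.
  rewrite lerBlDr (le_trans (diamond_le_boxes be L k0 c0 Q0 hA ab lam0 om0 rho0 e0))//.
  apply: le_trans (_ : \sum_(i : 'I_Q * bool)
     (phi * (X / Q%:R * Y * (2 * cell_radius rho Q i.1) + D) + Err) <= _).
    apply: ler_sum => i _.
    have [lo1 lo2] := cell_bounds i Q0 X0 X1.
    have r0 := rad0 i; have rg := radl i.1.
    rewrite [X in box_sum _ _ _ _ _ _ X _ _](_ : _ = - (lam * b) + Y); last first.
      by rewrite /Y; ring.
    rewrite /D; apply: (box_sum_upper _ hbox e0 e1 lo1 (ltW XQ) XQ1 lo2 _ _ Y0 YM r0).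
    - by clear -lb1 lb2 a0 b0 hW e1; lra.
    - by rewrite /Y; clear -la1 la2 a0 b0 hW e1; lra.
    - by clear -rg g1; lra.
    - by clear -rg g1; lra.
  rewrite (sum_ord_bool _ (fun r =>
    phi * (X / Q%:R * Y * (2 * cell_radius rho Q r) + D) + Err)).
  rewrite big_split /= -mulr_sumr big_split /= -mulr_sumr -mulr_sumr sum_radius//.
  rewrite !sum_ord_const.
  rewrite -/Y (_ : 2 * _ = phi * (Y * (2 * rho * X)) +
    (phi * (2 * (Y * rho * X) / Q%:R + 2 * Q%:R * D) + 2 * Q%:R * Err)); last first.
    by field; rewrite gt_eqF.
  rewrite addrC lerD2r lerD2r ler_pM2l// lerD//.
    by rewrite ler_pM2r ?invr_gt0//; move: YrX; clear; lra.
  by rewrite le_eqVlt /D; apply/orP; left; apply/eqP; ring.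
have Dia0 : 0 <= diamond_count A lam be c om rho k0 L.
  by apply: sumr_ge0 => d _; apply: sumr_ge0.
have QD : 2 * Q%:R * D = Q%:R * e * g * (12 * (1 + 2 * (b - a))) by rewrite /D; ring.
rewrite -QD -/Y lerBrDr.
have QErr : 0 <= 2 * Q%:R * Err by rewrite !mulr_ge0// ltW.
have ba : 0 <= 4 * (b - a) / Q%:R by rewrite divr_ge0 ?mulr_ge0 ?subr_ge0// ltW.
(* If the image of A is shorter than the smoothing scale there are no inner boxes; the main term is
   then below the error, and nonnegativity of the count suffices. *)
have [eY|eY] := ltP Y e.
  have h1 : Y * (2 * rho * X) <= 2 * Q%:R * D.
    apply: (@le_trans _ _ (e * (2 * g * 1))).
      have r0 := ltW rho0; have x0 := ltW X0.
      apply: ler_pM; [exact: Y0|by apply: mulr_ge0 => //; apply: mulr_ge0|exact: ltW|].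
      apply: ler_pM; [by apply: mulr_ge0|exact: x0|by rewrite ler_pM2l|exact: X1].
    have eg : 0 <= e * g by rewrite mulr_ge0 ?(ltW e0)//; move: g1; clear; lra.
    rewrite QD (_ : e * (2 * g * 1) = e * g * (1 * 2)); last by ring.
    rewrite (_ : Q%:R * e * g * _ = e * g * (Q%:R * (12 * (1 + 2 * (b - a))))); last by ring.
    by rewrite ler_wpM2l// ler_pM//; move: ab; clear; lra.
  have h2 := ler_wpM2l (ltW phi0) h1.
  have h3 := mulr_ge0 (ltW phi0) ba.
  move: h2 h3 Dia0 QErr; clear; lra.
apply: le_trans (boxes_le_diamond be c0 Q0 hA' lam0 om0 rho0 e0 eX eR eY hc hL).
apply: le_trans (_ : \sum_(i : 'I_Q * bool)
     (phi * (X / Q%:R * Y * (2 * cell_radius rho Q i.1.+1) - D) - Err) <= _); last first.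
  rewrite [X in _ <= X]big_mkcond; apply: ler_sum => i _.
  (* The omitted cells have radius 0, so their terms in the lower bound are nonpositive and may be
     added to complete the sum. *)
  case: ifP => iQ; last first.
    have -> : cell_radius rho Q i.1.+1 = 0.
      have -> : i.1.+1 = Q by apply/eqP; rewrite eqn_leq ltn_ord leqNgt iQ.
      by rewrite /cell_radius divff ?gt_eqF// subrr mulr0.
    by have := mulr_ge0 (ltW phi0) D0; move: Err0; clear; lra.
  have [lo1 lo2] := cell_bounds i Q0 X0 X1.
  have r0 := rad1 i; have rg := radl i.1.+1.
  have re : e <= 2 * cell_radius rho Q i.1.+1.
    have h : Q%:R^-1 <= 1 - i.1.+1%:R / Q%:R :> R.
      rewrite -(ler_pM2r QR) mulVf ?gt_eqF// mulrBl mul1r divfK ?gt_eqF//.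
      by rewrite lerBrDr addrC natr1 ler_nat.
    by have := ler_wpM2l (ltW rho0) h; rewrite -/(cell_radius rho Q i.1.+1);
      move: eR; clear; lra.
  rewrite [X in box_sum _ _ _ _ _ _ X _ _](_ : _ = - (lam * b) + Y - e); last first.
    by rewrite /Y; ring.
  rewrite /D; apply: (box_sum_lower _ hbox e0 e1 lo1 eX XQ1 lo2 _ _ eY YM re).
  - by clear -lb1 lb2 a0 b0 hW e1; lra.
  - by rewrite /Y; clear -la1 la2 a0 b0 hW e1; lra.
  - by clear -rg g1; lra.
  - by clear -rg g1; lra.
rewrite (sum_ord_bool _ (fun r =>
    phi * (X / Q%:R * Y * (2 * cell_radius rho Q r.+1) - D) - Err)).
rewrite sumrB -mulr_sumr sumrB -mulr_sumr -mulr_sumr sum_radiusS//.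
rewrite !sum_ord_const.
rewrite [X in _ <= X](_ : _ = phi * (Y * (2 * rho * X)) -
    (phi * (2 * (Y * rho * X) / Q%:R + 2 * Q%:R * D) + 2 * Q%:R * Err)); last first.
  by field; rewrite gt_eqF.
have h : 2 * (Y * rho * X) / Q%:R <= 4 * (b - a) / Q%:R.
  by rewrite ler_pM2r ?invr_gt0//; move: YrX; clear; lra.
have := ler_wpM2l (ltW phi0) h.
clear; lra.
Qed.

End diamond_asymptotics.

(** * The divisor bound *)

Section divisor_bound.
Local Open Scope nat_scope.

Lemma divisors_pfactor p n : prime p -> 0 < n ->
  exists n', [/\ n = n' * p ^ logn p n, 0 < n', coprime p n' &
    size (divisors n) <= (logn p n).+1 * size (divisors n')].
Proof.
move=> pp n0; have [n' cn' en] := pfactor_coprime pp n0.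
have n'0 : 0 < n' by move: n0; rewrite en muln_gt0 => /andP[].
exists n'; split => //.
rewrite -(size_iota 0 (logn p n).+1).
rewrite -(size_allpairs (fun i d => d * p ^ i)).
apply: uniq_leq_size; first exact: divisors_uniq.
move=> d; rewrite -dvdn_divisors// => dn.
have d0 : 0 < d by exact: dvdn_gt0 dn.
have [d' cd' ed] := pfactor_coprime pp d0.
apply/allpairsP; exists (logn p d, d'); split; [|rewrite -dvdn_divisors//|exact: ed].
  by rewrite mem_iota add0n ltnS dvdn_leq_log.
have d'n : d' %| n' * p ^ logn p n.
  by rewrite -en; apply: dvdn_trans dn; rewrite [in X in _ %| X]ed dvdn_mulr.
by move: d'n; rewrite Gauss_dvdl// coprimeXr// coprime_sym.
Qed.

(** From e + 1 <= (m + 1) (e %/ (m + 1) + 1) <= (m + 1) 2^(e %/ (m + 1)), raised to the power m + 1.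
    It bounds what a small prime contributes. *)
Lemma succ_exp_le m e : e.+1 ^ m.+1 <= m.+1 ^ m.+1 * 2 ^ e.
Proof.
have h : e.+1 <= m.+1 * 2 ^ (e %/ m.+1).
  apply: leq_trans (_ : m.+1 * (e %/ m.+1).+1 <= _).
    by rewrite mulnC ltn_ceil.
  by rewrite leq_mul2l /= ltn_expl.
apply: leq_trans (_ : (m.+1 * 2 ^ (e %/ m.+1)) ^ m.+1 <= _); first by rewrite leq_exp2r.
by rewrite expnMn leq_mul2l -expnM leq_exp2l// leq_divM orbT.
Qed.

(* at a prime p >= 2 ^ m the factor (e + 1) ^ m is at most p ^ e, so only the
   finitely many smaller primes contribute to the constant *)
Lemma divisor_bound m : exists K, forall n, 0 < n ->
  size (divisors n) ^ m.+1 <= K * n.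
Proof.
pose B := 2 ^ m.+1; pose C := m.+1 ^ m.+1.
(* Induction on k, the primes of n being below k or at least B: raising k by one admits at most one
   more small prime, paid for by one factor C. *)
suff h k : forall n, 0 < n ->
    (forall p, prime p -> p %| n -> p < k \/ B <= p) ->
    size (divisors n) ^ m.+1 <= C ^ k * n.
  exists (C ^ B) => n n0; apply: h => // p _ _.
  by case: (ltnP p B) => ?; [left|right].
elim: k => [|k IH].
  elim/ltn_ind => n IH n0 hp.
  have [n1|n1] := ltnP 1 n; first last.
    have -> : n = 1 by apply/eqP; rewrite eqn_leq n1 n0.
    by rewrite (_ : divisors 1 = [:: 1])// exp1n expn0.
  have pp := pdiv_prime n1; set p := pdiv n in pp.
  have pn : p %| n by exact: pdiv_dvd.
  have [n' [en n'0 cn' hs]] := divisors_pfactor pp n0.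
  have e0 : 0 < logn p n by rewrite logn_gt0 mem_primes pp n0.
  have pB : 2 ^ m.+1 <= p by have [] := hp p pp pn.
  have n'n : n' < n.
    rewrite [in X in _ < X]en ltn_Pmulr//.
    by rewrite -{1}(expn0 p) ltn_exp2l// prime_gt1.
  have h : size (divisors n') ^ m.+1 <= n'.
    rewrite -[X in _ <= X]mul1n -(expn0 C); apply: IH => // q pq qn'.
    by apply: hp => //; rewrite en dvdn_mulr.
  apply: leq_trans (_ : ((logn p n).+1 * size (divisors n')) ^ m.+1 <= _).
    by rewrite leq_exp2r.
  rewrite expn0 mul1n expnMn mulnC [X in _ <= X]en; apply: leq_mul.
    exact: h.
  apply: leq_trans (_ : (2 ^ m.+1) ^ logn p n <= _); last by rewrite leq_exp2r.
  by rewrite -expnM mulnC expnM leq_exp2r// ltn_expl.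
move=> n n0 hp.
have [pk|npk] := boolP (prime k); last first.
  apply: leq_trans (IH n n0 _) _; last first.
    by rewrite leq_mul2r expnS leq_pmull ?orbT// expn_gt0.
  move=> p pp pn; have [|] := hp p pp pn; last by right.
  rewrite ltnS leq_eqVlt => /orP[/eqP pk|]; last by left.
  by rewrite -pk pp in npk.
have [n' [en n'0 cn' hs]] := divisors_pfactor pk n0.
have h : size (divisors n') ^ m.+1 <= C ^ k * n'.
  apply: IH => // p pp pn'.
  have pn : p %| n by rewrite en dvdn_mulr.
  have [|] := hp p pp pn; last by right.
  rewrite ltnS leq_eqVlt => /orP[/eqP epk|]; last by left.
  move: cn'; rewrite -epk prime_coprime//; by rewrite pn'.
apply: leq_trans (_ : ((logn k n).+1 * size (divisors n')) ^ m.+1 <= _).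
  by rewrite leq_exp2r.
have h2 : (logn k n).+1 ^ m.+1 <= C * k ^ logn k n.
  apply: leq_trans (succ_exp_le m (logn k n)) _; rewrite leq_mul2l; apply/orP; right.
  by case: (logn k n) => // e; rewrite leq_exp2r// prime_gt1.
rewrite expnMn [X in _ <= _ * X]en (expnS C k) [n' * _]mulnC mulnACA.
exact: leq_mul.
Qed.

End divisor_bound.

(** * Pairs with a given gcd *)

Section large_gcd.
Context {R : realType}.

(** N times the phase difference factors as (i - j) ((i + j) / 2 - al); here h = i - j and k = i +
    j. *)
Definition pair_hit (A : set R) (al : R) (N : nat) (h k : int) : bool :=
  `[< exists2 x, A x & exists m : int,
      (h * k)%:~R / 2 - h%:~R * al = x + N%:R * m%:~R >].

(** Ordinals start at 0, hence the summand 2 in i + j; the difference is unaffected. *)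
Definition gcd_pairs (A : set R) (al : R) (N g : nat) : {set 'I_N * 'I_N} :=
  [set p : 'I_N * 'I_N | [&& p.1 != p.2, gcdn (absz (p.1%:Z - p.2%:Z)) N == g &
     pair_hit A al N (p.1%:Z - p.2%:Z) (p.1%:Z + p.2%:Z + 2)]].

Lemma pair_correlation_gcd (A : set R) (al : R) (N : nat) : (0 < N)%N ->
  pair_correlation N A (fun z : R => (z - al) ^+ 2 / (2 * N%:R)) =
  (\sum_(g <- divisors N) #|gcd_pairs A al N g|)%:R / N%:R.
Proof.
move=> N0; have NR : N%:R != 0 :> R by rewrite pnatr_eq0 -lt0n.
rewrite /pair_correlation; congr (_%:R / _).
rewrite -sum1_card.
under [RHS]eq_bigr do rewrite -sum1_card big_mkcond.
rewrite exchange_big big_mkcond /=; apply: eq_bigr => -[i j] _.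
rewrite !inE /=.
have -> : `[< exists2 x : R, A x & exists m : int,
    (i.+1%:R - al) ^+ 2 / (2 * N%:R) - (j.+1%:R - al) ^+ 2 / (2 * N%:R) =
    x / N%:R + m%:~R >] = pair_hit A al N (i%:Z - j%:Z) (i%:Z + j%:Z + 2).
  apply: asbool_equiv_eq; split => -[x Ax [m hm]]; exists x => //; exists m.
    have -> : x + N%:R * m%:~R = N%:R * (x / N%:R + m%:~R) by field.
    rewrite -hm -!natr1 intrM intrB !intrD -!pmulrn.
    by field.
  have -> : x / N%:R + m%:~R = (x + N%:R * m%:~R) / N%:R by field.
  rewrite -hm -!natr1 intrM intrB !intrD -!pmulrn.
  by field.
case: eqVneq => /= [->|ij]; first by rewrite big1// => g _; rewrite inE /= eqxx.
case hh: (pair_hit _ _ _ _ _); last first.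
  by rewrite big1// => g _; rewrite inE /= hh !andbF.
have gd : gcdn (absz (i%:Z - j%:Z)) N \in divisors N.
  by rewrite -dvdn_divisors// dvdn_gcdr.
rewrite (bigD1_seq _ gd (divisors_uniq N)) /= big1 ?addn0 => [|g gne].
  by rewrite inE /= eqxx hh ij.
by rewrite inE /= [_ == g]eq_sym (negbTE gne) andbF.
Qed.

(** The Diophantine inequality multiplied by the denominator, its exponent rounded up to the integer
    m + 1. A negative D is reduced to -D by changing the sign of p. *)
Lemma diophantine_separated (kappa al : R) (m : nat) : diophantine kappa al ->
  kappa <= m.+1%:R ->
  exists2 C : R, 0 < C & forall (D p : int), D != 0 ->
    C <= `|D%:~R| ^+ m * `|D%:~R * al - p%:~R|.
Proof.
move=> [_ _ [C C0 hC]] km; exists C => // D p D0.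
pose q := absz D; have q0 : (0 < q)%N by rewrite absz_gt0.
have qR : 0 < q%:R :> R by rewrite ltr0n.
have q1 : 1 <= q%:R :> R by rewrite ler1n.
have h0 (p' : int) : C <= q%:R ^+ m * `|q%:R * al - p'%:~R|.
  have := hC p' q q0; rewrite ltr_pdivrMr ?powR_gt0// => /ltW h; apply: le_trans h _.
  have -> : al - p'%:~R / q%:R = (q%:R * al - p'%:~R) / q%:R :> R.
    by field; rewrite gt_eqF.
  rewrite normrM normfV normr_nat mulrAC ler_pdivrMr// mulrC -mulrAC -exprSr.
  rewrite ler_wpM2r// -powR_mulrn ?(ltW qR)//.
  exact: ler_powR.
have eq : `|D%:~R| = q%:R :> R by rewrite /q natr_absz intr_norm.
rewrite eq; have [D1|D1] := leP 0 D.
  by have -> : D%:~R = q%:R :> R; [rewrite -eq ger0_norm// ler0z|exact: h0].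
have -> : D%:~R = - q%:R :> R by rewrite -eq ltr0_norm ?opprK// ltrz0.
have := h0 (- p); rewrite intrN opprK mulNr -opprD normrN.
by [].
Qed.

(** Adding c makes both numbers nonnegative, so that equal quotients mean a common block of length
    Q. The factor 2 matches the frequency 2 d below. *)
Lemma quotient_close (Q c : nat) (z z' : int) : (0 < Q)%N ->
  (absz z < c)%N -> (absz z' < c)%N ->
  (absz (z + c%:Z)%R %/ Q = absz (z' + c%:Z)%R %/ Q)%N ->
  (absz (2 * (z - z'))%R <= 2 * Q)%N.
Proof.
move=> Q0 hz hz' hq.
have h1 := divn_eq (absz (z + c%:Z)%R) Q.
have h2 := divn_eq (absz (z' + c%:Z)%R) Q.
have h3 := ltn_pmod (absz (z + c%:Z)%R) Q0.
have h4 := ltn_pmod (absz (z' + c%:Z)%R) Q0.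
rewrite hq in h1; move: h1 h2 h3 h4 {hq}.
move: (absz (z' + c%:Z)%R %/ Q * Q)%N (absz (z + c%:Z)%R %% Q)%N
  (absz (z' + c%:Z)%R %% Q)%N => u r r'; lia.
Qed.

Lemma quotient_dvd_inj (c y y' : nat) (t : int) : (0 < c)%N ->
  (y %/ c = y' %/ c)%N -> y%:Z - y'%:Z = t * c%:Z -> y = y'.
Proof.
move=> c0 hq; have h1 := divn_eq y c; have h2 := divn_eq y' c.
have h3 := ltn_pmod y c0; have h4 := ltn_pmod y' c0.
rewrite hq in h1; move: h1 h2 h3 h4 {hq}.
move: (y' %/ c * c)%N (y %% c)%N (y' %% c)%N => u r r' h1 h2 h3 h4 h5.
have t0 : t = 0 by nia.
by rewrite t0 mul0r in h5; lia.
Qed.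

(* d j - alpha d determines j modulo c as soon as g exceeds the length of A, and
   two values of d for which it is near an integer are more than Q apart *)
Lemma large_gcd_bound (A : set R) (a b al C : R) (N g m Q : nat) :
  (0 < N)%N -> (g %| N)%N -> (0 < Q)%N -> (forall x, A x -> a <= x <= b) ->
  0 < C -> (forall D p : int, D != 0 -> C <= `|D%:~R| ^+ m * `|D%:~R * al - p%:~R|) ->
  b - a < g%:R ->
  (2 * Q%:R) ^+ m * (2 * (`|a| + `|b|)) < C * g%:R ->
  (#|gcd_pairs A al N g| * Q <= 6 * N)%N.
Proof.
move=> N0 gN Q0 hA C0 hC hg hQ.
have g0 : (0 < g)%N by exact: dvdn_gt0 gN.
have gR : 0 < g%:R :> R by rewrite ltr0n.
pose c := (N %/ g)%N; have eN : N = (g * c)%N by rewrite mulnC divnK.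
have c0 : (0 < c)%N by move: N0; rewrite eN muln_gt0 => /andP[].
have eNR : N%:R = g%:R * c%:R :> R by rewrite -natrM -eN.
(* An integer D of size at most 2 Q for which D al is within O(1/g) of an integer must vanish:
   otherwise the Diophantine bound contradicts the lower bound on g. *)
have far (D p : int) (y : R) : `|D%:~R| <= 2 * Q%:R :> R ->
    D%:~R * al - p%:~R = y / g%:R -> `|y| <= 2 * (`|a| + `|b|) -> D = 0.
  move=> DQ e hy; apply/eqP; apply: contraPT hQ => D0; apply/negP; rewrite -leNgt.
  rewrite -ler_pdivlMr// (le_trans (hC D p D0))// e normrM normfV normr_nat -mulrA.
  rewrite ler_pM ?exprn_ge0//.
    by rewrite lerXn2r ?nnegrE.
  by rewrite ler_pM2r ?invr_gt0.
pose d (p : 'I_N * 'I_N) : int := ((p.1%:Z - p.2%:Z) %/ g%:Z)%Z.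
(* Doubling clears the half in the phase: 2 d al is at distance at most 2 |x| / g from an
   integer. *)
have hd p : p \in gcd_pairs A al N g -> [/\ p.1%:Z - p.2%:Z = d p * g%:Z,
    coprimez (d p) c%:Z, d p != 0, (absz (d p) < c)%N &
    exists2 x, A x & exists m' : int,
      (2 * d p)%:~R * al - (d p * (p.1%:Z + p.2%:Z + 2) - 2 * c%:Z * m')%:~R =
        (- (2 * x)) / g%:R].
  rewrite inE => /and3P[pne /eqP hgcd /asboolP[x Ax [m' hm]]].
  have hdiv : (g%:Z %| p.1%:Z - p.2%:Z)%Z.
    by rewrite dvdzE /= -hgcd dvdn_gcdl.
  have e : p.1%:Z - p.2%:Z = d p * g%:Z by rewrite /d divzK.
  have dne : d p != 0.
    apply: contraNN pne => /eqP d0; apply/eqP/val_inj => /=.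
    by move: e; rewrite d0 mul0r => /eqP; rewrite subr_eq0 eqz_nat => /eqP.
  split => //.
  - move: hgcd; rewrite e abszM absz_nat eN mulnC -muln_gcdr => h.
    rewrite /coprimez /gcdz eqz_nat absz_nat -(eqn_pmul2l g0) muln1.
    exact/eqP.
  - rewrite -(ltn_pmul2r g0) [(c * g)%N]mulnC -eN -[g in (_ * g)%N]absz_nat -abszM -e.
    by have := ltn_ord p.1; have := ltn_ord p.2; clear; lia.
  - exists x => //; exists m'.
    move: hm; rewrite e eNR !intrB !intrM -!pmulrn => hm.
    have -> : x = (d p)%:~R * g%:R * (p.1%:Z + p.2%:Z + 2)%:~R / 2 -
      (d p)%:~R * g%:R * al - g%:R * c%:R * m'%:~R by rewrite hm; ring.
    by field; rewrite gt_eqF.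
have absx x : A x -> `|x| <= `|a| + `|b|.
  move=> /hA /andP[h1 h2]; rewrite ler_norml.
  have := ler_norm b; have := ler_norm (- a); rewrite normrN.
  have := normr_ge0 a; have := normr_ge0 b => *; apply/andP; split; lra.
have [->|[p0 hp0]] := set_0Vmem (gcd_pairs A al N g); first by rewrite cards0.
(* A single pair already forces this, for 0 < |d| < c < Q would contradict [far]. It absorbs the
   additional block when 2 c / Q is rounded. *)
have Qc : (Q <= c)%N.
  have [_ _ dne dc [x Ax [m' hm]]] := hd _ hp0.
  rewrite leqNgt; apply: contraNN dne => cQ.
  have := far _ _ _ _ hm; rewrite normrN normrM ger0_norm// => hf.
  suff : (2 * d p0 = 0 :> int) by clear; lia.
  apply: hf; last by rewrite ler_pM2l// absx.
  by rewrite -intr_norm -natr_absz -natrM ler_nat; move: dc cQ; clear; lia.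
(* The range (-c, c) of d is cut into blocks of length Q and the range of j into blocks of length c;
   a pair is determined by its two blocks, which leaves at most 3 c / Q times 2 g pairs. *)
pose f (p : 'I_N * 'I_N) : 'I_((2 * c) %/ Q).+1 * 'I_g.+1 :=
  (inord (absz (d p + c%:Z)%R %/ Q), inord (p.2 %/ c)).
have finj : {in gcd_pairs A al N g &, injective f}.
  move=> p p' hp hp' [].
  have [e1 cop _ dc [x Ax [m1 hm1]]] := hd _ hp.
  have [e2 _ _ dc' [x' Ax' [m2 hm2]]] := hd _ hp'.
  have bnd z : (absz z < c)%N -> (absz (z + c%:Z)%R %/ Q < ((2 * c) %/ Q).+1)%N.
    by move=> zc; rewrite ltnS leq_div2r//; move: zc; clear; lia.
  have bnd2 (j : 'I_N) : (j %/ c < g.+1)%N.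
    by rewrite ltnS ltnW// ltn_divLR// -eN.
  move=> /(congr1 val); rewrite /= !inordK ?bnd// => hq.
  move=> /(congr1 val); rewrite /= !inordK ?bnd2// => hj.
  have hx : `|2 * x' - 2 * x| <= 2 * (`|a| + `|b|).
    move: (hA _ Ax) (hA _ Ax') (ler_norm b) (ler_norm (- a)).
    rewrite ler_norml normrN; clear => /andP[? ?] /andP[? ?] ? ?.
    by apply/andP; split; lra.
  have dd : d p = d p'.
    have : 2 * (d p - d p') = 0.
      apply: (far _ (d p * (p.1%:Z + p.2%:Z + 2) - 2 * c%:Z * m1 -
         (d p' * (p'.1%:Z + p'.2%:Z + 2) - 2 * c%:Z * m2)) (2 * x' - 2 * x)) => //.
        rewrite -intr_norm -natr_absz -natrM ler_nat.
        exact: quotient_close dc dc' hq.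
      have -> : (2 * x' - 2 * x) / g%:R = - (2 * x) / g%:R - - (2 * x') / g%:R by ring.
      by rewrite -hm1 -hm2 !(intrD, intrN, intrM); ring.
    by clear; lia.
  have jj : p.2 = p'.2.
    have hz : d p * (p.2%:Z - p'.2%:Z) = c%:Z * (m1 - m2).
      have hr : (d p * (p.2%:Z - p'.2%:Z) - c%:Z * (m1 - m2))%:~R = (x - x') / g%:R :> R.
        have -> : (x - x') / g%:R = (- (2 * x') / g%:R - - (2 * x) / g%:R) / 2.
          by field; rewrite gt_eqF.
        rewrite -hm1 -hm2 -dd.
        have -> : p.1%:Z = p.2%:Z + d p * g%:Z by move: e1; clear; lia.
        have -> : p'.1%:Z = p'.2%:Z + d p * g%:Z by rewrite dd; move: e2; clear; lia.
        by rewrite !(intrD, intrN, intrM) -!pmulrn; field.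
      have hlt : `|(x - x') / g%:R| < 1.
        rewrite normrM normfV normr_nat ltr_pdivrMr// mul1r (le_lt_trans _ hg)//.
        move: (hA _ Ax) (hA _ Ax'); rewrite ler_norml; clear => /andP[? ?] /andP[? ?].
        by apply/andP; split; lra.
      move: hlt; rewrite -hr -intr_norm -natr_absz -[1]/(1%:R) ltr_nat; clear; lia.
    have : (c%:Z %| p.2%:Z - p'.2%:Z)%Z.
      have cop' : coprimez c%:Z (d p) by rewrite coprimez_sym.
      by rewrite -(Gauss_dvdzr _ cop') hz dvdz_mulr.
    by move=> /dvdzP[t ht]; apply/val_inj; exact: quotient_dvd_inj hj ht.
  have ii : p.1 = p'.1.
    have e : p.1%:Z = p'.1%:Z.
      by rewrite -[LHS](subrK p.2%:Z) e1 dd -e2 jj subrK.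
    by apply/val_inj; case: e.
  by rewrite [p]surjective_pairing [p']surjective_pairing ii jj.
have := max_card (mem (f @: gcd_pairs A al N g)).
rewrite card_in_imset// card_prod !card_ord => hcard.
apply: leq_trans (leq_mul hcard (leqnn Q)) _.
rewrite eN; have h1 : (((2 * c) %/ Q).+1 * Q <= 3 * c)%N.
  by rewrite mulSn; have := leq_trunc_div (2 * c) Q; move: Qc; clear; lia.
rewrite mulnAC; apply: leq_trans (leq_mul h1 (_ : g.+1 <= 2 * g)%N) _.
  by move: g0; clear; lia.
by clear; lia.
Qed.

End large_gcd.

(** * Removal of the parity condition *)

Section parity_decomposition.
Context {R : realType}.

(** Clearing the denominator [sg] makes diamonds of different centres and moduli comparable as
    inequalities between natural numbers. *)
Lemma in_diamond_nat (C : nat) (om rho k0 sg : R) (d y z : int) (g n : nat) :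
  0 < sg -> y%:~R / C%:R - k0 = z%:~R / sg ->
  om * `|d%:~R / C%:R| = (g * absz d)%:R / sg -> rho = n%:R / sg ->
  in_diamond C om rho k0 d y = (absz z + g * absz d <= n)%N.
Proof.
move=> s0 e1 e2 e3; rewrite /in_diamond e1 e2 e3 normrM normfV -intr_norm -natr_absz.
by rewrite (ger0_norm (ltW s0)) -mulrDl ler_pM2r ?invr_gt0// -natrD ler_nat.
Qed.

Lemma zsum_shift (F : int -> R) (t : int) : zsum F = zsum (fun n => F (n + t)).
Proof.
rewrite /zsum (reindex_fsbigT (fun n => n + t))//.
by exists (fun n => n - t) => n; rewrite ?addrK ?subrK.
Qed.

Lemma sum_even_zw (F : int -> R) (L : nat) :
  (forall k, (L < absz k)%N -> F k = 0) ->
  \sum_(k <- zw L) (2 %| k)%Z%:R * F k = \sum_(y <- zw L) F (2 * y).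
Proof.
move=> hF.
rewrite (eq_bigr (fun k : int => if (2 %| k)%Z then F k else 0)); last first.
  by move=> k _; case: (2 %| k)%Z; rewrite ?mul1r ?mul0r.
rewrite -big_mkcond [RHS](bigID (fun y : int => (absz (2 * y)%R <= L)%N)) /=.
rewrite [X in _ = _ + X]big1 ?addr0; last by move=> y; rewrite -ltnNge; exact: hF.
rewrite -[LHS]big_filter -[RHS]big_filter -[RHS](big_map (fun y : int => 2 * y) xpredT F).
apply: perm_big; apply: uniq_perm.
- by rewrite filter_uniq// zw_uniq.
- by rewrite map_inj_uniq ?filter_uniq ?zw_uniq// => x y h; lia.
move=> k; apply/idP/mapP => [|[y]].
  rewrite mem_filter mem_zw => /andP[/dvdzP[y ->] h].
  by exists y; rewrite ?mem_filter ?mem_zw; lia.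
by rewrite mem_filter !mem_zw => /andP[h1 h2] ->; rewrite mem_filter mem_zw dvdz_mulr//=.
Qed.

Lemma sum_zw_widen (P : pred int) (F : int -> R) (L L' : nat) : (L <= L')%N ->
  (forall k, (L < absz k)%N -> F k = 0) ->
  \sum_(k <- zw L | P k) F k = \sum_(k <- zw L' | P k) F k.
Proof.
move=> LL hF; rewrite [RHS](bigID (fun k : int => (absz k <= L)%N)) /=.
rewrite [X in _ = _ + X]big1 ?addr0; last by move=> k /andP[_]; rewrite -ltnNge; exact: hF.
rewrite -[LHS]big_filter -[RHS]big_filter; apply: perm_big; apply: uniq_perm.
- by rewrite filter_uniq// zw_uniq.
- by rewrite filter_uniq// zw_uniq.
by move=> k; rewrite !mem_filter !mem_zw; case: (P k) => //=; lia.
Qed.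

(** The square 1 <= i, j <= N in the coordinates g d = i - j and k = i + j, without the parity
    condition. *)
Definition in_region (N g : nat) (d k : int) : bool :=
  (absz (k - N.+1%:Z)%R + g * absz d <= N.-1)%N.

Lemma in_regionP (N g : nat) (d k : int) : (0 < N)%N ->
  in_region N g d k = (2 <= k + d * g%:Z <= 2 * N%:Z) && (2 <= k - d * g%:Z <= 2 * N%:Z).
Proof.
move=> N0; rewrite /in_region -(absz_nat g) -abszM mulrC absz_nat.
by move: (d * g%:Z) => z; lia.
Qed.

Lemma in_region_small (N g : nat) (d k : int) : (0 < N)%N -> in_region N g d k ->
  (absz k <= 2 * N)%N.
Proof. by move=> N0; rewrite in_regionP//; move: (d * g%:Z) => z; lia. Qed.

Lemma in_region_small_d (N g c : nat) (d k : int) : (0 < g)%N -> N = (g * c)%N ->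
  (0 < N)%N -> in_region N g d k -> (absz d < c)%N.
Proof.
move=> g0 eN N0; rewrite /in_region => h; rewrite -(ltn_pmul2l g0) -eN.
by move: (g * absz d)%N h => z; lia.
Qed.

(** The conditions gcd = g and i != j become coprimality of d and c: as c > 1, the value d = 0 is
    not prime to c. *)
Lemma card_gcd_pairs (A : set R) (al : R) (N g c L : nat) : (0 < g)%N -> (1 < c)%N ->
  N = (g * c)%N -> (2 * N <= L)%N ->
  #|gcd_pairs A al N g|%:R =
  \sum_(d <- zw c.*2 | coprimez c%:Z d) \sum_(k <- zw L)
    [&& (2 %| k - d * g%:Z)%Z, in_region N g d k &
        pair_hit A al N (d * g%:Z) k]%:R :> R.
Proof.
move=> g0 c1 eN NL.
have N0 : (0 < N)%N by rewrite eN muln_gt0 g0 (leq_trans _ c1).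
have eNc : (c * g)%N = N by rewrite mulnC -eN.
pose P (x : int * int) := [&& coprimez c%:Z x.1, (2 %| x.2 - x.1 * g%:Z)%Z,
  in_region N g x.1 x.2 & pair_hit A al N (x.1 * g%:Z) x.2].
pose s2 := [seq x <- [seq (d, k) | d <- zw c.*2, k <- zw L] | P x].
have -> : \sum_(d <- zw c.*2 | coprimez c%:Z d) \sum_(k <- zw L)
    [&& (2 %| k - d * g%:Z)%Z, in_region N g d k &
        pair_hit A al N (d * g%:Z) k]%:R = (size s2)%:R :> R.
  rewrite /s2 size_filter -sum1_count natr_sum [RHS]big_mkcond big_allpairs_dep.
  rewrite [LHS]big_mkcond; apply: eq_bigr => d _; rewrite /P /=.
  by case: (coprimez _ _) => /=; [|rewrite big1//]; apply: eq_bigr => k _; case: ifP.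
congr (_%:R).
pose f (p : 'I_N * 'I_N) : int * int :=
  (((p.1%:Z - p.2%:Z) %/ g%:Z)%Z, p.1%:Z + p.2%:Z + 2).
have hd p : p \in gcd_pairs A al N g ->
    p.1%:Z - p.2%:Z = ((p.1%:Z - p.2%:Z) %/ g%:Z)%Z * g%:Z.
  rewrite inE => /and3P[_ /eqP hgcd _]; rewrite divzK//.
  by rewrite dvdzE /= -hgcd dvdn_gcdl.
rewrite cardE -(size_map f); apply: perm_size; apply: uniq_perm.
- rewrite map_inj_in_uniq ?enum_uniq// => p p'; rewrite !mem_enum => hp hp' ef.
  have e1 : ((p.1%:Z - p.2%:Z) %/ g%:Z)%Z = ((p'.1%:Z - p'.2%:Z) %/ g%:Z)%Z := congr1 fst ef.
  have e2 : p.1%:Z + p.2%:Z + 2 = p'.1%:Z + p'.2%:Z + 2 := congr1 snd ef.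
  have e3 : p.1%:Z - p.2%:Z = p'.1%:Z - p'.2%:Z by rewrite (hd _ hp) (hd _ hp') e1.
  have i1 : p.1%:Z = p'.1%:Z by move: e2 e3; clear; lia.
  have i2 : p.2%:Z = p'.2%:Z by move: e2 e3; clear; lia.
  have j1 : p.1 = p'.1 by apply/val_inj; case: i1.
  have j2 : p.2 = p'.2 by apply/val_inj; case: i2.
  by rewrite [p]surjective_pairing [p']surjective_pairing j1 j2.
- rewrite filter_uniq// allpairs_uniq ?zw_uniq// => -[? ?] [? ?] _ _ [-> ->] //.
move=> x; apply/mapP/idP => [[p]|].
  rewrite mem_enum => hp ->.
  have e := hd _ hp; move: hp; rewrite inE => /and3P[pne /eqP hgcd hph].
  have b1 := ltn_ord p.1; have b2 := ltn_ord p.2.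
  have hreg : in_region N g ((p.1%:Z - p.2%:Z) %/ g%:Z)%Z (p.1%:Z + p.2%:Z + 2).
    rewrite in_regionP// -e; move: b1 b2; clear.
    by move: (p.1 : nat) (p.2 : nat) => i j; lia.
  have hdc := in_region_small_d g0 eN N0 hreg.
  have hkN := in_region_small N0 hreg.
  have h2 : (2 %| p.1%:Z + p.2%:Z + 2 - ((p.1%:Z - p.2%:Z) %/ g%:Z)%Z * g%:Z)%Z.
    by rewrite -e; apply/dvdzP; exists (p.2%:Z + 1); ring.
  have hcop : coprimez c%:Z ((p.1%:Z - p.2%:Z) %/ g%:Z)%Z.
    have hg1 : gcdn (absz ((p.1%:Z - p.2%:Z) %/ g%:Z)%Z * g) (c * g) = g.
      by rewrite eNc -[RHS]hgcd [in RHS]e abszM absz_nat.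
    move: hg1; rewrite -muln_gcdl => hg1.
    by rewrite /coprimez /gcdz eqz_nat absz_nat gcdnC -(eqn_pmul2r g0) mul1n hg1.
  have hph' : pair_hit A al N (((p.1%:Z - p.2%:Z) %/ g%:Z)%Z * g%:Z)
      (p.1%:Z + p.2%:Z + 2) by rewrite -e.
  rewrite mem_filter; apply/andP; split.
    by apply/and4P; split; [exact: hcop|exact: h2|exact: hreg|exact: hph'].
  apply/allpairsPdep; exists ((p.1%:Z - p.2%:Z) %/ g%:Z)%Z, (p.1%:Z + p.2%:Z + 2).
  split; [|by rewrite mem_zw (leq_trans hkN)|by []].
  by rewrite mem_zw (leq_trans (ltnW hdc))// -addnn leq_addr.
rewrite mem_filter => /andP[/and4P[hcop h2 hreg hph] _].
have hdc := in_region_small_d g0 eN N0 hreg.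
case: x hcop h2 hreg hph hdc => d k /= hcop /dvdzP[t ht] hreg hph hdc.
move: hreg; rewrite in_regionP// => /andP[/andP[r1 r2] /andP[r3 r4]].
pose i := absz (t + d * g%:Z - 1)%R; pose j := absz (t - 1)%R.
have ei : i%:Z = t + d * g%:Z - 1.
  by rewrite /i; move: (d * g%:Z) ht r1 r2 => z; clear; lia.
have ej : j%:Z = t - 1.
  by rewrite /j; move: (d * g%:Z) ht r3 r4 => z; clear; lia.
have iN : (i < N)%N by move: (d * g%:Z) ht r1 r2 ei => z; clear; lia.
have jN : (j < N)%N by move: (d * g%:Z) ht r3 r4 ej => z; clear; lia.
have edif : i%:Z - j%:Z = d * g%:Z by rewrite ei ej; ring.
have esum : i%:Z + j%:Z + 2 = k by rewrite ei ej -[k](subrK (d * g%:Z)) ht; ring.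
exists (Ordinal iN, Ordinal jN); last first.
  by rewrite /f /= edif esum mulzK// -lt0n.
have d0 : d != 0.
  by apply: contraTN hcop => /eqP ->; rewrite /coprimez gcdz0 absz_nat eqz_nat; case: (c) c1 => [|[]].
rewrite mem_enum inE /= edif esum hph andbT; apply/andP; split.
  apply: contraNN d0 => /eqP[] eij; move: edif; rewrite eij subrr => /esym/eqP.
  by rewrite mulf_eq0 eqz_nat => /orP[//|]; rewrite -leqn0 leqNgt g0.
rewrite abszM absz_nat [X in gcdn _ X]eN [(g * c)%N]mulnC -muln_gcdl.
move: hcop; rewrite /coprimez /gcdz eqz_nat absz_nat gcdnC => /eqP ->.
by rewrite mul1n.
Qed.

End parity_decomposition.

Section gcd_decomposition.
Context {R : realType}.

Lemma hit_even (A : set R) (al : R) (N g c : nat) (d y : int) : (0 < g)%N ->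
  N = (g * c)%N -> hit A g%:R^-1 al c d y = pair_hit A al N (d * g%:Z) (2 * y).
Proof.
move=> g0 eN; have gR : g%:R != 0 :> R by rewrite pnatr_eq0 -lt0n.
apply: asbool_equiv_eq; split => -[x Ax [m hm]]; exists x => //; exists m.
  rewrite eN natrM !intrM -!pmulrn.
  have -> : x + g%:R * c%:R * m%:~R = g%:R * (g%:R^-1 * x + c%:R * m%:~R) :> R by field.
  by rewrite -hm intrM; field.
have -> : g%:R^-1 * x + c%:R * m%:~R = g%:R^-1 * (x + N%:R * m%:~R) :> R.
  by rewrite eN natrM; field.
by rewrite -hm !intrM -!pmulrn; field.
Qed.

Lemma hit_all (A : set R) (al : R) (N g c : nat) (d k : int) : (0 < g)%N ->
  N = (g * c)%N ->
  hit A (2 / g%:R) (2 * al) (2 * c) d k = pair_hit A al N (d * g%:Z) k.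
Proof.
move=> g0 eN; have gR : g%:R != 0 :> R by rewrite pnatr_eq0 -lt0n.
apply: asbool_equiv_eq; split => -[x Ax [m hm]]; exists x => //; exists m.
  rewrite eN natrM !intrM -!pmulrn.
  have -> : x + g%:R * c%:R * m%:~R =
    g%:R / 2 * (2 / g%:R * x + (2 * c)%:R * m%:~R) :> R by rewrite natrM; field.
  by rewrite -hm intrM; field.
have -> : 2 / g%:R * x + (2 * c)%:R * m%:~R = 2 / g%:R * (x + N%:R * m%:~R) :> R.
  by rewrite eN !natrM; field.
by rewrite -hm !intrM -!pmulrn; field.
Qed.

(* for odd d the residue m mod 2 is absorbed by the shift y -> y - c *)
Lemma hit_odd (A : set R) (a b al : R) (N g c : nat) (d y : int) : (0 < g)%N ->
  (0 < c)%N -> N = (g * c)%N -> (forall x, A x -> a <= x <= b) -> b - a < N%:R ->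
  odd (absz d) ->
  (pair_hit A al N (d * g%:Z) (2 * y))%:R =
  (hit A g%:R^-1 al (2 * c) d y)%:R + (hit A g%:R^-1 al (2 * c) d (y - c%:Z))%:R :> R.
Proof.
move=> g0 c0 eN hA hN od; rewrite -(hit_even A al d y g0 eN).
have gR : 0 < g%:R :> R by rewrite ltr0n.
have cR : 0 < c%:R :> R by rewrite ltr0n.
have [d' ed] : exists d' : int, d = 2 * d' + 1.
  by exists ((d - 1) %/ 2)%Z; move: od; clear; lia.
have e1 : hit A g%:R^-1 al (2 * c) d y =
    `[< exists2 x, A x & exists m : int,
      (d * y)%:~R - d%:~R * al = g%:R^-1 * x + c%:R * (2 * m)%:~R >].
  apply: asbool_equiv_eq; split => -[x Ax [m hm]]; exists x => //; exists m;
    rewrite hm natrM intrM; ring.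
have e2 : hit A g%:R^-1 al (2 * c) d (y - c%:Z) =
    `[< exists2 x, A x & exists m : int,
      (d * y)%:~R - d%:~R * al = g%:R^-1 * x + c%:R * (2 * m + 1)%:~R >].
  apply: asbool_equiv_eq; split => -[x Ax [m hm]]; exists x => //.
    exists (m + d').
    have -> : (d * y)%:~R - d%:~R * al =
      (d * (y - c%:Z))%:~R - d%:~R * al + d%:~R * c%:R :> R.
      by rewrite !(intrM, intrD, intrN) -!pmulrn; ring.
    by rewrite hm natrM ed !(intrM, intrD); ring.
  exists (m - d').
  have -> : (d * (y - c%:Z))%:~R - d%:~R * al =
    (d * y)%:~R - d%:~R * al - d%:~R * c%:R :> R.
    by rewrite !(intrM, intrD, intrN) -!pmulrn; ring.
  by rewrite hm natrM ed !(intrM, intrD, intrN); ring.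
have disj : hit A g%:R^-1 al (2 * c) d y -> hit A g%:R^-1 al (2 * c) d (y - c%:Z) -> False.
  rewrite e1 e2 => /asboolP[x /hA /andP[x1 x2] [m hm]] /asboolP[x' /hA /andP[x3 x4] [m' hm']].
  have h : c%:R * (2 * m - (2 * m' + 1))%:~R = g%:R^-1 * (x' - x) :> R.
    by rewrite intrB mulrBr mulrBr; move: hm; rewrite hm'; lra.
  have : `|g%:R^-1 * (x' - x)| < c%:R.
    rewrite normrM normfV normr_nat ltr_pdivrMl// -natrM -eN (le_lt_trans _ hN)//.
    by rewrite ler_norml; apply/andP; split; lra.
  rewrite -h normrM normr_nat -[X in _ < X]mulr1 ltr_pM2l// -intr_norm -natr_absz.
  by rewrite -[1]/(1%:R) ltr_nat; clear; lia.
have or : hit A g%:R^-1 al c d y =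
    hit A g%:R^-1 al (2 * c) d y || hit A g%:R^-1 al (2 * c) d (y - c%:Z).
  apply/idP/orP.
    move=> /asboolP[x Ax [m hm]].
    have [m' [em|em]] : exists m' : int, m = 2 * m' \/ m = 2 * m' + 1.
      by exists (m %/ 2)%Z; clear; lia.
    - by left; rewrite e1; apply/asboolP; exists x => //; exists m'; rewrite hm em.
    - by right; rewrite e2; apply/asboolP; exists x => //; exists m'; rewrite hm em.
  by rewrite e1 e2 => -[] /asboolP[x Ax [m hm]]; apply/asboolP; exists x => //;
     eexists; exact: hm.
rewrite or; move: disj.
case: (hit A g%:R^-1 al (2 * c) d y); case: (hit _ _ _ _ _ (y - c%:Z)) => //= h.
- by case: h.
- by rewrite addr0.
- by rewrite add0r.
- by rewrite addr0.
Qed.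

(** The indicator of k = g d mod 2 is [k even] + [g odd] [d odd] (1 - 2 [k even]). Even k are
    written 2 y, which halves the frequency. Odd d prime to c are the d prime to 2 c; for these the
    condition on y modulo c is split into two conditions modulo 2 c, the second with y shifted by c
    and so with centre shifted by 1/2. *)
Lemma gcd_pairs_decomposition (A : set R) (a b al : R) (N g c L : nat) :
  (0 < g)%N -> (1 < c)%N -> N = (g * c)%N ->
  (forall x, A x -> a <= x <= b) -> b - a < N%:R -> (4 * N <= L)%N ->
  let rho := N.-1%:R / (2 * c%:R) in let k0 := N.+1%:R / (2 * c%:R) in
  #|gcd_pairs A al N g|%:R =
  diamond_count A g%:R^-1 al c (g%:R / 2) rho k0 L +
  (odd g)%:R * (diamond_count A (2 / g%:R) (2 * al) (2 * c) g%:R rho k0 L -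
    2 * (diamond_count A g%:R^-1 al (2 * c) (g%:R / 2) (rho / 2) (k0 / 2) L +
         diamond_count A g%:R^-1 al (2 * c) (g%:R / 2) (rho / 2) (k0 / 2 - 2^-1) L)) :> R.
Proof.
move=> g0 c1 eN hA hN NL rho k0.
have c0 : (0 < c)%N by apply: leq_trans c1.
have N0 : (0 < N)%N by rewrite eN muln_gt0 g0.
have cR : 0 < c%:R :> R by rewrite ltr0n.
have cN : (c <= N)%N by rewrite eN leq_pmull.
pose F d k := in_region N g d k && pair_hit A al N (d * g%:Z) k.
have F0 d k : (2 * N < absz k)%N -> (F d k)%:R = 0 :> R.
  by move=> hk; rewrite /F; case hr: (in_region _ _ _ _) => //=;
     move: (in_region_small N0 hr) hk; clear; lia.
pose S d : R := \sum_(y <- zw L) (F d (2 * y))%:R.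
pose U d : R := \sum_(k <- zw L) (F d k)%:R.
have LN : (2 * N <= L)%N by move: NL; clear; lia.
rewrite (card_gcd_pairs A al g0 c1 eN LN).
have termE d : \sum_(k <- zw L) [&& (2 %| k - d * g%:Z)%Z, in_region N g d k &
        pair_hit A al N (d * g%:Z) k]%:R =
    S d + (odd g)%:R * ((odd (absz d))%:R * (U d - 2 * S d)).
  have SE : S d = \sum_(k <- zw L) (2 %| k)%Z%:R * (F d k)%:R.
    by rewrite sum_even_zw// => k hk; apply: F0; apply: leq_ltn_trans hk.
  rewrite SE /U mulr_sumr -sumrB !mulr_sumr -big_split /=; apply: eq_bigr => k _.
  rewrite -/(F d k).
  have -> : (2 %| k - d * g%:Z)%Z = (2 %| k)%Z (+) (odd g && odd (absz d)).
    by rewrite andbC; case: (boolP (odd (absz d))); case: (boolP (odd g)) => h1 h2;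
      move: h1 h2; clear; nia.
  case: (2 %| k)%Z; case: (odd g); case: (odd (absz d)); case: (F d k);
    rewrite /= ?mulr1 ?mulr0 ?mul1r ?mul0r ?addr0 ?add0r ?subr0 ?subrr//; ring.
under eq_bigr do rewrite termE.
rewrite big_split /= -mulr_sumr; congr (_ + _).
  apply: eq_bigr => d _; apply: eq_bigr => y _; rewrite /F; congr (_%:R); congr andb.
    apply/esym; apply: (@in_diamond_nat R _ _ _ _ (2 * c%:R)); first by rewrite mulr_gt0.
    - by rewrite /k0 intrB intrM -!pmulrn; field; rewrite gt_eqF.
    - rewrite normrM normfV normr_nat -intr_norm -natr_absz natrM.
      by field; rewrite gt_eqF.
    - by [].
  by rewrite (hit_even A al d y g0 eN).
have [og|eg] := boolP (odd g); last by rewrite !mul0r.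
rewrite !mul1r.
have region0 d k : (c.*2 < absz d)%N -> F d k = false.
  move=> hd; rewrite /F; case hr: (in_region _ _ _ _) => //=.
  by move: (in_region_small_d g0 eN N0 hr) hd; clear; lia.
(* Oddness of d is absorbed into the modulus 2 c; the window may be widened because the region
   forces |d| < c. *)
have -> : \sum_(d <- zw c.*2 | coprimez c%:Z d) (odd (absz d))%:R * (U d - 2 * S d) =
   \sum_(d <- zw (2 * c).*2 | coprimez (2 * c)%:Z d) (U d - 2 * S d).
  rewrite -(@sum_zw_widen R (coprimez (2 * c)%:Z) _ c.*2); last 2 first.
  - by clear; lia.
  - move=> d hd; rewrite /U /S !big1 ?mulr0 ?subr0// => k _; by rewrite region0.
  rewrite big_mkcond [RHS]big_mkcond; apply: eq_bigr => d _.
  have -> : coprimez (2 * c)%:Z d = coprimez c%:Z d && odd (absz d).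
    by rewrite /coprimez /gcdz !eqz_nat !absz_nat -!/(coprime _ _) coprimeMl coprime2n andbC.
  by case: (coprimez _ _); case: (odd _); rewrite ?mul1r ?mul0r.
rewrite sumrB -mulr_sumr; congr (_ - 2 * _).
  apply: eq_bigr => d _; apply: eq_bigr => k _; rewrite /F; congr (_%:R); congr andb.
    apply/esym; apply: (@in_diamond_nat R _ _ _ _ (2 * c%:R)); first by rewrite mulr_gt0.
    - by rewrite /k0 intrB natrM -!pmulrn; field; rewrite gt_eqF.
    - rewrite normrM normfV normr_nat -intr_norm -natr_absz !natrM.
      by field; rewrite gt_eqF.
    - by [].
  by rewrite (hit_all A al d k g0 eN).
rewrite /diamond_count -big_split /=; apply: eq_bigr => d hd.
have od : odd (absz d).
  by move: hd; rewrite /coprimez /gcdz eqz_nat absz_nat -/(coprime _ _) coprimeMl coprime2n => /andP[].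
have diamE y (t : R) (z : int) : t = k0 / 2 - z%:~R / (2 * c%:R) ->
    in_diamond (2 * c) (g%:R / 2) (rho / 2) t d y = in_region N g d (2 * (y + z)).
  move=> ->; apply: (@in_diamond_nat R _ _ _ _ (4 * c%:R)); first by rewrite mulr_gt0.
  - by rewrite /k0 intrB intrM intrD natrM -!pmulrn; field; rewrite gt_eqF.
  - rewrite normrM normfV normr_nat -intr_norm -natr_absz !natrM.
    by field; rewrite gt_eqF.
  - by rewrite /rho; field; rewrite gt_eqF.
pose G1 y : R := (in_region N g d (2 * y) && hit A g%:R^-1 al (2 * c) d y)%:R.
pose G2 y : R := (in_region N g d (2 * y) && hit A g%:R^-1 al (2 * c) d (y - c%:Z))%:R.
have SE : S d = \sum_(y <- zw L) G1 y + \sum_(y <- zw L) G2 y.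
  rewrite /S -big_split; apply: eq_bigr => y _; rewrite /F /G1 /G2.
  case: (in_region _ _ _ _) => /=; last by rewrite addr0.
  exact: hit_odd hA hN od.
rewrite SE; congr (_ + _).
  apply: eq_bigr => y _; rewrite /G1 (diamE _ _ 0) ?addr0//.
  by rewrite mul0r subr0.
have G20 y : (2 * N < absz (2 * y)%R)%N -> G2 y = 0.
  move=> hy; rewrite /G2; case hr: (in_region _ _ _ _) => //=.
  by move: (in_region_small N0 hr) hy; clear; lia.
(* Passing through the sum over all integers allows the shift by c; L >= 4 N leaves room for the
   shifted support. *)
rewrite -(@zsumE R L G2); last by move=> y hy; apply: G20; move: hy LN; clear; lia.
rewrite (zsum_shift _ c%:Z) (@zsumE R L); last first.
  by move=> y hy; apply: G20; move: hy NL cN; clear; lia.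
apply: eq_bigr => y _; rewrite /G2 addrK (diamE _ _ c%:Z)//.
by rewrite -pmulrn; field; rewrite gt_eqF.
Qed.

End gcd_decomposition.

(** * Error terms uniform in the gcd *)

Section uniform_estimates.
Context {R : realType}.

Lemma totient_le n : (0 < n)%N -> (totient n <= n)%N.
Proof.
move=> n0; have h := cyclic.sum_totient_dvd n.
rewrite (bigD1 (ord_max : 'I_n.+1)) //= in h.
by rewrite -[X in (_ <= X)%N]h leq_addr.
Qed.

(** The frequency doubles because the series involves 2 xi2. Frequencies 2 alpha and alpha are
    therefore obtained at alpha and alpha / 2. *)
Definition box_equidistribution (e : nat) (s al : R) : Prop :=
  forall W : R, 1 <= W -> exists K : R, exists C0 : nat, 0 <= K /\
  forall (c : nat) (H e0 : R), (C0 <= c)%N -> (0 < c)%N ->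
    0 < e0 -> e0 <= 1 -> 1 <= H ->
    box_estimate (2 * al) c e0 W H
      (K * ((totient c)%:R * H * e0^-1 ^+ e * c%:R `^ (- s))).

Lemma equidistribution_boxes : equidistribution R ->
  exists e : nat, exists2 kappa0 : R, 2 <= kappa0 &
  forall kappa : R, kappa <= kappa0 -> exists2 s : R, 0 < s &
  forall al : R, diophantine kappa al -> box_equidistribution e s al.
Proof.
move=> /smooth_box [e [kappa0 k2 h]]; exists e, kappa0 => // kappa /h [s s0 {}h].
exists s => // al /h {}h W /h [K [C0 [K0 {}h]]]; exists K, C0; split => //.
move=> c H e0 cC c0 e00 e01 H1 i0 i1 b0 b1 j0 j1 *.
exact: h.
Qed.

(** All errors are brought to the size c / Q. The smoothing loss is Q d g with d = Q^-(p+2), at most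
    1 / Q since g <= Q^p. The errors of (E) have order phi Q g d^-e c^-s, and the condition on
    Q^((p+2)(e+1)) makes this at most phi / Q. *)
Lemma diamond_uniform (e p : nat) (s al a b : R) (A : set R) :
  box_equidistribution e s al -> a <= b -> (forall x, A x -> a <= x <= b) ->
  (forall x, a < x < b -> A x) ->
  exists K : R, exists C0 : nat, 0 <= K /\
  forall (c Q L : nat) (g lam om rho k0 : R), (C0 <= c)%N -> (0 < c)%N -> (4 <= Q)%N ->
    1 <= g -> g <= Q%:R ^+ p -> 0 < lam -> lam * g <= 2 -> 0 < om ->
    1 / 8 <= rho -> rho <= g -> 1 / 4 <= rho / om -> rho / om <= 1 ->
    (`|k0| + rho) * c%:R <= L%:R ->
    Q%:R ^+ ((p.+2) * e.+1) <= c%:R `^ s ->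
    `| diamond_count A lam (2 * al) c om rho k0 L -
       (totient c)%:R * (lam * (b - a) * (2 * rho * (rho / om))) | <= K * (c%:R / Q%:R).
Proof.
move=> hbox ab hA hA'.
have a0 := normr_ge0 a; have b0 := normr_ge0 b.
have [|K [C0 [K0 {}hbox]]] := hbox (2 * (`|a| + `|b|) + 1); first by lra.
exists (4 * (b - a) + 12 * (1 + 2 * (b - a)) + 6 * K).
exists (maxn C0 (Num.truncn (2 * (b - a))).+1); split; first by lra.
move=> c Q L g lam om rho k0; rewrite geq_max => /andP[cC cba] c0 Q4 g1 gQ lam0 lamg om0.
move=> rho8 rhog X4 X1 hL hQ.
have Q0 : (0 < Q)%N by exact: leq_trans Q4.
have QR : 0 < Q%:R :> R by rewrite ltr0n.
have Q4R : 4 <= Q%:R :> R by rewrite (ler_nat _ 4).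
have cR : 0 < c%:R :> R by rewrite ltr0n.
pose q : R := Q%:R^-1; have q0 : 0 < q by rewrite invr_gt0.
have q4 : q <= 1 / 4 by rewrite /q -div1r ler_pdivrMr//; move: Q4R; clear; lra.
have qQ : q * Q%:R = 1 by rewrite /q mulVf// gt_eqF.
(* Besides the loss above, d <= q / 4 keeps the scale below the cell sizes, by the lower bounds 1/8
   on rho and 1/4 on rho / om. *)
pose d : R := q ^+ p.+2.
have d0 : 0 < d by rewrite exprn_gt0.
have dq : d <= q / 4.
  have h : q ^+ p <= 1 by rewrite exprn_ile1 ?(ltW q0)//; lra.
  rewrite /d 2!exprS mulrA; apply: (@le_trans _ _ (q * q * 1)).
    by rewrite ler_wpM2l// mulr_ge0// ltW.
  by rewrite mulr1 ler_pM2l//; lra.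
have d1 : d <= 1 by lra.
have dinv : d^-1 = Q%:R ^+ p.+2 by rewrite /d /q exprVn invrK.
have lam2 : lam <= 2 by apply: le_trans lamg; rewrite ler_peMr// ltW.
pose phi : R := (totient c)%:R.
have phi0 : 0 <= phi by [].
have phic : phi <= c%:R by rewrite ler_nat totient_le.
pose Err := K * (phi * (3 * g) * d^-1 ^+ e * c%:R `^ (- s)).
have ps : 0 <= c%:R `^ (- s) by exact: powR_ge0.
have Err0 : 0 <= Err.
  by rewrite /Err !mulr_ge0 ?exprn_ge0 ?invr_ge0 ?(ltW d0)//; move: g1; clear; lra.
have g3 : 1 <= 3 * g by move: g1; clear; lra.
have rho0 : 0 < rho by move: rho8; clear; lra.
have eX : d <= rho / om / Q%:R.
  apply: le_trans dq _; rewrite mulrC; apply: ler_wpM2r; first exact: ltW.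
  by move: X4; clear; lra.
have eR : d <= 2 * rho / Q%:R.
  apply: le_trans dq _; rewrite mulrC; apply: ler_wpM2r; first exact: ltW.
  by move: rho8; clear; lra.
have hc : lam * (b - a) <= c%:R.
  apply: (@le_trans _ _ (2 * (b - a))); first by apply: ler_wpM2r => //; rewrite subr_ge0.
  by apply: le_trans (ltW (truncnS_gt _)) _; rewrite ler_nat.
have := diamond_estimate c0 Q0 hA hA' ab lam0 g1 lamg om0 rho0 rhog X1 d0 d1 eX eR hc hL
  (lexx _) Err0 (hbox c (3 * g) d cC c0 d0 d1 g3).
move=> h; apply: le_trans h _; rewrite -/phi -/q.
have h1 : Q%:R * d * g <= q.
  have hg : d * g <= q * q.
    apply: (@le_trans _ _ (q * q * (q ^+ p * Q%:R ^+ p))).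
      by rewrite /d 2!exprS !mulrA ler_wpM2l// !mulr_ge0 ?exprn_ge0// ltW.
    by rewrite -exprMn qQ expr1n mulr1.
  have := ler_wpM2l (ltW QR) hg.
  by rewrite mulrA [X in _ <= X]mulrA [Q%:R * q]mulrC qQ mul1r.
have h2 : 2 * Q%:R * Err <= 6 * K * (phi * q).
  have cs : Q%:R ^+ (p.+2 * e.+1) * c%:R `^ (- s) <= 1.
    by rewrite powRN ler_pdivrMr ?powR_gt0// mul1r.
  have e1 : Q%:R ^+ (p.+2 * e.+1) = Q%:R * (Q%:R * Q%:R ^+ p) * d^-1 ^+ e :> R.
    by rewrite mulnS exprD dinv -exprM (exprS _ p.+1) (exprS _ p).
  have -> : 2 * Q%:R * Err = 6 * K * phi * (Q%:R * g * d^-1 ^+ e * c%:R `^ (- s)).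
    by rewrite /Err; ring.
  rewrite [X in _ <= X]mulrA; apply: ler_wpM2l; first by rewrite !mulr_ge0.
  rewrite -[X in _ <= X]mulr1; apply: le_trans (ler_wpM2l (ltW q0) cs).
  rewrite e1 !mulrA qQ mul1r; apply: ler_wpM2r => //; apply: ler_wpM2r.
    by rewrite exprn_ge0// invr_ge0 ltW.
  by rewrite ler_pM2l.
have h3 : phi * (4 * (b - a) * q + Q%:R * d * g * (12 * (1 + 2 * (b - a)))) <=
    phi * ((4 * (b - a) + 12 * (1 + 2 * (b - a))) * q).
  apply: ler_wpM2l => //; have M0 : 0 <= 12 * (1 + 2 * (b - a)) by move: ab; clear; lra.
  by have := ler_wpM2r M0 h1; clear; lra.
have h4 : (4 * (b - a) + 12 * (1 + 2 * (b - a)) + 6 * K) * (phi * q) <=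
    (4 * (b - a) + 12 * (1 + 2 * (b - a)) + 6 * K) * (c%:R * q).
  by apply: ler_wpM2l; [move: ab K0; clear; lra|rewrite ler_pM2r].
apply: le_trans h4; move: h2 h3; clear; lra.
Qed.

(** [hbox1] serves the diamond of frequency 2 al, [hbox2] the three of frequency al. The bounds on
    their shapes come from rho = g t / 2 with t = (N - 1) / N in [1/2, 1]. *)
Lemma gcd_pairs_estimate (e p : nat) (s al a b : R) (A : set R) :
  0 <= s ->
  box_equidistribution e s al -> box_equidistribution e s (al / 2) ->
  a <= b -> (forall x, A x -> a <= x <= b) -> (forall x, a < x < b -> A x) ->
  exists K : R, exists C0 : nat, 0 <= K /\
  forall (N g c Q : nat), N = (g * c)%N -> (0 < g)%N -> (C0 <= c)%N -> (4 <= Q)%N ->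
    (Q <= N)%N -> g%:R <= Q%:R ^+ p :> R -> Q%:R ^+ ((p.+2) * e.+1) <= c%:R `^ s ->
    `| #|gcd_pairs A al N g|%:R - (totient c)%:R * (b - a) | <= K * (c%:R / Q%:R).
Proof.
move=> s0 hbox1 hbox2 ab hA hA'.
have [K1 [C1 [K10 h1]]] := diamond_uniform p hbox1 ab hA hA'.
have [K2 [C2 [K20 h2]]] := diamond_uniform p hbox2 ab hA hA'.
exists (K2 + 2 * (K1 + 4 * K2) + 2 * (b - a)).
exists (maxn (maxn C1 C2) (maxn 2 (Num.truncn (b - a)).+1)); split; first by lra.
move=> N g c Q eN g0; rewrite !geq_max => /andP[/andP[cC1 cC2] /andP[c2 cba]] Q4 QN gQ hQ.
have c0 : (0 < c)%N by exact: leq_trans c2.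
have N0 : (0 < N)%N by rewrite eN muln_gt0 g0.
have gR : 0 < g%:R :> R by rewrite ltr0n.
have cR : 0 < c%:R :> R by rewrite ltr0n.
have NR : 0 < N%:R :> R by rewrite ltr0n.
have QR : 0 < Q%:R :> R by rewrite ltr0n; exact: leq_trans Q4.
have g1 : 1 <= g%:R :> R by rewrite ler1n.
have cN : (c <= N)%N by rewrite eN leq_pmull.
have hN : b - a < N%:R.
  by apply: lt_le_trans (truncnS_gt _) _; rewrite ler_nat (leq_trans cba).
have eNR : N%:R = g%:R * c%:R :> R by rewrite -natrM -eN.
pose t : R := N.-1%:R / N%:R.
have eN1 : N.-1%:R = N%:R - 1 :> R by rewrite -[in RHS](prednK N0) -natr1 addrK.
have N2 : 2 <= N%:R :> R by rewrite (ler_nat _ 2) (leq_trans c2).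
have t2 : 1 / 2 <= t by rewrite /t ler_pdivlMr// eN1; lra.
have t1 : t <= 1 by rewrite /t ler_pdivrMr// eN1; lra.
pose rho : R := N.-1%:R / (2 * c%:R); pose k0 : R := N.+1%:R / (2 * c%:R).
have rhoE : rho = g%:R / 2 * t by rewrite /rho /t eNR; field; rewrite !gt_eqF.
have k00 : 0 <= k0 by rewrite divr_ge0.
have hrk : (k0 + rho) * c%:R = N%:R.
  by rewrite /k0 /rho eN1 -natr1; field; rewrite gt_eqF.
have gt2 : g%:R * (1 / 2) <= g%:R * t by rewrite ler_pM2l.
have gt1 : g%:R * t <= g%:R * 1 by rewrite ler_pM2l.
have rho4 : 1 / 4 <= rho by rewrite rhoE; move: g1 gt2; clear; lra.
have rhog2 : rho <= g%:R / 2 by rewrite rhoE; move: gt1; clear; lra.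
have h8 : 1 / 8 <= rho by move: rho4; clear; lra.
have h8' : 1 / 8 <= rho / 2 by move: rho4; clear; lra.
have hg : rho <= g%:R by move: rhog2 gR; clear; lra.
have hg' : rho / 2 <= g%:R by move: rhog2 rho4 gR; clear; lra.
have t4 : 1 / 4 <= t by move: t2; clear; lra.
have t4' : 1 / 4 <= t / 2 by move: t2; clear; lra.
have t1' : t / 2 <= 1 by move: t1 t2; clear; lra.
have rX1 : rho / (g%:R / 2) = t by rewrite rhoE; field; rewrite gt_eqF.
have rX2 : rho / g%:R = t / 2 by rewrite rhoE; field; rewrite gt_eqF.
have rX3 : rho / 2 / (g%:R / 2) = t / 2 by rewrite rhoE; field; rewrite gt_eqF.
have g20 : 0 < g%:R / 2 :> R by rewrite divr_gt0.
have cs : c%:R `^ s <= (2 * c)%:R `^ s :> R.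
  by apply: ge0_ler_powR; rewrite ?nnegrE// ler_nat leq_pmull.
have hQ2 := le_trans hQ cs.
have L0 : N%:R <= (4 * N)%:R :> R by rewrite ler_nat leq_pmull.
have lam1 : g%:R^-1 * g%:R <= 2 :> R by rewrite mulVf ?gt_eqF// ler1n.
have gi0 : 0 < g%:R^-1 :> R by rewrite invr_gt0.
have lam2 : 2 / g%:R * g%:R <= 2 :> R by rewrite divfK ?gt_eqF.
have gi20 : 0 < 2 / g%:R :> R by rewrite divr_gt0.
have cC1' : (C1 <= 2 * c)%N by rewrite (leq_trans cC1)// leq_pmull.
have cC2' : (C2 <= 2 * c)%N by rewrite (leq_trans cC2)// leq_pmull.
have c20 : (0 < 2 * c)%N by rewrite muln_gt0.
have alE : 2 * (al / 2) = al by field.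
have D1 := h2 c Q (4 * N)%N g%:R g%:R^-1 (g%:R / 2) rho k0 cC2 c0 Q4 g1 gQ gi0 lam1 g20.
have D4 := h1 (2 * c)%N Q (4 * N)%N g%:R (2 / g%:R) g%:R rho k0 cC1' c20 Q4 g1 gQ gi20 lam2 gR.
have D2 k := h2 (2 * c)%N Q (4 * N)%N g%:R g%:R^-1 (g%:R / 2) (rho / 2) k cC2' c20 Q4 g1 gQ gi0 lam1 g20.
rewrite alE rX1 in D1; rewrite rX2 in D4.
have {}D1 : `|diamond_count A g%:R^-1 al c (g%:R / 2) rho k0 (4 * N) -
    (totient c)%:R * ((b - a) * t ^+ 2)| <= K2 * (c%:R / Q%:R).
  have -> : (b - a) * t ^+ 2 = g%:R^-1 * (b - a) * (2 * rho * t).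
    by rewrite rhoE; field; rewrite gt_eqF.
  by apply: D1 => //; rewrite (ger0_norm k00) hrk.
have {}D4 : `|diamond_count A (2 / g%:R) (2 * al) (2 * c) g%:R rho k0 (4 * N) -
    (totient (2 * c))%:R * ((b - a) * t ^+ 2)| <= K1 * ((2 * c)%:R / Q%:R).
  have -> : (b - a) * t ^+ 2 = 2 / g%:R * (b - a) * (2 * rho * (t / 2)).
    by rewrite rhoE; field; rewrite gt_eqF.
  apply: D4 => //; rewrite (ger0_norm k00) !natrM mulrCA hrk ler_wpM2r//.
  by rewrite ler_nat.
have {}D2 k : `|k| <= k0 / 2 + 1 / 2 ->
    `|diamond_count A g%:R^-1 al (2 * c) (g%:R / 2) (rho / 2) k (4 * N) -
    (totient (2 * c))%:R * ((b - a) * t ^+ 2 / 4)| <= K2 * ((2 * c)%:R / Q%:R).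
  move=> hk; have := D2 k; rewrite alE rX3 => {}D2.
  have -> : (b - a) * t ^+ 2 / 4 = g%:R^-1 * (b - a) * (2 * (rho / 2) * (t / 2)).
    by rewrite rhoE; field; rewrite gt_eqF.
  apply: D2 => //; apply: (@le_trans _ _ ((k0 / 2 + 1 / 2 + rho / 2) * (2 * c%:R))).
    by rewrite natrM ler_pM2r ?mulr_gt0// lerD2r.
  have -> : (k0 / 2 + 1 / 2 + rho / 2) * (2 * c%:R) = (k0 + rho) * c%:R + c%:R by field.
  by rewrite hrk -natrD ler_nat; move: cN; clear; lia.
have hk1 : `|k0 / 2| <= k0 / 2 + 1 / 2 by rewrite ger0_norm; move: k00; clear; lra.
have hk2 : `|k0 / 2 - 2^-1| <= k0 / 2 + 1 / 2.
  by rewrite ler_norml; move: k00; clear => k00; apply/andP; split; lra.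
rewrite (gcd_pairs_decomposition al g0 c2 eN hA hN (leqnn _)) -/rho -/k0.
move: D1 D4 (D2 _ hk1) (D2 _ hk2).
set d1 := diamond_count _ _ _ _ _ _ _ _; set d4 := diamond_count _ _ _ _ _ _ _ _.
set d2 := diamond_count _ _ _ _ _ _ _ _; set d3 := diamond_count _ _ _ _ _ _ _ _.
set T := (totient (2 * c))%:R * _.
move=> D1 D4 D2' D3'.
have phic : (totient c)%:R <= c%:R :> R by rewrite ler_nat totient_le.
have cQ : 0 <= c%:R / Q%:R :> R by rewrite divr_ge0.
(* The diamond is slightly too small because |i - j| <= N - 1; replacing t^2 by 1 costs 2 / N, which
   is where Q <= N enters. *)
have htt : `|(totient c)%:R * ((b - a) * t ^+ 2) - (totient c)%:R * (b - a)| <=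
    2 * (b - a) * (c%:R / Q%:R).
  have -> : (totient c)%:R * ((b - a) * t ^+ 2) - (totient c)%:R * (b - a) =
    - ((totient c)%:R * ((b - a) * (1 - t ^+ 2))) by ring.
  have tt : 1 - t ^+ 2 <= 2 / Q%:R.
    have e1 : 1 - t = N%:R^-1 by rewrite /t eN1; field; rewrite gt_eqF.
    have -> : 1 - t ^+ 2 = (1 - t) * (1 + t) by ring.
    rewrite e1 mulrC; apply: ler_pM.
    - by move: t2; clear; lra.
    - by rewrite invr_ge0.
    - by move: t1; clear; lra.
    by rewrite lef_pV2 ?posrE// ler_nat.
  have tt0 : 0 <= 1 - t ^+ 2 by rewrite subr_ge0 exprn_ile1//; move: t2; clear; lra.
  have ba : 0 <= b - a by rewrite subr_ge0.
  rewrite normrN ger0_norm; last by rewrite !mulr_ge0.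
  apply: (@le_trans _ _ (c%:R * ((b - a) * (2 / Q%:R)))).
    by apply: ler_pM => //; [rewrite mulr_ge0|exact: ler_wpM2l].
  by rewrite le_eqVlt; apply/orP; left; apply/eqP; ring.
(* The parity correction has no main term: among the odd d, even and odd k occur equally often to
   leading order, so T cancels. *)
have e4 : T = 2 * ((totient (2 * c))%:R * ((b - a) * t ^+ 2 / 4) +
   (totient (2 * c))%:R * ((b - a) * t ^+ 2 / 4)) by rewrite /T; field.
move: D2' D3'; set T' := (totient (2 * c))%:R * _ in e4 *; move=> D2' D3'.
have c2Q : (2 * c)%:R / Q%:R = 2 * (c%:R / Q%:R) :> R by rewrite natrM mulrA.
rewrite c2Q in D4 D2' D3'.
have hrest : `|d4 - 2 * (d2 + d3)| <= 2 * (K1 + 4 * K2) * (c%:R / Q%:R).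
  have -> : d4 - 2 * (d2 + d3) = (d4 - T) - 2 * ((d2 - T') + (d3 - T')).
    by rewrite e4; ring.
  apply: le_trans (ler_normB _ _) _; rewrite [`|2 * _|]normrM ger0_norm//.
  have := ler_normD (d2 - T') (d3 - T'); move: D4 D2' D3'; clear; lra.
have hodd : `|(odd g)%:R * (d4 - 2 * (d2 + d3))| <= 2 * (K1 + 4 * K2) * (c%:R / Q%:R).
  by case: (odd g); rewrite ?mul1r// mul0r normr0 !mulr_ge0//; move: K10 K20; clear; lra.
set x4 := (odd g)%:R * _ in hodd *.
have -> : d1 + x4 - (totient c)%:R * (b - a) =
  (d1 - (totient c)%:R * ((b - a) * t ^+ 2)) +
  (x4 + ((totient c)%:R * ((b - a) * t ^+ 2) - (totient c)%:R * (b - a))) by ring.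
have := ler_normD x4 ((totient c)%:R * ((b - a) * t ^+ 2) - (totient c)%:R * (b - a)).
have := ler_normD (d1 - (totient c)%:R * ((b - a) * t ^+ 2))
  (x4 + ((totient c)%:R * ((b - a) * t ^+ 2) - (totient c)%:R * (b - a))).
move: D1 hodd htt; clear; lra.
Qed.

End uniform_estimates.

(** * Summation over the divisors of N *)

Section summation.
Context {R : realType}.

Lemma sum_totient_divisors n : (0 < n)%N ->
  (\sum_(g <- divisors n) totient (n %/ g))%N = n.
Proof.
move=> n0; rewrite -[RHS]cyclic.sum_totient_dvd.
rewrite -(big_map (fun g => n %/ g)%N xpredT totient).
rewrite -[RHS](big_mkord (fun d => d %| n)%N) -[RHS]big_filter.
apply: perm_big; apply: uniq_perm; rewrite ?filter_uniq ?iota_uniq//.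
  rewrite map_inj_in_uniq ?divisors_uniq// => x y.
  rewrite -!dvdn_divisors// => hx hy h.
  have hq : (0 < n %/ x)%N by rewrite divn_gt0 ?(dvdn_gt0 n0 hx)// dvdn_leq.
  have e1 := divnK hx; have e2 := divnK hy.
  by apply/eqP; rewrite -(eqn_pmul2l hq) e1 h e2.
move=> d; rewrite mem_filter mem_index_iota ltnS /=; apply/mapP/andP.
  move=> [g]; rewrite -dvdn_divisors// => gn ->; split.
    by apply/dvdnP; exists g; rewrite mulnC divnK.
  by rewrite leq_div.
move=> [dn _]; exists (n %/ d)%N.
  rewrite -dvdn_divisors//; apply/dvdnP; exists d; by rewrite mulnC divnK.
by rewrite divnA// mulKn.
Qed.

(** An approximation p / q of al / 2 yields 2 p / q for al: the type is unchanged and the constant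
    is halved, so (E) gives the same s for both frequencies. *)
Lemma diophantine_half (kappa al : R) :
  diophantine kappa al -> diophantine kappa (al / 2).
Proof.
move=> [k0 irr [C C0 hC]]; split => //.
  apply: contra_not irr => -[q _ e]; exists (q * 2) => //.
  by rewrite rmorphM /= e ratr_nat divfK.
exists (C / 2); first by rewrite divr_gt0.
move=> p q q0; have := hC (2 * p) q q0; rewrite intrM => h.
have -> : al / 2 - p%:~R / q%:R = (al - 2 * p%:~R / q%:R) / 2 by field; rewrite pnatr_eq0 -lt0n.
by rewrite normrM normfV normr_nat mulrAC ltr_pM2r ?invr_gt0.
Qed.

(** The counting only needs A sandwiched between an open and a closed interval with the same
    endpoints, so the kinds of endpoints are forgotten. The empty interval is given a = b = 0. *)
Lemma interval_endpoints (A : interval R) : bounded_set [set` A] ->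
  exists a b : R, [/\ a <= b, forall x, x \in A -> a <= x <= b,
    forall x, a < x < b -> x \in A & fine (lebesgue_measure [set` A]) = b - a].
Proof.
move=> [M [_ hM]]; have {}hM x : x \in A -> `|x| <= M + 1.
  by apply: hM; rewrite ltrDl.
have [A0|/set0P[x0 x0A]] := eqVneq [set` A] set0.
  exists 0, 0; split => //.
  - by move=> x xA; have : [set` A] x by []; rewrite A0.
  - by move=> x /andP[]; lra.
  - by rewrite A0 measure0 subrr.
case: A hM x0A => l r hM x0A.
have noinfr : r <> +oo%O.
  move=> A2; have : `|x0| + `|M| + 2 \in Interval l r.
    move: x0A; rewrite /= !itv_boundlr A2 => /andP[h _]; apply/andP; split => //.
    apply: le_trans h _; rewrite bnd_simp; have := ler_norm x0; have := normr_ge0 M; lra.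
  move=> /hM; rewrite ger0_norm; have := ler_norm M; have := normr_ge0 x0;
    have := normr_ge0 M; lra.
have noinfl : l <> -oo%O.
  move=> A1; have : - (`|x0| + `|M| + 2) \in Interval l r.
    move: x0A; rewrite /= !itv_boundlr A1 => /andP[_ h]; apply/andP; split => //.
    apply: le_trans _ h; rewrite bnd_simp; have := ler_norm (- x0); rewrite normrN.
    by have := normr_ge0 M; lra.
  move=> /hM; rewrite normrN ger0_norm; have := ler_norm M; have := normr_ge0 x0;
    have := normr_ge0 M; lra.
case: l r hM x0A noinfr noinfl => [s a|[]] [t b|[]] //= hM x0A _ _.
exists a, b.
have hab x : x \in Interval (BSide s a) (BSide t b) -> a <= x <= b.
  by rewrite itv_boundlr; case: s {hM x0A}; case: t; rewrite !bnd_simp => /andP[h1 h2];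
    rewrite ?h1 ?h2 ?(ltW h1) ?(ltW h2).
have ab : a <= b by have /andP[h1 h2] := hab _ x0A; exact: le_trans h2.
split => //.
  by move=> x; rewrite itv_boundlr; case: s {hM x0A hab}; case: t; rewrite !bnd_simp => /andP[h1 h2];
    rewrite ?h1 ?h2 ?(ltW h1) ?(ltW h2).
rewrite lebesgue_measure_itv /= lte_fin.
by case: ltP => //= ba; apply/eqP; rewrite eq_sym subr_eq0 eq_le ba ab.
all: by move: x0A; rewrite itv_boundlr => /andP[].
Qed.

(** Each divisor g contributes an error O(N / Q), by the asymptotic count if g <= Q^(m+1) and by
    sparsity otherwise. The main terms add up to N (b - a), and the number of divisors multiplies
    the error. *)
Lemma correlation_bound (A : set R) (a b al C K s : R) (N Q m E C0 : nat) :
  (0 < N)%N -> (0 < Q)%N -> (forall x, A x -> a <= x <= b) -> a <= b -> 0 <= K ->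
  0 < C -> (forall D p : int, D != 0 -> C <= `|D%:~R| ^+ m * `|D%:~R * al - p%:~R|) ->
  (forall g c, N = (g * c)%N -> (0 < g)%N -> (C0 <= c)%N -> g%:R <= Q%:R ^+ m.+1 :> R ->
     Q%:R ^+ E <= c%:R `^ s ->
     `| #|gcd_pairs A al N g|%:R - (totient c)%:R * (b - a) | <= K * (c%:R / Q%:R)) ->
  b - a < Q%:R -> 2 ^+ m * (2 * (`|a| + `|b|)) < C * Q%:R -> (C0 <= Q)%N ->
  (Q ^ (2 * m.+1) <= N)%N -> Q%:R ^+ E <= N%:R `^ (s / 2) -> 0 <= s ->
  `| pair_correlation N A (fun z : R => (z - al) ^+ 2 / (2 * N%:R)) - (b - a) | <=
    (K + 6 + (b - a)) * ((size (divisors N))%:R / Q%:R).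
Proof.
move=> N0 Q0 hA ab K0 C0' hC hg baQ hQC CQ QN QE s0.
have NR : 0 < N%:R :> R by rewrite ltr0n.
have QR : 0 < Q%:R :> R by rewrite ltr0n.
have ba : 0 <= b - a by rewrite subr_ge0.
have Q1 : (Q <= Q ^ m.+1)%N by rewrite -{1}(expn1 Q) leq_pexp2l.
have cNQ c : (c <= N)%N -> c%:R / Q%:R <= N%:R / Q%:R :> R.
  by move=> h; rewrite ler_pM2r ?invr_gt0// ler_nat.
have NQ0 : 0 <= N%:R / Q%:R :> R by rewrite divr_ge0.
have term g : g \in divisors N ->
    `| #|gcd_pairs A al N g|%:R - (totient (N %/ g))%:R * (b - a) | <=
    (K + 6 + (b - a)) * (N%:R / Q%:R).
  rewrite -dvdn_divisors// => gN.
  have g0 : (0 < g)%N by exact: dvdn_gt0 gN.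
  pose c := (N %/ g)%N; have eN : N = (g * c)%N by rewrite mulnC divnK.
  have c0 : (0 < c)%N by move: N0; rewrite eN muln_gt0 => /andP[].
  have cN : (c <= N)%N by rewrite leq_div.
  rewrite -/c; have [gQ|gQ] := leqP g (Q ^ m.+1).
    have cQ : (Q ^ m.+1 <= c)%N.
      rewrite -(leq_pmul2l (_ : 0 < Q ^ m.+1)%N) ?expn_gt0 ?Q0//.
      rewrite -expnD addnn -mul2n (leq_trans QN)// [X in (X <= _)%N]eN leq_mul2r gQ orbT//.
    have hcs : Q%:R ^+ E <= c%:R `^ s.
      apply: le_trans QE _.
      (* Since g <= Q^(m+1) <= c, one has N <= c^2: a power of N bounds a power of c from below. *)
      have -> : c%:R `^ s = (c%:R ^+ 2) `^ (s / 2) :> R.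
        by rewrite -powR_mulrn// -powRrM mulrCA mulfV// mulr1.
      apply: ge0_ler_powR; rewrite ?nnegrE ?divr_ge0 ?exprn_ge0//.
      by rewrite -natrX ler_nat [X in (X <= _)%N]eN -mulnn leq_mul2r (leq_trans gQ cQ) orbT.
    have gQR : g%:R <= Q%:R ^+ m.+1 :> R by rewrite -natrX ler_nat.
    have C0c : (C0 <= c)%N by rewrite (leq_trans CQ)// (leq_trans Q1).
    apply: le_trans (hg g c eN g0 C0c gQR hcs) _.
    apply: ler_pM; first exact: K0.
    - by rewrite divr_ge0.
    - by move: ba; clear; lra.
    - exact: cNQ.
  have gQR : Q%:R ^+ m.+1 < g%:R :> R by rewrite -natrX ltr_nat.
  have gQ1 : (Q < g)%N by apply: leq_ltn_trans gQ.
  have bag : b - a < g%:R by apply: lt_trans baQ _; rewrite ltr_nat.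
  (* Of the m + 1 factors Q below g, m match (2 Q)^m and the last one absorbs the constants. *)
  have hfar : (2 * Q%:R) ^+ m * (2 * (`|a| + `|b|)) < C * g%:R.
    apply: lt_trans (_ : C * (Q%:R ^+ m.+1) < _); last by rewrite ltr_pM2l.
    rewrite exprMn mulrAC exprS mulrA ltr_pM2r// exprn_gt0//.
  have hcard := large_gcd_bound N0 gN Q0 hA C0' hC bag hfar.
  have hc1 : #|gcd_pairs A al N g|%:R <= 6 * (N%:R / Q%:R) :> R.
    by rewrite mulrA ler_pdivlMr// -!natrM ler_nat.
  (* For large g the expected main term is itself an error, as c = N / g < N / Q. *)
  have hc2 : (totient c)%:R <= N%:R / Q%:R :> R.
    rewrite ler_pdivlMr// -natrM ler_nat [X in (_ <= X)%N]eN mulnC.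
    by apply: leq_mul; [exact: ltnW|exact: totient_le].
  have hc3 := ler_wpM2r ba hc2.
  rewrite (le_trans (ler_normB _ _))// normr_nat ger0_norm ?mulr_ge0//.
  have := mulr_ge0 K0 NQ0; move: hc1 hc3; clear; lra.
rewrite pair_correlation_gcd//.
have -> : (\sum_(g <- divisors N) #|gcd_pairs A al N g|)%:R / N%:R - (b - a) =
    N%:R^-1 * \sum_(g <- divisors N)
      (#|gcd_pairs A al N g|%:R - (totient (N %/ g))%:R * (b - a)).
  rewrite sumrB -mulr_suml -!natr_sum sum_totient_divisors//.
  by field; rewrite gt_eqF.
rewrite normrM normfV normr_nat ler_pdivrMl//.
apply: le_trans (ler_norm_sum _ _ _) _.
apply: (@le_trans _ _ (\sum_(g <- divisors N) (K + 6 + (b - a)) * (N%:R / Q%:R))).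
  by rewrite big_seq [X in _ <= X]big_seq; apply: ler_sum => g /term.
rewrite big_const_seq count_predT iter_addr addr0 -mulr_natr.
by rewrite le_eqVlt; apply/orP; left; apply/eqP; ring.
Qed.

End summation.

(** * Choice of the exponents and the final estimate *)

Lemma divisor_bound_powR (R : realType) (t : R) : 0 < t ->
  exists2 K : R, 0 <= K & forall N, (0 < N)%N ->
    (size (divisors N))%:R <= K * N%:R `^ t.
Proof.
move=> t0; pose r := Num.truncn t^-1.
have [K hK] := divisor_bound r.
exists K.+1%:R => // N N0.
have N1 : 1 <= N%:R :> R by rewrite ler1n.
rewrite -(@ler_pXn2r _ r.+1)// ?nnegrE ?mulr_ge0 ?powR_ge0//.
rewrite exprMn -(powR_mulrn _ (powR_ge0 N%:R t)) -powRrM -!natrX.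
apply: (@le_trans _ _ (K%:R * N%:R)); first by rewrite -natrM ler_nat hK.
apply: ler_pM => //.
  by rewrite ler_nat (leq_trans (leqnSn K))// -{1}(expn1 K.+1) leq_pexp2l.
rewrite -[X in X <= _]powRr1//; apply: ler_powR => //.
by rewrite -ler_pdivrMl// mulr1 ltW// truncnS_gt.
Qed.

Lemma powR_near_large (R : realType) (eta M : R) : 0 < eta ->
  \forall N \near \oo, M <= N%:R `^ eta.
Proof.
move=> e0; pose B := Num.max M 1.
have B1 : 1 <= B by rewrite le_max lexx orbT.
exists (Num.truncn (B `^ eta^-1)).+1 => // N /= hN.
apply: (@le_trans _ _ B); first by rewrite le_max lexx.
have -> : B = (B `^ eta^-1) `^ eta.
  by rewrite -powRrM mulVf ?gt_eqF// powRr1// (le_trans _ B1).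
apply: ge0_ler_powR; rewrite ?nnegrE ?powR_ge0 ?(ltW e0)//.
by apply: le_trans (ltW (truncnS_gt _)) _; rewrite ler_nat.
Qed.

Theorem proposition2p5 (R : realType) :
  equidistribution R ->
  exists2 kappa0 : R, 2 <= kappa0 &
  forall kappa : R, kappa <= kappa0 -> exists2 s : R, 0 < s &
  forall alpha : R, diophantine kappa alpha ->
  forall A : interval R, bounded_set [set` A] -> exists K : R,
  \forall N \near \oo,
    `| pair_correlation N [set` A]
         (fun z : R => (z - alpha) ^+ 2 / (2 * N%:R))
       - fine (lebesgue_measure [set` A]) |
    <= K * N%:R `^ (- s).
Proof.
move=> /equidistribution_boxes [e [kappa0 k2 hbox]].
exists kappa0 => // kappa hk; have [s s0 {}hbox] := hbox kappa hk.
pose m := Num.truncn kappa; pose E := (m.+3 * e.+1)%N.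
have E0 : 0 < E%:R :> R by rewrite ltr0n.
(* For Q <= N^eta the first entry gives Q^(2 (m+1)) <= N, so that small g leave a large c; the
   second gives Q^E <= N^(s/2), the condition under which (E) beats the smoothing. *)
pose eta : R := Num.min (2 * m.+1)%:R^-1 (s / 2 / E%:R).
have eta0 : 0 < eta by rewrite lt_min invr_gt0 ltr0n /= !divr_gt0.
(* The saving 1 / Q is of order N^-eta, and half of the exponent is given up to the number of
   divisors. *)
exists (eta / 2); first by rewrite divr_gt0.
move=> al hal A hA.
have [a [b [ab hA1 hA2 ->]]] := interval_endpoints hA.
have km : kappa <= m.+1%:R by exact/ltW/truncnS_gt.
have [C C0 hC] := diophantine_separated hal km.
have [K1 [C1 [K10 hg]]] := gcd_pairs_estimate m.+1 (ltW s0) (hbox _ hal)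
  (hbox _ (diophantine_half hal)) ab hA1 hA2.
have [K2 K20 hdiv] := divisor_bound_powR (divr_gt0 eta0 (ltr0Sn R 1)).
(* The sum of all lower bounds required of Q, so that each follows from M < Q. *)
pose M := 4 + C1%:R + (b - a) + 2 ^+ m * (2 * (`|a| + `|b|)) / C + 1.
have ba : 0 <= b - a by rewrite subr_ge0.
have q0 : 0 <= 2 ^+ m * (2 * (`|a| + `|b|)) / C.
  by rewrite divr_ge0 ?(ltW C0)// mulr_ge0 ?exprn_ge0// mulr_ge0// addr_ge0.
exists ((K1 + 6 + (b - a)) * (K2 * 2)).
have large := @powR_near_large R eta (M + 1) eta0.
near=> N.
have NM : M + 1 <= N%:R `^ eta by near: N.
have N0 : (0 < N)%N by near: N; exists 1%N.
have N1 : 1 <= N%:R :> R by rewrite ler1n.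
have pN : 0 <= N%:R `^ eta by exact: powR_ge0.
pose Q := Num.truncn (N%:R `^ eta).
have QN : Q%:R <= N%:R `^ eta by rewrite truncn_le.
have QN1 : N%:R `^ eta < Q%:R + 1 by rewrite natr1 truncnS_gt.
have QM : M < Q%:R by move: NM QN1; clear; lra.
have c10 : 0 <= C1%:R :> R by [].
have Q4R : 4 <= Q%:R :> R by move: QM ba q0 c10; rewrite /M; clear; lra.
have Q4 : (4 <= Q)%N by rewrite -(ler_nat R).
have Q0 : (0 < Q)%N by exact: leq_trans Q4.
have QR : 0 < Q%:R :> R by rewrite ltr0n.
have Qpow n x : eta * n%:R <= x -> Q%:R ^+ n <= N%:R `^ x.
  move=> h; apply: (@le_trans _ _ ((N%:R `^ eta) ^+ n)).
    by rewrite lerXn2r ?nnegrE.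
  by rewrite -powR_mulrn// -powRrM; apply: ler_powR.
have QpN : (Q ^ (2 * m.+1) <= N)%N.
  rewrite -(ler_nat R) natrX -[X in _ <= X]powRr1//; apply: Qpow.
  by rewrite -ler_pdivlMr ?ltr0n// div1r ge_min lexx.
have QE : Q%:R ^+ E <= N%:R `^ (s / 2).
  by apply: Qpow; rewrite -ler_pdivlMr// ge_min lexx orbT.
have QleN : (Q <= N)%N.
  by apply: leq_trans QpN; rewrite -{1}(expn1 Q) leq_pexp2l.
have hgcd g c : N = (g * c)%N -> (0 < g)%N -> (C1 <= c)%N ->
    g%:R <= Q%:R ^+ m.+1 :> R -> Q%:R ^+ E <= c%:R `^ s ->
    `| #|gcd_pairs [set` A] al N g|%:R - (totient c)%:R * (b - a) | <=
      K1 * (c%:R / Q%:R).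
  by move=> *; exact: hg.
have baQ : b - a < Q%:R by move: QM q0 c10; rewrite /M; clear; lra.
have hQC : 2 ^+ m * (2 * (`|a| + `|b|)) < C * Q%:R.
  by rewrite -ltr_pdivrMl// mulrC; move: QM ba c10; rewrite /M; clear; lra.
have C1Q : (C1 <= Q)%N by rewrite -(ler_nat R); move: QM ba q0; rewrite /M; clear; lra.
have hmain := correlation_bound N0 Q0 hA1 ab K10 C0 hC hgcd baQ hQC C1Q QpN QE (ltW s0).
apply: le_trans hmain _; rewrite -mulrA; apply: ler_wpM2l.
  by move: K10 ba; clear; lra.
have pe : 0 < N%:R `^ eta by rewrite powR_gt0// ltr0n.
have hQ : Q%:R^-1 <= 2 * N%:R `^ (- eta).
  rewrite powRN -div1r ler_pdivrMr// mulrAC ler_pdivlMr// mul1r.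
  by move: QN1 Q4R; clear; lra.
have -> : K2 * 2 * N%:R `^ (- (eta / 2)) =
    (K2 * N%:R `^ (eta / 2)) * (2 * N%:R `^ (- eta)).
  have -> : - (eta / 2) = eta / 2 + - eta by field.
  rewrite powRD; first by ring.
  by apply/implyP => _; rewrite pnatr_eq0 -lt0n.
by apply: ler_pM; rewrite ?invr_ge0//; exact: hdiv.
Unshelve. all: by end_near. Qed.
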